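(* Let $X \subseteq \mathbb{P}^n(\overline{\mathbb{F}_q})$ be a smooth irreducible projective curve, defined over $\mathbb{F}_q$, and let $\xi : X \rightarrow \mathbb{P}^1(\overline{\mathbb{F}_q})$ be a finite separable surjective morphism. Then there exist $m \in \mathbb{N}$ and $\mathfrak{G}_m = \mathrm{Gal}(\overline{\mathbb{F}_q}/\mathbb{F}_{q^m})$-submodules $X_o \subseteq X$, $L_o \subseteq \mathbb{P}^1(\overline{\mathbb{F}_q})$ with at most finite complements $X \setminus X_o$, $\mathbb{P}^1(\overline{\mathbb{F}_q}) \setminus L_o$, such that the restriction $\xi : X_o \rightarrow L_o$ is a finite covering of $\mathfrak{G}_m$-modules with a Galois closure $\xi_H : Z_o \rightarrow L_o$, supported by a smooth quasi-projective curve $Z_o \subseteq \mathbb{P}^k(\overline{\mathbb{F}_q})$.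
   Context: $\mathbb{F}_q$ is a finite field. For $k\in\mathbb{N}=\{1,2,\dots\}$, $\mathfrak{G}_k=\mathrm{Gal}(\overline{\mathbb{F}_q}/\mathbb{F}_{q^k})$ is topologically generated by $\Phi_q^k$, where $\Phi_q(a)=a^q$. A dominant morphism of smooth irreducible quasi-projective curves is finite (respectively, finite separable) if the induced extension of function fields over $\overline{\mathbb{F}_q}$ is finite (respectively, finite separable). A $\mathfrak{G}_k$-module is a set with an action of $\mathfrak{G}_k$; a submodule is an invariant subset; it is locally finite if all orbits are finite and for every $n\in\mathbb{N}$ there are at most finitely many orbits of cardinality $n$. Subvarieties of projective space defined over $\mathbb{F}_{q^k}$ are locally finite $\mathfrak{G}_k$-modules through the action on homogeneous coordinates. Finite covering: a surjective $\mathfrak{G}_k$-equivariant map $\xi:M\to L$ of locally finite $\mathfrak{G}_k$-modules is a finite covering of degree $n$ if there are at most finitely many $x_1,\dots,x_s\in L$ with $|\xi^{-1}(x)|=n$ for all $x\in L\setminus\{x_1,\dots,x_s\}$ and $|\xi^{-1}(x_i)|<n$ for all $i$. Galois coverings and Galois closure: for an infinite locally finite $\mathfrak{G}_s$-module $N$, $\mathfrak{G}_s$ is treated as a subgroup of $\mathrm{Sym}(N)$ via its action and $Z(\mathfrak{G}_s)$ denotes its centralizer in $\mathrm{Sym}(N)$. If $H\le Z(\mathfrak{G}_s)$ is a finite subgroup with $H\cap\mathfrak{G}_s=\{\mathrm{Id}_N\}$ and $\mathrm{Stab}_H(z)=\{\mathrm{Id}_N\}$ for all but at most finitely many $z\in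 N$, then $N/H$ is a locally finite $\mathfrak{G}_s$-module by $\gamma\,\mathrm{Orb}_H(z)=\mathrm{Orb}_H(\gamma z)$ and $\xi_H:N\to N/H$, $z\mapsto\mathrm{Orb}_H(z)$, is called an $H$-Galois covering. A finite covering $\xi:M\to L$ of locally finite $\mathfrak{G}_k$-modules has a Galois closure $\xi_H:N\to L$ if there exist $s\in k\mathbb{N}$, an infinite locally finite $\mathfrak{G}_s$-module $N$ and finite subgroups $H_1\le H\le Z(\mathfrak{G}_s)\le\mathrm{Sym}(N)$ with $H\cap\mathfrak{G}_s=\{\mathrm{Id}_N\}$ and $\mathrm{Stab}_H(z)=\{\mathrm{Id}_N\}$ for all but finitely many $z\in N$, such that $M=N/H_1$, $L=N/H$ (as $\mathfrak{G}_s$-modules, up to equivariant bijection) and $\xi_H=\xi\circ\xi_{H_1}$. That the Galois closure is supported by the curve $Z_o$ means that $N=Z_o$ as a set with Galois action. *)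

(* Defs.v *)
From HB Require Import structures.
From mathcomp Require Import all_boot all_order all_algebra all_field.
From mathcomp Require Import boolp classical_sets functions cardinality.
From mathcomp Require Import mpoly.

Set Implicit Arguments.
Unset Strict Implicit.
Unset Printing Implicit Defensive.

Import GRing.Theory.
Local Open Scope ring_scope.
Local Open Scope quotient_scope.
Local Open Scope classical_set_scope.
Local Open Scope card_scope.

Section ProjectiveSpace.
Variables (K : closedFieldType) (n : nat).

Definition hvec := {v : 'rV[K]_n.+1 | v != 0}.

(* Two nonzero vectors are proportional iff they have the same row space. *)
Definition proportional (u v : hvec) : bool := (val u == val v)%MS.

Lemma proportional_equiv : equiv_class_of proportional.
Proof.
split=> [u|u v|v u w]; rewrite /proportional.
- by apply/andP; split; apply: submx_refl.
- by rewrite andbC.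
- move=> /andP[uv vu] /andP[vw wv].
  by apply/andP; split; [apply: submx_trans uv vw|apply: submx_trans wv vu].
Qed.

Canonical proportional_equivRel := EquivRelPack proportional_equiv.

Definition proj := {eq_quot proportional}.

HB.instance Definition _ := EqQuotient.on proj.
HB.instance Definition _ := Choice.on proj.

Lemma const1_neq0 : const_mx 1 != 0 :> 'rV[K]_n.+1.
Proof. by apply/eqP => /matrixP/(_ 0 0)/eqP; rewrite !mxE oner_eq0. Qed.

(* The point [v_0 : ... : v_n]; only meaningful when v != 0. *)
Definition pt (v : 'rV[K]_n.+1) : proj :=
  \pi_proj (insubd (exist _ (const_mx 1) const1_neq0 : hvec) v).

HB.instance Definition _ := isPointed.Build proj (pt (const_mx 1)).

Definition coords (x : proj) : 'rV[K]_n.+1 := val (repr x).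

(* Value of p at the chosen homogeneous coordinates of x.  It is only used where
   the choice is immaterial: vanishing of homogeneous polynomials, quotients of
   two of the same degree, and tuples of the same degree up to a scalar. *)
Definition evalp (p : {mpoly K[n.+1]}) (x : proj) : K := p.@[coords x 0].

Lemma coords_neq0 x : coords x != 0.
Proof. exact: (valP (repr x)). Qed.

Lemma coordsK x : pt (coords x) = x.
Proof. by rewrite /pt /coords valKd reprK. Qed.

Lemma pt_eq u v : u != 0 -> v != 0 -> (u == v)%MS -> pt u = pt v.
Proof.
move=> u0 v0 uv; apply/eqP; rewrite eqmodE /= /proportional.
by rewrite !insubdK.
Qed.

Lemma coords_pt v : v != 0 -> (coords (pt v) == v)%MS.
Proof.
move=> v0; have: pt (coords (pt v)) == pt v by rewrite coordsK.
by rewrite eqmodE /= /proportional !insubdK //; apply: coords_neq0.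
Qed.

End ProjectiveSpace.

Section Zariski.
Variables (K : closedFieldType) (n : nat).
Implicit Types (X U C : set (proj K n)) (p r : {mpoly K[n.+1]}).

Definition zlocus (S : set {mpoly K[n.+1]}) : set (proj K n) :=
  [set x | forall p, S p -> evalp p x = 0].

Definition zclosed C :=
  exists2 S : set {mpoly K[n.+1]},
    (forall p, S p -> exists d, p \is d.-homog) & C = zlocus S.

Definition zopen U := zclosed (~` U).

Definition zirreducible X :=
  X !=set0 /\
  forall C1 C2, zclosed C1 -> zclosed C2 ->
    X `<=` C1 `|` C2 -> X `<=` C1 \/ X `<=` C2.

Definition quasi_projective X :=
  exists C U, [/\ zclosed C, zopen U & X = C `&` U].

(* A chain Y 0 < ... < Y d of irreducible closed subsets of X. *)
Definition zchain X (d : nat) :=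
  exists Y : nat -> set (proj K n),
    (forall i, (i <= d)%N ->
       zirreducible (Y i) /\ exists2 C, zclosed C & Y i = X `&` C) /\
    (forall i, (i < d)%N -> Y i `<` Y i.+1).

Definition has_dim X (d : nat) := zchain X d /\ ~ zchain X d.+1.

(* Jacobian criterion on the affine cone: the common kernel of the
   differentials at x of all homogeneous polynomials vanishing on X (the tangent
   space of the cone, which contains the line x) has dimension d + 1. *)
Definition smooth_at X (d : nat) (x : proj K n) :=
  exists2 T : {vspace 'rV[K]_n.+1},
    (forall v : 'rV[K]_n.+1, v \in T <->
       forall p e, p \is e.-homog -> X `<=` [set y | evalp p y = 0] ->
         \sum_(i < n.+1) evalp p^`M(i) x * v 0 i = 0)
    & \dim T = d.+1.

Definition smooth X (d : nat) := forall x, X x -> smooth_at X d x.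

Definition zclosed_over (F : fieldType) (iota : {rmorphism F -> K}) C :=
  exists2 S : set {mpoly F[n.+1]},
    (forall p : {mpoly F[n.+1]}, S p -> exists d, p \is d.-homog)
    & C = zlocus (map_mpoly iota @` S).

Definition regular_at X (f : proj K n -> K) (x : proj K n) :=
  exists U d p r,
    [/\ zopen U, U x, p \is d.-homog, r \is d.-homog &
        forall y, X y -> U y -> evalp r y != 0 /\ f y = evalp p y / evalp r y].

(* f : proj K n -> K represents a rational function on X if it is regular on a
   nonempty open subset U of X; its values outside U are irrelevant. *)
Definition rational X (f : proj K n -> K) :=
  exists U, [/\ zopen U, X `&` U !=set0 &
                forall x, X x -> U x -> regular_at X f x].

Definition generically X (P : proj K n -> Prop) :=
  exists U, [/\ zopen U, X `&` U !=set0 & forall x, X x -> U x -> P x].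

Lemma zopenT : zopen [set: proj K n].
Proof.
exists [set 1] => [p ->|]; first by exists 0; rewrite dhomog1.
apply/seteqP; split=> x /=; first by move=> /(_ I).
by move=> /(_ _ erefl)/eqP; rewrite /evalp meval1 oner_eq0.
Qed.

Lemma zopenI U V : zopen U -> zopen V -> zopen (U `&` V).
Proof.
move=> [S hS eS] [T hT eT].
exists [set p | exists a b, [/\ S a, T b & p = a * b]].
  move=> _ [a [b [/hS[d ha] /hT[e hb] ->]]].
  by exists (d + e)%N; apply: dhomogM.
rewrite setCI eS eT; apply/seteqP; split=> x /=.
  move=> [h|h] _ [a [b [Sa Tb ->]]]; rewrite /evalp mevalM.
    by rewrite [X in X * _](h _ Sa) mul0r.
  by rewrite [X in _ * X](h _ Tb) mulr0.
move=> h; have [|/existsNP[a /not_implyP[Sa /eqP a0]]] := pselect (zlocus S x).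
  by left.
right=> b Tb; have /eqP := h _ (ex_intro _ a (ex_intro _ b (And3 Sa Tb erefl))).
by rewrite /evalp mevalM mulf_eq0 => /orP[/(negP a0)//|/eqP].
Qed.

Lemma zopen_neq0 p d : p \is d.-homog -> zopen [set x | evalp p x != 0].
Proof.
move=> hp; exists [set p] => [_ ->|]; first by exists d.
apply/seteqP; split=> x /=; first by move=> /negP; rewrite negbK => /eqP ? _ ->.
by move=> /(_ _ erefl) ->; rewrite eqxx.
Qed.

Lemma irreducible_openI X U V : zirreducible X -> zopen U -> zopen V ->
  X `&` U !=set0 -> X `&` V !=set0 -> X `&` (U `&` V) !=set0.
Proof.
move=> [_ irrX] oU oV [x [Xx Ux]] [y [Xy Vy]].
have [[z]|e] := pselect (X `&` (U `&` V) !=set0); first by exists z.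
suff [/(_ _ Xx)//|/(_ _ Xy)//] : X `<=` ~` U \/ X `<=` ~` V.
apply: irrX => // z Xz; rewrite -setCI => UVz.
by apply: e; exists z.
Qed.

Lemma genericallyI X P Q : zirreducible X -> generically X P ->
  generically X Q -> generically X (fun x => P x /\ Q x).
Proof.
move=> irrX [U [oU nU hU]] [V [oV nV hV]]; exists (U `&` V); split.
- exact: zopenI.
- exact: irreducible_openI.
- by move=> x Xx [Ux Vx]; split; [apply: hU|apply: hV].
Qed.

Lemma genericallyW X (P Q : proj K n -> Prop) : (forall x, P x -> Q x) ->
  generically X P -> generically X Q.
Proof. by move=> PQ [U [? ? h]]; exists U; split=> // x Xx Ux; apply/PQ/h. Qed.

Lemma generically_true X (P : proj K n -> Prop) :
  X !=set0 -> (forall x, P x) -> generically X P.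
Proof.
by move=> X0 h; exists setT; split=> //; [exact: zopenT|rewrite setIT].
Qed.

Lemma regular_at_cst X c x : regular_at X (fun=> c) x.
Proof.
exists setT, 0%N, c%:MP, 1; split=> //; first exact: zopenT.
- by rewrite -[c%:MP]mulr1 mul_mpolyC dhomogZ // dhomog1.
- exact: dhomog1.
- by move=> y _ _; rewrite /evalp meval1 mevalC divr1 oner_neq0.
Qed.

Lemma regular_atB X f g x : regular_at X f x -> regular_at X g x ->
  regular_at X (f - g) x.
Proof.
move=> [U [d [p [r [oU Ux hp hr h]]]]] [V [e [a [b [oV Vx ha hb h']]]]].
exists (U `&` V), (d + e)%N, (p * b - r * a), (r * b).
split; [exact: zopenI|by []| |exact: dhomogM|].
  by rewrite rpredB // dhomogM.
move=> y Xy [Uy Vy]; have [r0 fE] := h _ Xy Uy; have [b0 gE] := h' _ Xy Vy.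
rewrite /evalp in r0 fE b0 gE *; rewrite mevalB !mevalM mulf_neq0 //; split=> //.
rewrite -[LHS]/(f y - g y) fE gE -mulNr addf_div // mulNr.
by rewrite [_.@[_] * r.@[_]]mulrC.
Qed.

Lemma regular_atM X f g x : regular_at X f x -> regular_at X g x ->
  regular_at X (f * g) x.
Proof.
move=> [U [d [p [r [oU Ux hp hr h]]]]] [V [e [a [b [oV Vx ha hb h']]]]].
exists (U `&` V), (d + e)%N, (p * a), (r * b).
split; [exact: zopenI|by []|exact: dhomogM|exact: dhomogM|].
move=> y Xy [Uy Vy]; have [r0 fE] := h _ Xy Uy; have [b0 gE] := h' _ Xy Vy.
rewrite /evalp in r0 fE b0 gE *; rewrite !mevalM mulf_neq0 //; split=> //.
by rewrite -[LHS]/(f y * g y) fE gE mulf_div.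
Qed.

Lemma regular_at_inv X f x : X x -> regular_at X f x -> f x != 0 ->
  exists U d p r, [/\ zopen U, U x, p \is d.-homog, r \is d.-homog &
    forall y, X y -> U y ->
      [/\ evalp p y != 0, evalp r y != 0 & f y = evalp p y / evalp r y]].
Proof.
move=> Xx [U [d [p [r [oU Ux hp hr h]]]]] fx0.
exists (U `&` [set y | evalp p y != 0]), d, p, r; split=> //.
- by apply: zopenI => //; apply: zopen_neq0 hp.
- split=> //=; move: fx0; have [r0 ->] := h _ Xx Ux.
  by apply: contraNN => /eqP ->; rewrite mul0r.
- by move=> y Xy [Uy py]; have [? ?] := h _ Xy Uy.
Qed.

End Zariski.

(* The field K(X) of rational functions on an irreducible X: representatives of
   rational functions modulo equality on a nonempty open subset of X. *)
Section FunctionField.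
Variables (K : closedFieldType) (n : nat) (X : set (proj K n)).
Variable irrX : zirreducible X.

Definition rationalb of zirreducible X : {pred proj K n -> K} :=
  fun f => `[< rational X f >].

Lemma rational_subring : subring_closed (rationalb irrX).
Proof.
split=> [|f g /asboolP fR /asboolP gR|f g /asboolP fR /asboolP gR]; apply/asboolP.
- by apply: generically_true => [|x]; [case: irrX|apply: regular_at_cst].
- apply: genericallyW (genericallyI irrX fR gR) => x [].
  exact: regular_atB.
- apply: genericallyW (genericallyI irrX fR gR) => x [].
  exact: regular_atM.
Qed.

HB.instance Definition _ :=
  GRing.isSubringClosed.Build _ (rationalb irrX) rational_subring.

Record ratfun := RatFun { ratfun_val :> proj K n -> K;
                          _ : ratfun_val \in rationalb irrX }.

HB.instance Definition _ := [isSub for ratfun_val].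
HB.instance Definition _ := [Choice of ratfun by <:].
HB.instance Definition _ := [SubChoice_isSubComNzRing of ratfun by <:].

Definition gen_zero : {pred ratfun} :=
  fun f => `[< generically X (fun x => f x = 0) >].

Lemma gen_zero_ideal : idealr_closed gen_zero.
Proof.
split.
- by apply/asboolP/generically_true => //; case: irrX.
- apply/asboolP => -[U [_ [x [Xx Ux]] /(_ _ Xx Ux)/eqP]].
  by rewrite -[ratfun_val 1]/(1 : proj K n -> K) -[_ x]/(1 : K) oner_eq0.
- move=> a f g /asboolP f0 /asboolP g0; apply/asboolP.
  apply: genericallyW (genericallyI irrX f0 g0) => x [fx gx].
  by rewrite -[LHS]/(a x * f x + g x) fx gx mulr0 addr0.
Qed.

HB.instance Definition _ := isIdealr.Build _ gen_zero gen_zero_ideal.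

Definition funfield := {ideal_quot gen_zero}.

HB.instance Definition _ := GRing.ComNzRing.on funfield.

Definition germ (f : ratfun) : funfield := \pi_funfield f.

Lemma germ0 : germ 0 = 0. Proof. by rewrite /germ (rmorph0 \pi_funfield). Qed.

Lemma germ1 : germ 1 = 1. Proof. by rewrite /germ (rmorph1 \pi_funfield). Qed.

Lemma germM f g : germ (f * g) = germ f * germ g.
Proof. by rewrite /germ (rmorphM \pi_funfield). Qed.

Lemma germP f g : germ f = germ g <-> generically X (fun x => f x = g x).
Proof.
have -> : germ f = germ g <-> f - g \in gen_zero.
  by rewrite Quotient.idealrBE; split=> [/eqP|/eqP].
split=> [/asboolP|h]; last (apply/asboolP; move: h).
  by apply: genericallyW => x /eqP; rewrite subr_eq0 => /eqP.
by apply: genericallyW => x fg; apply/eqP; rewrite subr_eq0; apply/eqP.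
Qed.

Lemma funfield_inv (a : funfield) : exists b : funfield, a != 0 -> b * a = 1.
Proof.
have [->|] := eqVneq a 0; first by exists 0.
have <- : germ (repr a) = a by rewrite /germ reprK.
set f := repr a => f0.
have nz : ~ generically X (fun x => f x = 0).
  by move=> h; move/negP: f0; apply; rewrite -germ0; apply/eqP/germP.
have /asboolP [U [oU nU hU]] := valP f.
have [x [Xx Ux] fx0] : exists2 x, (X `&` U) x & f x != 0.
  apply: contrapT => h; apply: nz; exists U; split=> // x Xx Ux.
  by apply/eqP/negPn/negP => fx; apply: h; exists x.
have [V [d [p [r [oV Vx hp hr h]]]]] := regular_at_inv Xx (hU _ Xx Ux) fx0.
pose g : proj K n -> K := fun y => evalp r y / evalp p y.
have gR : g \in rationalb irrX.
  apply/asboolP; exists V; split=> //; first by exists x.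
  move=> y Xy Vy; exists V, d, r, p; split=> // z Xz Vz.
  by have [] := h _ Xz Vz.
exists (germ (RatFun gR)) => _; rewrite -germM -germ1.
apply/germP; exists V; split=> //; first by exists x.
move=> y Xy Vy; have [p0 r0 fy] := h _ Xy Vy.
rewrite -[LHS]/(g y * f y) -[RHS]/(1 : K) fy /g mulf_div.
by rewrite [_ * evalp p y]mulrC divff // mulf_neq0.
Qed.

Definition funfield_invf (a : funfield) : funfield :=
  if a == 0 then 0 else sval (cid (funfield_inv a)).

Lemma funfield_mulVf (a : funfield) : a != 0 -> funfield_invf a * a = 1.
Proof.
by move=> a0; rewrite /funfield_invf ifN //; case: cid => b /=; apply.
Qed.

Lemma funfield_invf0 : funfield_invf 0 = 0.
Proof. by rewrite /funfield_invf ifT. Qed.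

HB.instance Definition _ :=
  GRing.ComNzRing_isField.Build funfield funfield_mulVf funfield_invf0.

End FunctionField.

Section Morphisms.
Variables (K : closedFieldType) (n m : nat).
Variables (X : set (proj K n)) (Y : set (proj K m)).
(* The values of xi outside X are irrelevant. *)
Variable xi : proj K n -> proj K m.

Definition is_morphism :=
  (forall x, X x -> Y (xi x)) /\
  forall x, X x ->
    exists U d (p : 'I_m.+1 -> {mpoly K[n.+1]}),
      [/\ zopen U, U x, forall i, p i \is d.-homog &
          forall y, X y -> U y ->
            \row_i evalp (p i) y != 0 /\ xi y = pt (\row_i evalp (p i) y)].

(* g = xi^* f : some representatives satisfy g = f \o xi on a nonempty open
   subset of X. *)
Definition is_pullback (irrX : zirreducible X) (irrY : zirreducible Y)
    (f : funfield irrY) (g : funfield irrX) :=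
  exists f0 g0, [/\ germ f0 = f, germ g0 = g &
                    generically X (fun x => g0 x = f0 (xi x))].

(* The extension K(X) / xi^* K(Y) is finite separable: K(X), as an extension of
   K(Y) along xi^*, is isomorphic to a (finite dimensional) separable field
   extension L of K(Y). *)
Definition finite_separable :=
  exists (irrX : zirreducible X) (irrY : zirreducible Y)
         (L : fieldExtType (funfield irrY))
         (phi : {rmorphism L -> funfield irrX}),
    [/\ bijective phi,
        forall f : funfield irrY, is_pullback f (phi f%:A) &
        separable 1 {:L}].

End Morphisms.

(* Modules over the absolute Galois groups Gal(K / F_(q^k)), q = #|F|, where K
   is an algebraic closure of the finite field F. *)
Section GaloisModules.
Variables (F : finFieldType) (K : closedFieldType).

(* F_(q^k) is the set of roots of 'X^(q^k) - 'X in K. *)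
Record gal (k : nat) := Gal {
  gal_fun :> {rmorphism K -> K};
  gal_bij : bijective gal_fun;
  gal_fix : forall a : K, a ^+ (#|F| ^ k) = a -> gal_fun a = a }.

Lemma gal_eq k (g h : gal k) : gal_fun g = gal_fun h -> g = h.
Proof.
case: g h => [g gb gf] [h hb hf] /= gh; subst h.
by congr Gal; apply: Prop_irrelevance.
Qed.

Definition gal_one k : gal k :=
  @Gal k (idfun : {rmorphism K -> K}) (Bijective (fun=> erefl) (fun=> erefl))
    (fun a _ => erefl).

Definition gal_mul k (g h : gal k) : gal k :=
  @Gal k (gal_fun g \o gal_fun h : {rmorphism K -> K})
    (bij_comp (gal_bij g) (gal_bij h))
    (fun a ha => etrans (congr1 g (gal_fix h ha)) (gal_fix g ha)).

Lemma frob_fix_dvd k s (a : K) : (k %| s)%N ->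
  a ^+ (#|F| ^ k) = a -> a ^+ (#|F| ^ s) = a.
Proof.
move=> /dvdnP[t ->] ha; elim: t => [|t IH]; first by rewrite mul0n expn0 expr1.
by rewrite mulSn expnD exprM ha.
Qed.

Definition gal_incl k s (ks : (k %| s)%N) (g : gal s) : gal k :=
  Gal (gal_bij g) (fun a ha => gal_fix g (frob_fix_dvd ks ha)).

Lemma gal_incl_one k s (ks : (k %| s)%N) : gal_incl ks (gal_one s) = gal_one k.
Proof. exact: gal_eq. Qed.

Lemma gal_incl_mul k s (ks : (k %| s)%N) (g h : gal s) :
  gal_incl ks (gal_mul g h) = gal_mul (gal_incl ks g) (gal_incl ks h).
Proof. exact: gal_eq. Qed.

Record gmodule (k : nat) := GModule {
  gm_sort :> Type;
  act : gal k -> gm_sort -> gm_sort;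
  act_one : forall x, act (gal_one k) x = x;
  act_mul : forall g h x, act (gal_mul g h) x = act g (act h x) }.

Section Restriction.
Variables (k s : nat) (ks : (k %| s)%N) (M : gmodule k).

Definition res_act (g : gal s) : M -> M := act (gal_incl ks g).

Lemma res_act_one x : res_act (gal_one s) x = x.
Proof. by rewrite /res_act gal_incl_one act_one. Qed.

Lemma res_act_mul g h x : res_act (gal_mul g h) x = res_act g (res_act h x).
Proof. by rewrite /res_act gal_incl_mul act_mul. Qed.

Definition gm_res : gmodule s := GModule res_act_one res_act_mul.

End Restriction.

Definition equivariant k (M L : gmodule k) (f : M -> L) :=
  forall g x, f (act g x) = act g (f x).

Definition gorbit k (M : gmodule k) (x : M) : set M := range (fun g => act g x).

Definition locally_finite k (M : gmodule k) :=
  (forall x : M, finite_set (gorbit x)) /\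
  forall n : nat,
    finite_set [set O : set M | (exists x, O = gorbit x) /\ O #= `I_n].

Definition finite_covering k (n : nat) (M L : gmodule k) (xi : M -> L) :=
  [/\ locally_finite M, locally_finite L, equivariant xi,
      forall y, exists x, xi x = y &
      exists S : set L,
        [/\ finite_set S,
            forall y, ~ S y -> xi @^-1` [set y] #= `I_n &
            forall y, S y -> exists2 m, (m < n)%N & xi @^-1` [set y] #= `I_m]].

Definition proj_act n k (g : gal k) (x : proj K n) : proj K n :=
  pt (map_mx g (coords x)).

Definition gal_stable n k (A : set (proj K n)) :=
  forall (g : gal k) x, A x -> A (proj_act g x).

Lemma proj_act_one n k (x : proj K n) : proj_act (gal_one k) x = x.
Proof.
rewrite -[RHS]coordsK /proj_act; congr (pt _).
by apply/matrixP => i j; rewrite mxE.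
Qed.

Lemma proj_act_mul n k (g h : gal k) (x : proj K n) :
  proj_act (gal_mul g h) x = proj_act g (proj_act h x).
Proof.
have c0 := coords_neq0 x; have hc0 : map_mx h (coords x) != 0.
  by rewrite map_mx_eq0.
apply: pt_eq; rewrite ?map_mx_eq0 ?coords_neq0 //.
have -> : map_mx (gal_mul g h) (coords x) = map_mx g (map_mx h (coords x)).
  by apply/matrixP => i j; rewrite !mxE.
by rewrite !map_submx andbC; apply: coords_pt.
Qed.

Section Submodule.
Variables (n k : nat) (A : set (proj K n)) (sA : gal_stable k A).

Definition sub_act (g : gal k) (x : {x | A x}) : {x | A x} :=
  exist A (proj_act g (sval x)) (sA g (svalP x)).

Lemma sub_act_one x : sub_act (gal_one k) x = x.
Proof. by case: x => x Ax; apply: eq_exist; apply: proj_act_one. Qed.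

Lemma sub_act_mul g h x : sub_act (gal_mul g h) x = sub_act g (sub_act h x).
Proof. by case: x => x Ax; apply: eq_exist; apply: proj_act_mul. Qed.

Definition proj_gmodule : gmodule k := GModule sub_act_one sub_act_mul.

End Submodule.

Definition restr n m (A : set (proj K n)) (B : set (proj K m))
    (xi : proj K n -> proj K m) (AB : forall x, A x -> B (xi x)) :
  {x | A x} -> {y | B y} := fun x => exist B (xi (sval x)) (AB _ (svalP x)).

Section GaloisCoverings.
Variables (s : nat) (N : gmodule s).

Definition sym_subgroup (H : set (N -> N)) :=
  [/\ forall h, H h -> bijective h, H id,
      forall h1 h2, H h1 -> H h2 -> H (h1 \o h2) &
      forall h h', H h -> cancel h h' -> cancel h' h -> H h'].

Definition centralizer : set (N -> N) :=
  [set h : N -> N | bijective h /\ forall g z, h (act g z) = act g (h z)].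

Definition orb (H : set (N -> N)) (z : N) : set N := [set h z | h in H].

Definition orbit_space (H : set (N -> N)) := {O : set N | exists z, O = orb H z}.

Definition orbit_map (H : set (N -> N)) (z : N) : orbit_space H :=
  exist _ (orb H z) (ex_intro _ z erefl).

Lemma act_orb (H : set (N -> N)) g z : H `<=` centralizer ->
  act g @` orb H z = orb H (act g z).
Proof.
move=> HZ; apply/seteqP; split=> [_ [_ [h Hh <-] <-]|_ [h Hh <-]].
  by exists h => //; rewrite (HZ _ Hh).2.
by exists (h z); [exists h|rewrite (HZ _ Hh).2].
Qed.

Section OrbitModule.
Variables (H : set (N -> N)) (HZ : H `<=` centralizer).

Lemma act_orbit_space g (O : orbit_space H) :
  exists z, act g @` sval O = orb H z.
Proof. by have [z ->] := svalP O; exists (act g z); apply: act_orb. Qed.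

Definition orbit_act g (O : orbit_space H) : orbit_space H :=
  exist _ (act g @` sval O) (act_orbit_space g O).

Lemma orbit_act_one O : orbit_act (gal_one s) O = O.
Proof.
case: O => [O hO]; apply: eq_exist => /=.
apply/seteqP; split=> [_ [x Ox <-]|x Ox]; first by rewrite act_one.
by exists x => //; rewrite act_one.
Qed.

Lemma orbit_act_mul g h O :
  orbit_act (gal_mul g h) O = orbit_act g (orbit_act h O).
Proof.
case: O => [O hO]; apply: eq_exist => /=; rewrite image_comp.
by apply: eq_imagel => x _ /=; rewrite act_mul.
Qed.

Definition orbit_gmodule : gmodule s := GModule orbit_act_one orbit_act_mul.

End OrbitModule.

(* N, with finite groups H1 <= H <= Z(G_s), gives a Galois closure
   orbit_map H : N -> L of xi : M -> L; a and b are the identifications of N/H1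
   and N/H with the G_s-modules M and L. *)
Definition galois_closure k (ks : (k %| s)%N) (M L : gmodule k) (xi : M -> L) :=
  [/\ infinite_set [set: N], locally_finite N &
   exists H1 H (H1Z : H1 `<=` centralizer) (HZ : H `<=` centralizer),
    [/\ sym_subgroup H1, sym_subgroup H, finite_set H & H1 `<=` H] /\
    [/\ forall h, H h -> (exists g : gal s, h = act g) -> h = id,
        finite_set [set z | exists h, [/\ H h, h z = z & h <> id]] &
        exists (a : orbit_gmodule H1Z -> gm_res ks M)
               (b : orbit_gmodule HZ -> gm_res ks L),
          [/\ bijective a, equivariant a, bijective b, equivariant b &
              forall z : N, b (orbit_map H z) = xi (a (orbit_map H1 z))]]].

End GaloisCoverings.
End GaloisModules.

(* Main.v *)
Require Import Defs.
From HB Require Import structures.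
From mathcomp Require Import all_boot all_order all_fingroup all_algebra.
From mathcomp Require Import all_field.
From mathcomp Require Import boolp classical_sets functions cardinality.
From mathcomp Require Import mpoly ring.

Set Implicit Arguments.
Unset Strict Implicit.
Unset Printing Implicit Defensive.

Import GRing.Theory.
Local Open Scope ring_scope.
Local Open Scope classical_set_scope.

(** The covering xi : X -> P^1 is a plane curve over the line. The function
    field of X is a finite separable extension of K(t), where t is the
    coordinate of the line; by the primitive element theorem it is K(t)(u),
    and u has a polynomial f(t, u) = 0 of minimal degree d with separable
    roots. An identity between polynomials in (t, u) that holds in the
    function field is a multiple of f, up to a power of the leading
    coefficient, and so holds at all points of the curve f = 0 over a good t;
    an expression that is not zero in the function field has no zeros on f = 0
    outside finitely many t, by a Bezout relation with f. Hence, over the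
    values of t that are not roots of one polynomial, the points of X are the
    pairs (t, u) with f(t, u) = 0, the map xi is (t, u) |-> t, and the fibres
    are the d distinct roots of f(t, _) [plane_model]. Only finitely many
    points of X are lost, because the function field has transcendence degree
    one [algebraic_dependence, finite_zeros].

    The Galois closure consists of the orderings w = (w_0, ..., w_(d-1)) of
    the fibres. The symmetric group S_d acts on them freely; two orderings lie
    over the same t exactly when S_d exchanges them, and they have the same
    first point (t, w_0) exactly when the stabilizer of 0 exchanges them. So
    the quotient by S_d is the line and the quotient by the stabilizer is X.
    To make the set of orderings a curve, an ordering is replaced by the value
    z of a linear form in w_0, ..., w_(d-1) whose conjugates under S_d are
    distinct. The product F(t, z) of the d! factors z - (value) is symmetric
    in the roots, therefore a polynomial in t and z [resolvent]. The roots of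
    F(t, _) are simple for good t, which makes the curve F = 0 smooth
    [smooth_plane_curve], and its closed subsets are controlled by
    divisibility of polynomials in z over K[t], which gives dimension one
    [has_dim_plane_curve].

    All these constructions involve finitely many constants of K. Each of them
    is algebraic over F_q, so a common power F_(q^m) contains them all, and
    every map above commutes with Gal(K / F_(q^m)). An automorphism that acts
    on the orderings as a permutation of S_d fixes t, hence almost all
    elements of K, hence all of them; so S_d meets the Galois group trivially
    [galois_closure_xi]. *)

(** * Points and homogeneous polynomials *)

Section MPolyValues.
Variables (n : nat) (R : nzRingType).

Lemma rmorph_mmap (S T : comNzRingType) (f : {rmorphism R -> S})
    (g : {rmorphism S -> T}) (h : 'I_n -> S) (p : {mpoly R[n]}) :
  g (mmap f h p) = mmap (g \o f) (g \o h) p.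
Proof.
rewrite /mmap rmorph_sum; apply: eq_bigr => m _; rewrite rmorphM rmorph_prod.
by congr (_ * _); apply: eq_bigr => i _; rewrite rmorphXn.
Qed.

Lemma eq_mmap (S : comNzRingType) (f g : R -> S) (h k : 'I_n -> S)
    (p : {mpoly R[n]}) : f =1 g -> h =1 k -> mmap f h p = mmap g k p.
Proof.
move=> fg hk; rewrite /mmap; apply: eq_bigr => m _; rewrite fg.
by congr (_ * _); apply: eq_bigr => i _; rewrite hk.
Qed.

Lemma mmap_homogZ (S : comNzRingType) (f : {rmorphism R -> S}) (h : 'I_n -> S)
    (c : S) d (p : {mpoly R[n]}) : p \is d.-homog ->
  mmap f (fun i => c * h i) p = c ^+ d * mmap f h p.
Proof.
move=> /dhomogP hp; rewrite /mmap mulr_sumr big_seq [RHS]big_seq.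
apply: eq_bigr => m /hp dm; rewrite mulrCA; congr (_ * _).
rewrite /mmap1 (eq_bigr _ (fun i _ => exprMn _ (c) (h i))) big_split /=.
by rewrite prodrXr -mdegE dm.
Qed.

End MPolyValues.

Lemma meval_homogZ n (K : comNzRingType) (h : 'I_n -> K) (c : K) d
  (p : {mpoly K[n]}) : p \is d.-homog ->
  p.@[fun i => c * h i] = c ^+ d * p.@[h].
Proof. exact: (@mmap_homogZ n K K idfun). Qed.

Section ProjectivePoints.
Variables (K : closedFieldType) (n : nat).

Lemma coords_ptE (v : 'rV[K]_n.+1) : v != 0 ->
  exists2 c : K, c != 0 & coords (pt v) = c *: v.
Proof.
move=> v0; have /andP[/sub_rVP[c e] _] := coords_pt v0; exists c => //.
by apply/eqP => c0; have := coords_neq0 (pt v); rewrite e c0 scale0r eqxx.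
Qed.

Lemma evalp_pt (v : 'rV[K]_n.+1) d : v != 0 ->
  exists2 c : K, c != 0 &
    forall p : {mpoly K[n.+1]}, p \is d.-homog -> evalp p (pt v) = c * p.@[v 0].
Proof.
move=> /coords_ptE[c c0 e]; exists (c ^+ d); first by rewrite expf_neq0.
move=> p hp; rewrite /evalp e -(meval_homogZ _ _ hp).
by apply: meval_eq => i; rewrite mxE.
Qed.

Lemma evalp_pt_eq0 (v : 'rV[K]_n.+1) d (p : {mpoly K[n.+1]}) : v != 0 ->
  p \is d.-homog -> (evalp p (pt v) == 0) = (p.@[v 0] == 0).
Proof.
by move=> v0 hp; have [c c0 ->] // := evalp_pt d v0; rewrite mulf_eq0 (negPf c0).
Qed.

(** Cross products express proportionality without naming the factor, so that
    an equality of points becomes a family of polynomial identities. *)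
Lemma pt_eq_cross (u v : 'rV[K]_n.+1) : u != 0 -> v != 0 ->
  (forall i j, u 0 i * v 0 j = u 0 j * v 0 i) -> pt u = pt v.
Proof.
move=> u0 v0 uv; have /rV0Pn[i ui] := u0.
have vi : v 0 i != 0.
  apply: contraNneq v0 => vi; apply/eqP/rowP => j; rewrite mxE.
  by have /eqP := uv i j; rewrite vi mulr0 mulf_eq0 (negPf ui) => /eqP.
apply: pt_eq => //; apply/andP; split; apply/sub_rVP.
  exists (u 0 i / v 0 i); apply/rowP => j; rewrite mxE mulrAC uv.
  by rewrite mulfK.
exists (v 0 i / u 0 i); apply/rowP => j; rewrite mxE mulrAC.
by rewrite [v 0 i * _]mulrC -uv mulrAC mulfV // mul1r.
Qed.

Lemma dhomogC (c : K) : (c%:MP : {mpoly K[n]}) \is 0.-homog.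
Proof. by rewrite -[c%:MP]mulr1 mul_mpolyC dhomogZ // dhomog1. Qed.

Lemma dhomogXU i : ('X_i : {mpoly K[n]}) \is 1.-homog.
Proof. by rewrite dhomogX /= mdeg1. Qed.

End ProjectivePoints.

Section Irreducible.
Variables (K : closedFieldType) (n : nat).
Implicit Types (X U C : set (proj K n)) (p r : {mpoly K[n.+1]}).

Lemma zclosed_eq0 d p : p \is d.-homog -> zclosed [set x | evalp p x = 0].
Proof.
move=> hp; exists [set p] => [_ ->|]; first by exists d.
by apply/seteqP; split=> x /= => [h _ ->|->].
Qed.

(** Open sets are complements of arbitrary systems of equations; this reduces
    them to the nonvanishing of one polynomial. *)
Lemma zopen_basic U x : zopen U -> U x ->
  exists d p, [/\ p \is d.-homog, evalp p x != 0 &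
                  forall y, evalp p y != 0 -> U y].
Proof.
move=> [S hS eU] Ux.
have [|/existsNP[p /not_implyP[Sp /eqP p0]]] := pselect (zlocus S x).
  by rewrite -eU => /(_ Ux).
have [d hp] := hS _ Sp; exists d, p; split=> // y py; apply: contrapT => Uy.
by have : (~` U) y by []; rewrite eU => /(_ _ Sp)/eqP; apply/negP.
Qed.

(** Irreducibility turns a closed condition that holds on a nonempty open
    subset into one that holds everywhere. In this way identities in the
    function field become identities at all points. *)
Lemma generically_eq0 X d p : zirreducible X -> p \is d.-homog ->
  generically X (fun x => evalp p x = 0) <-> forall x, X x -> evalp p x = 0.
Proof.
move=> [X0 irrX] hp; split=> [[U [oU [x [Xx Ux]] hU]]|h]; last first.
  exists setT; split=> [||x /h //]; first exact: zopenT.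
  by rewrite setIT.
have [|//|/(_ _ Xx)//] := irrX _ (~` U) (zclosed_eq0 hp) oU _.
by move=> y Xy; have [/(hU _ Xy)|] := pselect (U y); [left|right].
Qed.

Lemma generically_neq0 X d p x : p \is d.-homog -> X x -> evalp p x != 0 ->
  generically X (fun x => evalp p x != 0).
Proof.
move=> hp Xx px; exists [set y | evalp p y != 0].
by split=> //; [exact: zopen_neq0 hp|exists x].
Qed.

Lemma irreducible_neq0M X p r d e : zirreducible X ->
    p \is d.-homog -> r \is e.-homog ->
  (forall x, X x -> evalp p x * evalp r x = 0) ->
  (forall x, X x -> evalp p x = 0) \/ (forall x, X x -> evalp r x = 0).
Proof.
move=> [_ irrX] hp hr h; apply: irrX (zclosed_eq0 hp) (zclosed_eq0 hr) _.
by move=> x /h/eqP; rewrite mulf_eq0 => /orP[] /eqP; [left|right].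
Qed.

End Irreducible.

(** A polynomial p without a nonzero value would make p + 1 a polynomial
    without roots. *)
Lemma poly_nonroot (K : closedFieldType) (p : {poly K}) : p != 0 ->
  exists c, p.[c] != 0.
Proof.
move=> p0; have [/size_poly1P[c c0 ->]|s1] := boolP (size p == 1%N).
  by exists 0; rewrite hornerC.
have /closed_rootP[c] : size (p + 1) != 1%N.
  apply: contraNneq s1 => s1; rewrite eqn_leq size_poly_gt0 p0 andbT.
  rewrite -[p](addrK (1 : {poly K})) (leq_trans (size_polyD _ _)) //.
  by rewrite geq_max s1 size_polyN size_poly1.
rewrite /root hornerD hornerC addr_eq0 => /eqP pc; exists c.
by rewrite pc oppr_eq0 oner_neq0.
Qed.

Lemma finite_roots (K : closedFieldType) (p : {poly K}) : p != 0 ->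
  finite_set [set c | p.[c] = 0].
Proof.
move=> p0; have [s e] := closed_field_poly_normal p.
apply/finite_seqP; exists s; apply/seteqP; split=> c /=.
  move=> /rootP; rewrite e rootZ ?lead_coef_eq0 //.
  by rewrite root_prod_XsubC.
by move=> cs; apply/rootP; rewrite e rootZ ?lead_coef_eq0 // root_prod_XsubC.
Qed.

Lemma closed_field_infinite (K : closedFieldType) : infinite_set [set: K].
Proof.
move=> /finite_seqP[s e]; have := @poly_nonroot K (\prod_(c <- s) ('X - c%:P)).
case=> [|c]; first by rewrite monic_neq0 // monic_prod_XsubC.
have : [set` s] c by rewrite -e.
by rewrite /= -root_prod_XsubC => /rootP ->; rewrite eqxx.
Qed.

(** * The function field and its generic point *)

Section FunctionFieldPoint.
Variables (K : closedFieldType) (n : nat) (X : set (proj K n)).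
Variable irrX : zirreducible X.
Implicit Types (p r a b : {mpoly K[n.+1]}).
Local Open Scope quotient_scope.
Local Notation E := (funfield irrX).
Local Notation ratE := (ratfun irrX).

Definition evr (x : proj K n) (f : ratE) : K := f x.

Lemma evr_is_zmod_morphism x : zmod_morphism (evr x).
Proof. by []. Qed.

Lemma evr_is_monoid_morphism x : monoid_morphism (evr x).
Proof. by []. Qed.

HB.instance Definition _ x :=
  GRing.isZmodMorphism.Build ratE K (evr x) (evr_is_zmod_morphism x).
HB.instance Definition _ x :=
  GRing.isMonoidMorphism.Build ratE K (evr x) (evr_is_monoid_morphism x).

Lemma germ_is_zmod_morphism : zmod_morphism (@germ K n X irrX).
Proof. by move=> f g; rewrite /germ (rmorphB \pi_E). Qed.

Lemma germ_is_monoid_morphism : monoid_morphism (@germ K n X irrX).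
Proof. by split=> [|f g]; [exact: germ1|exact: germM]. Qed.

HB.instance Definition _ := GRing.isZmodMorphism.Build ratE E
  (@germ K n X irrX) germ_is_zmod_morphism.
HB.instance Definition _ := GRing.isMonoidMorphism.Build ratE E
  (@germ K n X irrX) germ_is_monoid_morphism.

Lemma rational_cst c : (fun=> c : K) \in rationalb irrX.
Proof.
apply/asboolP; apply: generically_true; first by case: irrX.
by move=> x; apply: regular_at_cst.
Qed.

Definition rcst (c : K) : ratE := RatFun (rational_cst c).

Lemma rcst_is_zmod_morphism : zmod_morphism rcst.
Proof. by move=> c d; apply: val_inj; apply/funext => x. Qed.

Lemma rcst_is_monoid_morphism : monoid_morphism rcst.
Proof. by split=> [|c d]; apply: val_inj; apply/funext => x. Qed.

HB.instance Definition _ :=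
  GRing.isZmodMorphism.Build K ratE rcst rcst_is_zmod_morphism.
HB.instance Definition _ :=
  GRing.isMonoidMorphism.Build K ratE rcst rcst_is_monoid_morphism.

Definition constE (c : K) : E := germ (rcst c).

Lemma constE_is_zmod_morphism : zmod_morphism constE.
Proof. by move=> c d; rewrite /constE !rmorphB. Qed.

Lemma constE_is_monoid_morphism : monoid_morphism constE.
Proof. by split=> [|c d]; rewrite /constE ?rmorph1 ?rmorphM. Qed.

HB.instance Definition _ :=
  GRing.isZmodMorphism.Build K E constE constE_is_zmod_morphism.
HB.instance Definition _ :=
  GRing.isMonoidMorphism.Build K E constE constE_is_monoid_morphism.

Lemma rational_ratio d a b x : a \is d.-homog -> b \is d.-homog -> X x ->
  evalp b x != 0 -> (fun y => evalp a y / evalp b y) \in rationalb irrX.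
Proof.
move=> ha hb Xx bx; apply/asboolP; exists [set y | evalp b y != 0].
have ob := zopen_neq0 hb; split=> [//||y Xy by0]; first by exists x.
by exists [set y | evalp b y != 0], d, a, b.
Qed.

Lemma coord_nonvanishing : exists i x, X x /\ coords x 0 i != 0.
Proof.
have [[x Xx] _] := irrX; have /rV0Pn[i xi] := coords_neq0 x.
by exists i, x.
Qed.

(** The germs of the coordinates, dehomogenized by one that does not vanish on
    the curve, behave as the homogeneous coordinates of a generic point. *)
Lemma funfield_generic_point : exists y : 'I_n.+1 -> E,
  forall (f : ratE) d a b, a \is d.-homog -> b \is d.-homog ->
    germ f * mmap constE y b = mmap constE y a <->
    generically X (fun x => f x * evalp b x = evalp a x).
Proof.
have [i0 [x0 [Xx0 xi0]]] := coord_nonvanishing.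
pose r : {mpoly K[n.+1]} := 'X_i0.
have hr : r \is 1.-homog by apply: dhomogXU.
have rE x : evalp r x = coords x 0 i0 by rewrite /evalp mevalXU.
have ratY j : (fun x => evalp 'X_j x / evalp r x) \in rationalb irrX.
  by apply: (rational_ratio (dhomogXU _ j) hr Xx0); rewrite rE.
pose Y j : ratE := RatFun (ratY j).
pose y j := germ (Y j); exists y => f d a b ha hb.
have yE p : mmap constE y p = germ (mmap rcst Y p) by rewrite rmorph_mmap.
have YE p x : p \is d.-homog ->
    mmap rcst Y p x = (evalp r x)^-1 ^+ d * evalp p x.
  move=> hp; rewrite -[LHS]/(evr x _) rmorph_mmap /evalp /meval.
  rewrite -(mmap_homogZ _ _ _ hp); apply: eq_mmap => // j.
  by rewrite /= /evr /= /evalp mevalXU mulrC.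
rewrite !yE -germM germP.
have gr : generically X (fun x => evalp r x != 0).
  by apply: generically_neq0 hr Xx0 _; rewrite rE.
have fE x : (f * mmap rcst Y b : ratE) x =
    f x * ((evalp r x)^-1 ^+ d * evalp b x) by rewrite -YE.
split=> h; apply: genericallyW (genericallyI irrX gr h) => x [rx] {h}.
  rewrite fE YE // mulrCA.
  by apply: mulfI; rewrite expf_neq0 // invr_eq0.
by move=> h; rewrite fE YE // mulrCA h.
Qed.

Section GenericPoint.
Variable y : 'I_n.+1 -> E.
Hypothesis yP : forall (f : ratE) d a b, a \is d.-homog -> b \is d.-homog ->
    germ f * mmap constE y b = mmap constE y a <->
    generically X (fun x => f x * evalp b x = evalp a x).
Local Notation gev := (mmap constE y).

Lemma generic_vanishing d p : p \is d.-homog ->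
  gev p = 0 <-> forall x, X x -> evalp p x = 0.
Proof.
move=> hp; rewrite -(generically_eq0 irrX hp).
have := yP 0 hp (rpred0 _); rewrite mmap0 mulr0 => h.
have e : (0 = gev p) <-> (gev p = 0) by split.
rewrite -e h; split; apply: genericallyW => x.
  by rewrite -[ratfun_val 0 x]/(0 : K) mul0r.
by rewrite -[ratfun_val 0 x]/(0 : K) mul0r.
Qed.

Lemma generic_neq0 d p x : p \is d.-homog -> X x -> evalp p x != 0 ->
  gev p != 0.
Proof.
move=> hp Xx; apply: contra => /eqP /(generic_vanishing hp) h.
by apply/eqP; apply: h.
Qed.

Lemma ratfun_fraction (f : ratE) : exists d a b,
  [/\ a \is d.-homog, b \is d.-homog, gev b != 0 &
      germ f * gev b = gev a].
Proof.
have /asboolP[U [oU [x [Xx Ux]] hU]] := valP f.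
have [V [d [a [b [oV Vx ha hb h]]]]] := hU _ Xx Ux.
exists d, a, b; split=> //.
  by apply: (generic_neq0 hb Xx); case: (h _ Xx Vx).
apply/(yP _ ha hb); exists V; split=> //; first by exists x.
by move=> z Xz Vz; have [bz ->] := h _ Xz Vz; rewrite divfK.
Qed.

Lemma funfield_fraction (alpha : E) : exists d a b,
  [/\ a \is d.-homog, b \is d.-homog, gev b != 0 & alpha * gev b = gev a].
Proof.
have <- : germ (generic_quotient.repr alpha) = alpha by rewrite /germ reprK.
exact: ratfun_fraction.
Qed.

Lemma germ_cst (f : ratE) c : generically X (fun x => f x = c) ->
  germ f = constE c.
Proof.
move=> fc; have g1 : mmap constE y 1 = 1 by apply: rmorph1.
rewrite -[constE c](mmapC y constE) -[germ f]mulr1 -g1.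
apply/(yP f (dhomogC _ c) (dhomog1 _ _)); apply: genericallyW fc => x ->.
by rewrite /evalp meval1 mevalC mulr1.
Qed.

End GenericPoint.
End FunctionFieldPoint.
Arguments constE : simpl never.

(** * Polynomials in two variables *)

Section Evaluation.
Variables (K A : comNzRingType) (f : {rmorphism K -> A}).

Definition ev1 (t : A) (p : {poly K}) : A := (map_poly f p).[t].

Lemma ev1E t p : ev1 t p = (map_poly f p).[t].
Proof. by []. Qed.

Lemma ev1_is_zmod_morphism t : zmod_morphism (ev1 t).
Proof. by move=> p q; rewrite !ev1E rmorphB hornerD hornerN. Qed.

Lemma ev1_is_monoid_morphism t : monoid_morphism (ev1 t).
Proof.
by split=> [|p q]; rewrite !ev1E ?rmorph1 ?hornerC // rmorphM hornerM.
Qed.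

HB.instance Definition _ t :=
  GRing.isZmodMorphism.Build {poly K} A (ev1 t) (ev1_is_zmod_morphism t).
HB.instance Definition _ t :=
  GRing.isMonoidMorphism.Build {poly K} A (ev1 t) (ev1_is_monoid_morphism t).

(** Polynomials in two variables t, u are polynomials in u with coefficients
    in K[t]: the divisibility theory that matters is the one with respect to
    u. *)
Definition ev2 (t u : A) (g : {poly {poly K}}) : A := (map_poly (ev1 t) g).[u].

Lemma ev2E t u g : ev2 t u g = (map_poly (ev1 t) g).[u].
Proof. by []. Qed.

Lemma ev2_is_zmod_morphism t u : zmod_morphism (ev2 t u).
Proof. by move=> p q; rewrite !ev2E rmorphB hornerD hornerN. Qed.

Lemma ev2_is_monoid_morphism t u : monoid_morphism (ev2 t u).
Proof.
by split=> [|p q]; rewrite !ev2E ?rmorph1 ?hornerC // rmorphM hornerM.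
Qed.

HB.instance Definition _ t u :=
  GRing.isZmodMorphism.Build {poly {poly K}} A (ev2 t u)
    (ev2_is_zmod_morphism t u).
HB.instance Definition _ t u :=
  GRing.isMonoidMorphism.Build {poly {poly K}} A (ev2 t u)
    (ev2_is_monoid_morphism t u).

Lemma ev1C t c : ev1 t c%:P = f c.
Proof. by rewrite ev1E map_polyC hornerC. Qed.

Lemma ev1X t : ev1 t 'X = t.
Proof. by rewrite ev1E map_polyX hornerX. Qed.

Lemma ev2C t u p : ev2 t u p%:P = ev1 t p.
Proof. by rewrite ev2E map_polyC hornerC. Qed.

Lemma ev2X t u : ev2 t u 'X = u.
Proof. by rewrite ev2E map_polyX hornerX. Qed.

Lemma ev2_cross t u p q : ev2 t u ('X%:P * p - q) = t * ev2 t u p - ev2 t u q.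
Proof. by rewrite rmorphB rmorphM /= ev2C ev1X. Qed.

Lemma ev2_crossX t u p q : ev2 t u ('X * p - q) = u * ev2 t u p - ev2 t u q.
Proof. by rewrite rmorphB rmorphM /= ev2X. Qed.

End Evaluation.
Arguments ev1 : simpl never.
Arguments ev2 : simpl never.

Lemma rmorph_ev1 (K A B : comNzRingType) (f : {rmorphism K -> A})
    (g : {rmorphism A -> B}) t p : g (ev1 f t p) = ev1 (g \o f) (g t) p.
Proof. by rewrite !ev1E map_poly_comp horner_map. Qed.

Lemma ev1_id (K : comNzRingType) (t : K) p : ev1 idfun t p = p.[t].
Proof. by rewrite ev1E map_poly_id. Qed.

Lemma clear_denominators_step (A : comNzRingType) (a b c : A) (s : {poly A}) :
  b%:P * (a%:P * s) * 'X + (a * (b * c))%:P = (a * b)%:P * (s * 'X + c%:P).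
Proof.
rewrite mulrDr; congr (_ + _); last by rewrite -polyCM mulrA.
by rewrite polyCM mulrCA !mulrA.
Qed.

Section HomogeneousComposition.
Variables (K : comNzRingType) (n m : nat) (d : nat).
Variable q : 'I_m -> {mpoly K[n]}.
Hypothesis hq : forall i, q i \is d.-homog.

Lemma dhomog_comp e (p : {mpoly K[m]}) : p \is e.-homog ->
  mmap (@mpolyC n K) q p \is (d * e)%N.-homog.
Proof.
move=> /dhomogP hp; rewrite /mmap big_seq rpred_sum // => k /hp dk.
have {dk} <- : mdeg k = e := dk; rewrite mul_mpolyC dhomogZ //.
rewrite /mmap1 mdegE big_distrr /=.
apply: (big_ind2 (fun s (x : {mpoly K[n]}) => x \is s.-homog)).
- exact: dhomog1.
- by move=> *; apply: dhomogM.
- by move=> i _; apply: dhomogMn.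
Qed.

Lemma meval_comp (p : {mpoly K[m]}) (v : 'I_n -> K) :
  (mmap (@mpolyC n K) q p).@[v] = p.@[fun i => (q i).@[v]].
Proof.
rewrite (rmorph_mmap _ (meval v)); apply: eq_mmap => // c /=.
by rewrite mevalC.
Qed.

End HomogeneousComposition.

(** Clearing denominators: substituting the fractions p1/p0 and a/b of
    homogeneous polynomials into a polynomial in two variables gives a
    homogeneous polynomial, up to powers of p0 and b. Stating the identity in
    every ring makes it usable both at the points of a curve and at its
    generic point. *)
Lemma homogenize (K : comNzRingType) n (p0 p1 a b : {mpoly K[n]}) d e
    (g : {poly {poly K}}) :
    p0 \is d.-homog -> p1 \is d.-homog -> a \is e.-homog -> b \is e.-homog ->
  exists N M G, G \is (d * N + e * M)%N.-homog /\
    forall (A : comNzRingType) (f : {rmorphism K -> A}) (v : 'I_n -> A) (t u : A),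
      t * mmap f v p0 = mmap f v p1 -> u * mmap f v b = mmap f v a ->
      mmap f v G = mmap f v p0 ^+ N * mmap f v b ^+ M * ev2 f t u g.
Proof.
move=> hp0 hp1 ha hb.
pose H g := exists N M G, G \is (d * N + e * M)%N.-homog /\
    forall (A : comNzRingType) (f : {rmorphism K -> A}) (v : 'I_n -> A) (t u : A),
      t * mmap f v p0 = mmap f v p1 -> u * mmap f v b = mmap f v a ->
      mmap f v G = mmap f v p0 ^+ N * mmap f v b ^+ M * ev2 f t u g.
have HD g1 g2 : H g1 -> H g2 -> H (g1 + g2).
  move=> [N [M [G [hG eG]]]] [N' [M' [G' [hG' eG']]]].
  exists (N + N')%N, (M + M')%N,
    (G * (p0 ^+ N' * b ^+ M') + G' * (p0 ^+ N * b ^+ M)); split.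
    rewrite rpredD //.
      have -> : (d * (N + N') + e * (M + M') =
                 (d * N + e * M) + (d * N' + e * M'))%N.
        by rewrite !mulnDr addnACA.
      by do !apply: dhomogM => //; apply: dhomogMn.
    have -> : (d * (N + N') + e * (M + M') =
               (d * N' + e * M') + (d * N + e * M))%N.
      by rewrite !mulnDr addnACA [RHS]addnC.
    by do !apply: dhomogM => //; apply: dhomogMn.
  move=> A f v t u tE uE; rewrite !(rmorphD, rmorphM, rmorphXn) /=.
  rewrite (eG _ _ _ _ _ tE uE) (eG' _ _ _ _ _ tE uE) !exprD; ring.
have HM g1 g2 : H g1 -> H g2 -> H (g1 * g2).
  move=> [N [M [G [hG eG]]]] [N' [M' [G' [hG' eG']]]].
  exists (N + N')%N, (M + M')%N, (G * G'); split.
    by rewrite !mulnDr addnACA dhomogM.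
  move=> A f v t u tE uE; rewrite !rmorphM /=.
  rewrite (eG _ _ _ _ _ tE uE) (eG' _ _ _ _ _ tE uE) !exprD.
  by rewrite mulrACA; congr (_ * _); rewrite mulrACA.
have HC c : H c%:P%:P.
  exists 0%N, 0%N, c%:MP; split.
    by rewrite !muln0 -[c%:MP]mulr1 mul_mpolyC dhomogZ // dhomog1.
  by move=> A f v t u _ _; rewrite mmapC ev2C ev1C !expr0 !mul1r.
have Ht : H 'X%:P.
  exists 1%N, 0%N, p1; split; first by rewrite muln0 muln1 addn0.
  by move=> A f v t u <- _; rewrite ev2C ev1X expr0 expr1 mulr1 mulrC.
have Hu : H 'X.
  exists 0%N, 1%N, a; split; first by rewrite muln0 muln1 add0n.
  by move=> A f v t u _ <-; rewrite ev2X expr0 expr1 mul1r mulrC.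
have HP P : H P%:P.
  elim/poly_ind: P => [|P c IH]; first exact: (HC 0).
  by rewrite polyCD polyCM; apply: HD => //; apply: HM.
elim/poly_ind: g => [|g P IH]; first by apply: (HC 0).
by apply: HD => //; apply: HM.
Qed.

(** * The generic point of a separable covering of the line *)

(** The map xi is locally given by polynomials and is surjective: the preimage
    of a nonempty open set is open and nonempty. *)
Lemma generically_preimage (K : closedFieldType) n m (X : set (proj K n))
    (xi : proj K n -> proj K m) (P : proj K m -> Prop) :
    is_morphism X [set: proj K m] xi -> set_surj X [set: proj K m] xi ->
  generically [set: proj K m] P -> generically X (fun x => P (xi x)).
Proof.
move=> [_ xi_loc] xi_surj [W [oW [y [_ Wy]] hW]].
have [x Xx xiE] := xi_surj y I.
have [V [d [q [oV Vx hq hV]]]] := xi_loc _ Xx.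
have [e [p [hp py pW]]] := zopen_basic oW Wy.
have hpq := dhomog_comp hq hp; set pq := mmap _ _ _ in hpq.
have pqE z : X z -> V z -> (evalp pq z == 0) = (evalp p (xi z) == 0).
  move=> Xz Vz; have [qz ->] := hV _ Xz Vz; rewrite (evalp_pt_eq0 qz hp).
  rewrite /evalp meval_comp; congr (_ == _); apply: meval_eq => i.
  by rewrite mxE.
exists (V `&` [set z | evalp pq z != 0]); split.
- by apply: zopenI => //; apply: zopen_neq0 hpq.
- by exists x; do 2?split=> //=; rewrite pqE // xiE.
- by move=> z Xz [Vz /= pz]; apply: hW => //; apply: pW; rewrite -pqE.
Qed.

Lemma lead_divisible (R : idomainType) (p q : {poly R}) : p %| q ->
  exists2 k, k != 0 & exists s, k *: q = s * p.
Proof.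
rewrite Pdiv.Idomain.dvdp_eq => /eqP e.
exists (lead_coef p ^+ scalp q p); last by exists (q %/ p).
exact: Pdiv.Idomain.lc_expn_scalp_neq0.
Qed.

Lemma dvdp_lead_coef (R : idomainType) (p q : {poly R}) : p %| q ->
  exists N s, lead_coef p ^+ N *: q = s * p.
Proof.
rewrite Pdiv.Idomain.dvdp_eq => /eqP e.
by exists (scalp q p), (q %/ p).
Qed.

(** A field generated over K by the homogeneous coordinates y of a generic
    point of X, presented as an extension K(t)(u) with a separable generator,
    where t is the coordinate of the image of the generic point under xi. *)
Record generic_point (K : closedFieldType) n (X : set (proj K n))
    (xi : proj K n -> proj K 1) := GenericPoint {
  gp_field : fieldType;
  gp_const : {rmorphism K -> gp_field};
  gp_coord : 'I_n.+1 -> gp_field;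
  gp_t : gp_field;
  gp_u : gp_field;
  gp_vanish : forall d p, p \is d.-homog ->
    mmap gp_const gp_coord p = 0 <-> forall x, X x -> evalp p x = 0;
  gp_fraction : forall alpha : gp_field, exists d a b,
    [/\ a \is d.-homog, b \is d.-homog, mmap gp_const gp_coord b != 0 &
        alpha * mmap gp_const gp_coord b = mmap gp_const gp_coord a];
  gp_transc : forall p, ev1 gp_const gp_t p = 0 -> p = 0;
  gp_span : forall alpha : gp_field, exists2 q, q != 0 &
    exists h, ev1 gp_const gp_t q * alpha = ev2 gp_const gp_t gp_u h;
  gp_sep : exists2 h, ev2 gp_const gp_t gp_u h = 0 &
    ev2 gp_const gp_t gp_u h^`() != 0;
  gp_map : exists e d p0 p1 r,
    [/\ p0 \is d.-homog, p1 \is d.-homog, r \is e.-homog,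
        mmap gp_const gp_coord p0 != 0 & mmap gp_const gp_coord r != 0] /\
    gp_t * mmap gp_const gp_coord p0 = mmap gp_const gp_coord p1 /\
    forall x, X x -> evalp p0 x != 0 -> evalp r x != 0 ->
      xi x = pt (\row_(i < 2) evalp (if i == 0 then p0 else p1) x)
}.

Section GenericPointExists.
Variables (K : closedFieldType) (n : nat) (X : set (proj K n)).
Variable xi : proj K n -> proj K 1.
Hypothesis xi_mor : is_morphism X [set: proj K 1] xi.
Hypothesis xi_surj : set_surj X [set: proj K 1] xi.
Variables (irrX : zirreducible X) (irrY : zirreducible [set: proj K 1]).
Variables (L : fieldExtType (funfield irrY)) (phi : {rmorphism L -> funfield irrX}).
Hypothesis phi_bij : bijective phi.
Hypothesis phi_pull : forall f : funfield irrY, is_pullback xi f (phi f%:A).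
Hypothesis sepL : separable 1 {:L}.
Local Notation E := (funfield irrX).
Local Notation k := (funfield irrY).

Let psi : {rmorphism k -> E} := phi \o in_alg L.

Variables (y : 'I_n.+1 -> E) (z : 'I_2 -> k).
Hypothesis yP : forall (f : ratfun irrX) d a b,
    a \is d.-homog -> b \is d.-homog ->
    germ f * mmap (constE irrX) y b = mmap (constE irrX) y a <->
    generically X (fun x => f x * evalp b x = evalp a x).
Hypothesis zP : forall (f : ratfun irrY) d a b,
    a \is d.-homog -> b \is d.-homog ->
    germ f * mmap (constE irrY) z b = mmap (constE irrY) z a <->
    generically [set: proj K 1] (fun x => f x * evalp b x = evalp a x).

(** Pullbacks are defined by some representative; they are compatible with
    every representative because xi is dominant. *)
Lemma psi_pull (f0 : ratfun irrY) : exists2 g0 : ratfun irrX,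
  germ g0 = psi (germ f0) & generically X (fun x => g0 x = f0 (xi x)).
Proof.
have [f1 [g0 [e1 e2 h]]] := phi_pull (germ f0); exists g0 => //.
have /germP/(generically_preimage xi_mor xi_surj) h1 := e1.
by apply: genericallyW (genericallyI irrX h h1) => x [-> ->].
Qed.

Lemma psi_const c : psi (constE irrY c) = constE irrX c.
Proof.
have [g0 <- h] := psi_pull (rcst irrY c).
by apply: (germ_cst yP); apply: genericallyW h => x ->.
Qed.

Lemma basept_neq0 c : (\row_(i < 2) (if i == 0 then 1 else c) : 'rV[K]_2) != 0.
Proof. by apply/eqP => /rowP/(_ 0)/eqP; rewrite !mxE /= oner_eq0. Qed.

Lemma X0_generic : mmap (constE irrY) z 'X_0 != 0.
Proof.
apply: (generic_neq0 zP (dhomogXU _ 0)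
  (x := pt (\row_(i < 2) (if i == 0 then 1 else 0)))) => //.
rewrite (evalp_pt_eq0 (basept_neq0 0) (dhomogXU _ _)) mevalXU mxE /=.
exact: oner_neq0.
Qed.

Let T : k := z 1 / z 0.

Lemma z0_neq0 : z 0 != 0.
Proof. by have := X0_generic; rewrite mmapX mmap1U. Qed.

Lemma TE : T * mmap (constE irrY) z 'X_0 = mmap (constE irrY) z 'X_1.
Proof. by rewrite !mmapX !mmap1U divfK ?z0_neq0. Qed.

(** A relation of T, made homogeneous, vanishes on the whole line and so has
    every constant as a root. *)
Lemma T_transcendental p : ev1 (constE irrY) T p = 0 -> p = 0.
Proof.
move=> p0.
have [N [M [G [hG eG]]]] := homogenize p%:P (dhomogXU K (0 : 'I_2))
   (dhomogXU K 1) (dhomog1 _ _) (dhomog1 _ _).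
have /(generic_vanishing zP hG) Gv : mmap (constE irrY) z G = 0.
  by rewrite (eG _ _ _ T 1 TE) ?mul1r // ev2C p0 mulr0.
apply: contrapT => /eqP/poly_nonroot[c]; apply/negP/negPn.
have v0 := basept_neq0 c; set v := \row_(_ < _) _ in v0.
have /eqP := Gv (pt v) I.
rewrite (evalp_pt_eq0 v0 hG) /meval (eG _ _ _ c 1) ?mul1r //; last first.
  by rewrite !mmapX !mmap1U !mxE /= mulr1.
rewrite ev2C ev1_id mmapX mmap1U mxE /= expr1n mul1r rmorph1 expr1n mul1r.
by [].
Qed.

(** A rational function on the line is a quotient of binary forms of the same
    degree, which become polynomials in T after division by a power of z_0. *)
Lemma function_field_line (c : k) : exists2 q, q != 0 &
  exists p, ev1 (constE irrY) T q * c = ev1 (constE irrY) T p.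
Proof.
have [d [a [b [ha hb b0 e]]]] := funfield_fraction zP c.
pose dh (p : {mpoly K[2]}) : {poly K} :=
  mmap polyC (fun i => if i == 0 then 1 else 'X) p.
have dhE p : p \is d.-homog ->
    mmap (constE irrY) z p = z 0 ^+ d * ev1 (constE irrY) T (dh p).
  move=> hp; rewrite /dh rmorph_mmap -(mmap_homogZ _ _ _ hp).
  apply: eq_mmap => [x|i]; first exact: (esym (ev1C (constE irrY) T x)).
  rewrite /= fun_if rmorph1 ev1X; case: eqP => [->|i0]; first by rewrite mulr1.
  have -> : i = 1.
    apply/val_inj; case: i i0 => [[|[|m]] lt] i0 //.
    by case: i0; apply: val_inj.
  by rewrite mulrC divfK ?z0_neq0.
have zd : z 0 ^+ d != 0 by rewrite expf_neq0 // z0_neq0.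
exists (dh b); last exists (dh a).
  by apply: contraNneq b0 => b0; rewrite dhE // b0 rmorph0 mulr0.
by apply: (mulfI zd); rewrite -dhE // -e dhE // [c * _]mulrC mulrA.
Qed.

Lemma clear_denominators (s : {poly k}) : exists2 q, q != 0 &
  exists h, map_poly (ev1 (constE irrY) T) h = ev1 (constE irrY) T q *: s.
Proof.
elim/poly_ind: s => [|s c [q q0 [h e]]].
  by exists 1; rewrite ?oner_neq0 //; exists 0; rewrite rmorph0 scaler0.
have [q' q'0 [p e']] := function_field_line c.
exists (q * q'); first by rewrite mulf_neq0.
exists (q'%:P * h * 'X + (q * p)%:P).
rewrite !(rmorphD, rmorphM) /= !map_polyC map_polyX e /= -!mul_polyC -polyCM.
by rewrite -e' clear_denominators_step.
Qed.

Lemma generic_point_funfield : generic_point X xi.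
Proof.
pose t : E := psi T.
have ev1E p : ev1 (constE irrX) t p = psi (ev1 (constE irrY) T p).
  rewrite rmorph_ev1 !ev1E; congr (_.[_]); apply: eq_map_poly => c.
  exact/esym/psi_const.
pose u0 := separable_generator 1 {:L}.
have genL : fullv = <<1; u0>>%VS.
  by apply: eq_adjoin_separable_generator => //; apply: sub1v.
pose u := phi u0.
have ev2_horner (q : {poly {poly K}}) (s : {poly k}) c :
    map_poly (ev1 (constE irrY) T) q = c *: s ->
    ev2 (constE irrX) t u q = psi c * phi (map_poly (in_alg L) s).[u0].
  move=> e; rewrite ev2E (eq_map_poly ev1E) map_poly_comp e.
  rewrite map_polyZ hornerZ; congr (_ * _).
  by rewrite /psi map_poly_comp horner_map.
have tT p : ev1 (constE irrX) t p = 0 -> p = 0.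
  rewrite ev1E => /eqP; rewrite fmorph_eq0 => /eqP.
  exact: T_transcendental.
have spanE (alpha : E) : exists2 q, q != 0 &
    exists h, ev1 (constE irrX) t q * alpha = ev2 (constE irrX) t u h.
  have [phi' phi'K phiK] := phi_bij.
  have /Fadjoin_polyP[p /polyOver1P[s ->] e] : phi' alpha \in <<1; u0>>%VS.
    by rewrite -genL memvf.
  have [q q0 [h hE]] := clear_denominators s.
  exists q => //; exists h.
  by rewrite (ev2_horner _ _ _ hE) ev1E -[alpha]phiK e.
have sepE : exists2 h, ev2 (constE irrX) t u h = 0 &
    ev2 (constE irrX) t u h^`() != 0.
  have := separable_root_der 1 u0.
  rewrite separable_generatorP /= => der0.
  have /polyOver1P[s mE] := minPolyOver 1 u0.
  have [q q0 [h hE]] := clear_denominators s.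
  exists h; first by rewrite (ev2_horner _ _ _ hE) -mE minPolyxx rmorph0 mulr0.
  have hE' : map_poly (ev1 (constE irrY) T) h^`() =
      ev1 (constE irrY) T q *: s^`() by rewrite -deriv_map hE derivZ.
  rewrite (ev2_horner _ _ _ hE') -deriv_map -mE.
  rewrite mulf_eq0 negb_or !fmorph_eq0; apply/andP; split; last exact: der0.
  by apply: contra q0 => /eqP/T_transcendental ->.
apply: (@GenericPoint K n X xi E (constE irrX) y t u) => //.
- by move=> d p; apply: generic_vanishing.
- exact: funfield_fraction.
have [_ xi_loc] := xi_mor.
(* The local formula for xi is taken near a point over the origin of the line:
   its first component does not vanish there, so that t = p 1 / p 0. *)
have v0 := basept_neq0 0; set v := \row_(_ < _) _ in v0.
have [x Xx xiE] := @xi_surj (pt v) I.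
have [U [d [p [oU Ux hp hU]]]] := xi_loc _ Xx.
have [e [r [hr rx rU]]] := zopen_basic oU Ux.
have ifE z' (i : 'I_2) : evalp (if i == 0 then p 0 else p 1) z' = evalp (p i) z'.
  case: eqP => [->//|i0]; congr (evalp (p _) _).
  by apply/val_inj; case: i i0 => [[|[|m]] lt] i0 //; case: i0; apply: val_inj.
have p0x : evalp (p 0) x != 0.
  have [px xiE'] := hU _ Xx Ux; rewrite xiE' in xiE.
  have := evalp_pt_eq0 v0 (dhomogXU _ 0).
  rewrite -xiE (evalp_pt_eq0 px (dhomogXU _ 0)) !mevalXU !mxE => ->.
  by rewrite oner_eq0.
exists e, d, (p 0), (p 1), r; split; first split=> //.
- by apply: (generic_neq0 yP (hp 0) Xx).
- by apply: (generic_neq0 yP hr Xx).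
split; last first.
  move=> x' Xx' _ rx'; have [_ ->] := hU _ Xx' (rU _ rx').
  by congr pt; apply/rowP => i; rewrite !mxE ifE.
have ratT : (fun y0 => evalp 'X_1 y0 / evalp 'X_0 y0) \in rationalb irrY.
  apply: (rational_ratio (d := 1) irrY (x := pt v)) => //; try exact: dhomogXU.
  by rewrite (evalp_pt_eq0 v0 (dhomogXU _ 0)) mevalXU mxE /= oner_neq0.
have TgE : T = germ (RatFun ratT).
  apply: (mulIf X0_generic); rewrite TE; apply/esym.
  apply/(zP (RatFun ratT) (dhomogXU _ 1) (dhomogXU _ 0)).
  have /(generically_neq0 (dhomogXU K (0 : 'I_2)) (I : [set: proj K 1] (pt v))) :
      evalp 'X_0 (pt v) != 0.
    by rewrite (evalp_pt_eq0 v0 (dhomogXU _ 0)) mevalXU mxE /= oner_neq0.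
  by apply: genericallyW => y0 y00; rewrite /= divfK.
have [g gE hg] := psi_pull (RatFun ratT).
rewrite /t TgE -gE; apply/(yP g (hp 1) (hp 0)).
have gr := generically_neq0 hr Xx rx.
have gp := generically_neq0 (hp 0) Xx p0x.
have gX : generically X X.
  by exists setT; split; [exact: zopenT|rewrite setIT; case: irrX|].
apply: genericallyW (genericallyI irrX gX
  (genericallyI irrX hg (genericallyI irrX gr gp))).
move=> w [Xw [gw [rw pw]]]; rewrite gw /=.
have [qw ->] := hU _ Xw (rU _ rw).
have [c c0 cE] := evalp_pt 1 qw.
rewrite !cE ?dhomogXU // !mevalXU !mxE invfM mulrACA divff // mul1r.
by rewrite divfK.
Qed.
End GenericPointExists.

(** * Algebraic dependence *)

Local Notation "x %:F" := (@FracField.tofrac _ x).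

Lemma fraction_numden (R : idomainType) (x : {fraction R}) :
  exists2 d, d != 0 & exists n, x * d%:F = n%:F.
Proof.
elim/quotW: x => r; exists \d_r; first exact: denom_ratioP.
exists \n_r; unlock FracField.tofrac; rewrite -[LHS]FracField.pi_mul.
apply/eqP; rewrite FracField.equivf_def /FracField.mulf /=.
by rewrite !numden_Ratio ?mulf_neq0 ?oner_neq0 ?denom_ratioP // !mulr1 mulrC.
Qed.

Section FractionMap.
Variables (R : idomainType) (E : fieldType) (theta : {rmorphism R -> E}).
Hypothesis theta_inj : forall a, theta a = 0 -> a = 0.

Let theta_neq0 a : a != 0 -> theta a != 0.
Proof. by apply: contra => /eqP/theta_inj ->. Qed.

Lemma frac_map_exists (x : {fraction R}) : exists e : E,
  forall n d, d != 0 -> x * d%:F = n%:F -> e * theta d = theta n.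
Proof.
have [d d0 [n e]] := fraction_numden x; exists (theta n / theta d).
move=> n' d' d'0 e'; apply: (mulIf (theta_neq0 d0)).
rewrite mulrAC divfK ?theta_neq0 // -!rmorphM; congr (theta _).
by apply/eqP; rewrite -tofrac_eq !rmorphM /= -e -e' mulrAC.
Qed.

Definition frac_map x : E := sval (cid (frac_map_exists x)).

Lemma frac_mapP x n d : d != 0 -> x * d%:F = n%:F ->
  frac_map x * theta d = theta n.
Proof. by rewrite /frac_map; case: cid => e /= h d0 /h; apply. Qed.

Lemma frac_map_tofrac a : frac_map a%:F = theta a.
Proof.
have := @frac_mapP a%:F a 1 (oner_neq0 _).
by rewrite !rmorph1 !mulr1; apply.
Qed.

Lemma frac_map_is_zmod_morphism : zmod_morphism frac_map.
Proof.
move=> x x'.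
have [d d0 [n e]] := fraction_numden x; have [d' d'0 [n' e']] := fraction_numden x'.
have dd : d * d' != 0 by rewrite mulf_neq0.
have eB : (x - x') * (d * d')%:F = (n * d' - n' * d)%:F.
  by rewrite rmorphB !rmorphM /= -e -e'; ring.
apply: (mulIf (theta_neq0 dd)); rewrite (frac_mapP dd eB).
rewrite rmorphB !rmorphM /= -(frac_mapP d0 e) -(frac_mapP d'0 e'); ring.
Qed.

Lemma frac_map_is_monoid_morphism : monoid_morphism frac_map.
Proof.
split=> [|x x'].
  by rewrite -(rmorph1 (@FracField.tofrac R)) frac_map_tofrac rmorph1.
have [d d0 [n e]] := fraction_numden x; have [d' d'0 [n' e']] := fraction_numden x'.
have dd : d * d' != 0 by rewrite mulf_neq0.
have eM : (x * x') * (d * d')%:F = (n * n')%:F by rewrite !rmorphM /= -e -e'; ring.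
apply: (mulIf (theta_neq0 dd)); rewrite (frac_mapP dd eM).
rewrite !rmorphM /= -(frac_mapP d0 e) -(frac_mapP d'0 e'); ring.
Qed.

HB.instance Definition _ := GRing.isZmodMorphism.Build {fraction R} E
  frac_map frac_map_is_zmod_morphism.
HB.instance Definition _ := GRing.isMonoidMorphism.Build {fraction R} E
  frac_map frac_map_is_monoid_morphism.

Lemma fraction_map : exists phi : {rmorphism {fraction R} -> E},
  forall a, phi a%:F = theta a.
Proof. by exists frac_map; apply: frac_map_tofrac. Qed.

End FractionMap.

Lemma fraction_clear_denominators (R : idomainType) (s : {poly {fraction R}}) :
  exists2 q, q != 0 & exists h, map_poly (@FracField.tofrac R) h = q%:F *: s.
Proof.
elim/poly_ind: s => [|s c [q q0 [h e]]].
  by exists 1; rewrite ?oner_neq0 //; exists 0; rewrite rmorph0 scaler0.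
have [q' q'0 [p e']] := fraction_numden c.
exists (q * q'); first by rewrite mulf_neq0.
exists (q'%:P * h * 'X + (q * p)%:P).
rewrite !(rmorphD, rmorphM) /= !map_polyC map_polyX e /= -!mul_polyC -polyCM.
by rewrite -e' [c * _]mulrC clear_denominators_step.
Qed.

Section AlgebraicDependence.
Variables (K E : fieldType) (kappa : {rmorphism K -> E}).
Local Notation transc t := (forall p, ev1 kappa t p = 0 -> p = 0).

(** Clearing denominators passes between equations of e over the field K(s)
    and polynomial relations between s and e. The former can be added and
    composed, the latter can be read in both directions. *)
Lemma algebraic_over_transc s (phi : {rmorphism {fraction {poly K}} -> E}) e :
    (forall p, phi p%:F = ev1 kappa s p) ->
  algebraicOver phi e <-> exists2 g, g != 0 & ev2 kappa s e g = 0.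
Proof.
move=> phiE.
have mapE g : map_poly phi (map_poly (@FracField.tofrac _) g) =
    map_poly (ev1 kappa s) g.
  by rewrite -map_poly_comp; apply: eq_map_poly => p /=; rewrite phiE.
split=> [[p p0 /rootP pe]|[g g0 ge]].
  have [q q0 [h hE]] := fraction_clear_denominators p; exists h.
    apply: contraNneq p0 => h0; move: hE; rewrite h0 rmorph0 => /esym/eqP.
    by rewrite scaler_eq0 tofrac_eq0 (negPf q0).
  by rewrite ev2E -mapE hE map_polyZ hornerZ pe mulr0.
exists (map_poly (@FracField.tofrac _) g).
  by rewrite map_poly_eq0_id0 // tofrac_eq0 lead_coef_eq0.
by apply/rootP; rewrite mapE.
Qed.

Lemma ev2_swapXY s t g : ev2 kappa s t (swapXY g) = ev2 kappa t s g.
Proof.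
elim/poly_ind: g => [|g p IH]; first by rewrite !rmorph0.
rewrite !rmorphD !rmorphM /= IH swapXY_X swapXY_polyC.
rewrite !ev2C !ev2X ev1X; congr (_ + _).
rewrite ev2E -map_poly_comp ev1E; congr (_.[_]); apply: eq_map_poly => c /=.
by rewrite ev1C.
Qed.

(** Transcendence degree one. Every element of E = K(t)(u) is algebraic over
    K(t). If x is transcendental, a relation between t and x makes t algebraic
    over K(x), and then u and all of E are algebraic over K(x). *)
Lemma algebraic_dependence t u f : transc t -> f != 0 -> ev2 kappa t u f = 0 ->
    (forall alpha, exists2 q, q != 0 &
       exists h, ev1 kappa t q * alpha = ev2 kappa t u h) ->
  forall x y, exists2 g, g != 0 & ev2 kappa x y g = 0.
Proof.
move=> tT f0 fu span x y.
have spanE (alpha : E) : exists q h, q != 0 /\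
    alpha = ev2 kappa t u h / ev1 kappa t q.
  have [q q0 [h e]] := span alpha; exists q, h; split=> //.
  by rewrite -e mulrAC divff ?mul1r //; apply: contra q0 => /eqP/tT ->.
have [phi phiE] := fraction_map tT.
have algt e : algebraicOver phi e.
  have [q [h [q0 ->]]] := spanE e; apply/integral_algebraic.
  apply: integral_div; last by rewrite -phiE; apply: integral_id.
  rewrite ev2E; apply: integral_horner.
    by apply/integral_poly => i; rewrite coef_map /= -phiE; apply: integral_id.
  by apply/integral_algebraic/(algebraic_over_transc _ phiE); exists f.
have [xT|/existsNP[p /not_implyP[px /eqP p0]]] := pselect (transc x); last first.
  by exists p%:P; rewrite ?polyC_eq0 // ev2C.
have [psi psiE] := fraction_map xT.
apply/(algebraic_over_transc _ psiE)/integral_algebraic.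
have intt : integralOver psi t.
  apply/integral_algebraic/(algebraic_over_transc _ psiE).
  have /(algebraic_over_transc _ phiE)[g g0 ge] := algt x.
  by exists (swapXY g); rewrite ?swapXY_eq0 ?ev2_swapXY.
have intK p : integralOver psi (ev1 kappa t p).
  rewrite ev1E; apply: integral_horner => //; apply/integral_poly => i.
  rewrite coef_map /= -(ev1C kappa x) -psiE; exact: integral_id.
have [q [h [q0 ->]]] := spanE y; apply: integral_div => //.
rewrite ev2E; apply: integral_horner.
  by apply/integral_poly => i; rewrite coef_map /=.
apply: (@integral_root _ _ psi (map_poly (ev1 kappa t) f)).
- rewrite map_poly_eq0_id0 //; apply: contra f0 => /eqP/tT/eqP.
  by rewrite lead_coef_eq0.
- by apply/rootP; rewrite -ev2E.
- by apply/integral_poly => i; rewrite coef_map /=.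
Qed.

End AlgebraicDependence.

(** * Separable coverings as plane curves *)

Lemma finite_rows (K : choiceType) n (A : set K) : finite_set A ->
  finite_set [set v : 'rV[K]_n | forall j, A (v 0 j)].
Proof.
move=> /finite_seqP[s ->].
have := finite_finset (X := [set: {ffun 'I_n -> seq_sub s}]).
move=> /(finite_image (fun f : {ffun 'I_n -> seq_sub s} => \row_j val (f j))).
apply: sub_finite_set => v /= vs.
exists [ffun j => SeqSub (vs j)] => //.
by apply/rowP => j; rewrite mxE ffunE.
Qed.

Lemma minimal_size (R : nzSemiRingType) (P : {poly R} -> Prop) :
  (exists p, P p) -> exists2 p, P p & forall q, P q -> (size p <= size q)%N.
Proof.
move=> [p0 Pp0].
have ex : exists m, `[< exists2 p, P p & size p = m >].
  by exists (size p0); apply/asboolP; exists p0.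
case: (ex_minnP ex) => m /asboolP[p Pp sp] min; exists p => // q Pq.
by rewrite sp; apply: min; apply/asboolP; exists q.
Qed.

Lemma pt_coord_ratio (K : closedFieldType) n (x : proj K n) i :
  coords x 0 i != 0 -> x = pt (\row_j (coords x 0 j / coords x 0 i)).
Proof.
move=> xi; rewrite -[LHS]coordsK; apply: pt_eq_cross; first exact: coords_neq0.
  by apply/eqP => /rowP/(_ i)/eqP; rewrite !mxE divff // oner_eq0.
by move=> j k; rewrite !mxE; ring.
Qed.

Section Divisibility.
Variables (K E : fieldType) (kappa : {rmorphism K -> E}) (t u : E).
Hypothesis transc : forall p, ev1 kappa t p = 0 -> p = 0.
Variable f : {poly {poly K}}.
Hypothesis f0 : f != 0.
Hypothesis fu : ev2 kappa t u f = 0.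
Hypothesis f_min : forall g, g != 0 -> ev2 kappa t u g = 0 ->
  (size f <= size g)%N.

(** The pseudo-remainder of g modulo f vanishes at u and is smaller than f. *)
Lemma minimal_divides g : ev2 kappa t u g = 0 -> f %| g.
Proof.
move=> gu; apply: contraT; rewrite /dvdp => r0.
have := f_min r0; rewrite leqNgt ltn_modp f0 /=; apply.
have := congr1 (ev2 kappa t u) (Pdiv.Idomain.divp_eq g f).
rewrite -mul_polyC !rmorphD !rmorphM /= gu fu !mulr0 add0r; exact: esym.
Qed.

(** A common factor of f and g does not vanish at u, so the complementary
    factor of f does; minimality makes the common factor a constant. *)
Lemma minimal_bezout g : ev2 kappa t u g != 0 ->
  exists2 rho, rho != 0 & exists a b, rho%:P = a * f + b * g.
Proof.
move=> gu; have /Bezout_coprimepP[[a b] /= e] : coprimep f g; last first.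
  have /size_poly1P[rho rho0 e'] : size (a * f + b * g) == 1%N.
    by rewrite (eqp_size e) size_poly1.
  by exists rho => //; exists a, b.
set d := gcdp f g; rewrite /coprimep -/d.
have [k k0 [s e]] := lead_divisible (dvdp_gcdl f g).
have [k' k'0 [s' e']] := lead_divisible (dvdp_gcdr f g).
rewrite -/d -!mul_polyC in e e'.
have du : ev2 kappa t u d != 0.
  have : ev2 kappa t u (k'%:P * g) != 0.
    rewrite rmorphM /= ev2C mulf_neq0 //.
    by apply: contra k'0 => /eqP/transc ->.
  by rewrite e' rmorphM /= mulf_eq0 negb_or => /andP[].
have s0 : s != 0.
  apply: contraNneq f0 => s0; move: e; rewrite s0 mul0r => /eqP.
  by rewrite mulf_eq0 polyC_eq0 (negPf k0).
have su : ev2 kappa t u s = 0.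
  have /eqP := congr1 (ev2 kappa t u) e.
  by rewrite !rmorphM /= fu mulr0 eq_sym mulf_eq0 (negPf du) orbF => /eqP.
have d0 : d != 0 by rewrite gcdp_eq0 negb_and f0.
have := f_min s0 su.
have -> : size f = (size s + size d).-1.
  by rewrite -size_mul // -e mul_polyC size_scale.
have : (0 < size d)%N by rewrite size_poly_gt0.
case: (size d) => [|[|m]] // _.
by rewrite addnS /= -{2}[size s]addn0 leq_add2l.
Qed.

End Divisibility.

Section PlaneModel.
Variables (K : closedFieldType) (n : nat) (X : set (proj K n)).
Variable xi : proj K n -> proj K 1.
Variable gp : generic_point X xi.
Hypothesis irrX : zirreducible X.
Hypothesis closedX : zclosed X.
Let E := gp_field gp.
Let kappa : {rmorphism K -> E} := gp_const gp.
Let y : 'I_n.+1 -> E := gp_coord gp.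
Let t : E := gp_t gp.
Let u : E := gp_u gp.
Local Notation gev := (mmap kappa y).
Local Notation van := (@gp_vanish _ _ _ _ gp).

Lemma gp_minimal_poly : exists2 f : {poly {poly K}},
  f != 0 /\ ev2 kappa t u f = 0 &
  forall g, g != 0 -> ev2 kappa t u g = 0 -> (size f <= size g)%N.
Proof.
have [h hu h'u] := gp_sep gp.
have [|f [f0 fu] fmin] := @minimal_size _
    (fun g => g != 0 /\ ev2 kappa t u g = 0).
  exists h; split=> //; apply: contraNneq h'u => ->.
  by rewrite deriv0 rmorph0.
by exists f => // g g0 gu; apply: fmin.
Qed.

Lemma gp_dependence a b : exists2 g, g != 0 & ev2 kappa a b g = 0.
Proof.
have [f [f0 fu] _] := gp_minimal_poly.
exact (@algebraic_dependence K E kappa t u f (@gp_transc _ _ _ _ gp) f0 fu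
  (@gp_span _ _ _ _ gp) a b).
Qed.

Lemma gev_neq0 d p x : p \is d.-homog -> X x -> evalp p x != 0 -> gev p != 0.
Proof.
by move=> hp Xx; apply: contra => /eqP/(van hp) h; apply/eqP; apply: h.
Qed.

(** The functions h/x_i^d and x_j/x_i satisfy a polynomial relation, which can
    be taken not divisible by its first variable. Where h vanishes, it leaves
    finitely many values for x_j/x_i. *)
Lemma finite_zeros d h : h \is d.-homog -> gev h != 0 ->
  finite_set [set x | X x /\ evalp h x = 0].
Proof.
move=> hh h0.
pose chart i := [set x | [/\ X x, evalp h x = 0 & coords x 0 i != 0]].
suff chart_fin i : finite_set (chart i).
  apply: (@sub_finite_set _ _ (\bigcup_(i in [set: 'I_n.+1]) chart i)).
    move=> x [Xx hx]; have /rV0Pn[i xi0] := coords_neq0 x.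
    by exists i.
  by apply: bigcup_finite => //.
have [yi0|yi0] := eqVneq (gev 'X_i) 0.
  rewrite (_ : chart i = set0) //; apply/seteqP; split=> x //= [Xx _].
  move/(van (dhomogXU _ i)) : yi0 => /(_ x Xx).
  by rewrite /evalp mevalXU => ->; rewrite eqxx.
have ratio j : exists2 A : set K, finite_set A &
    forall x, chart i x -> A (coords x 0 j / coords x 0 i).
  pose eta := gev h / gev 'X_i ^+ d; pose b := gev 'X_j / gev 'X_i.
  have eta0 : eta != 0 by rewrite mulf_neq0 // invr_neq0 // expf_neq0.
  have [g g0 gE] : exists2 g : {poly {poly K}},
      map_poly (horner_eval 0) g != 0 & ev2 kappa eta b g = 0.
    have [g g0 gE] := gp_dependence eta b.
    elim: {g}(size (lead_coef g)) {-2}g (leqnn (size (lead_coef g))) g0 gE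
      => [|m IH] g sg g0 gE.
      by move: sg; rewrite leqn0 size_poly_eq0 lead_coef_eq0 (negPf g0).
    have [g00|] := eqVneq (map_poly (horner_eval 0) g) 0; last by exists g.
    have [g' gg'] : exists g', g = 'X%:P * g'.
      exists (\poly_(k < size g) (g`_k %/ 'X)); apply/polyP => k.
      rewrite coefCM coef_poly; case: ltnP => [_|sk]; last first.
        by rewrite mulr0 nth_default.
      have : root g`_k 0.
        by apply/rootP; rewrite -[LHS]/(horner_eval 0 g`_k) -coef_map g00 coef0.
      by rewrite -dvdp_XsubCl subr0 => /divpK {1}<-; rewrite mulrC.
    have g'0 : g' != 0 by apply: contraNneq g0 => e; rewrite gg' e mulr0.
    apply: (IH g') => //.
      move: sg; rewrite gg' lead_coefM lead_coefC size_mul ?polyX_eq0 ?lead_coef_eq0 //.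
      by rewrite size_polyX.
    move: gE; rewrite gg' rmorphM /= ev2C ev1X => /eqP.
    by rewrite mulf_eq0 (negPf eta0) => /eqP.
  exists [set c | (map_poly (horner_eval 0) g).[c] = 0].
    exact: finite_roots.
  have hX : ('X_i ^+ d : {mpoly K[n.+1]}) \is (1 * d)%N.-homog.
    by apply: dhomogMn; apply: dhomogXU.
  rewrite mul1n in hX.
  have [N [M [G [hG eG]]]] := homogenize g hX hh (dhomogXU K j) (dhomogXU K i).
  have G0 : gev G = 0.
    rewrite (eG _ _ _ eta b) ?gE ?mulr0 //.
      by rewrite rmorphXn /= divfK // expf_neq0.
    by rewrite divfK.
  move=> x [Xx hx xi0] /=; have /eqP := (van hG).1 G0 x Xx.
  rewrite /evalp /meval (eG _ _ _ 0 (coords x 0 j / coords x 0 i)).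
  - rewrite rmorphXn /= mmapX mmap1U !mulf_eq0 !expf_eq0 (negPf xi0) !andbF /=.
    rewrite ev2E => /eqP e; rewrite -[RHS]e; congr (_.[_]).
    by apply: eq_map_poly => c; rewrite ev1_id.
  - by rewrite mul0r -[RHS]/(evalp h x) hx.
  - by rewrite !mmapX !mmap1U divfK.
have {}ratio j : exists A : set K, finite_set A /\
    forall x, chart i x -> A (coords x 0 j / coords x 0 i).
  by have [A fA hA] := ratio j; exists A.
have [A hA] := choice ratio.
have fA : finite_set (\bigcup_(j in [set: 'I_n.+1]) A j).
  by apply: bigcup_finite => // j _; have [] := hA j.
apply: sub_finite_set (finite_image (@pt K n) (finite_rows n.+1 fA)).
move=> x cx; exists (\row_j (coords x 0 j / coords x 0 i)).
  by move=> j /=; rewrite mxE; exists j => //; apply: (hA j).2.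
by case: cx => _ _ /pt_coord_ratio.
Qed.
Local Notation sp := (ev2 (idfun : {rmorphism K -> K})).

Lemma coord_numerators : exists2 c, c != 0 &
  exists hh : 'I_n.+1 -> {poly {poly K}},
    forall j, ev2 kappa t u (hh j) = c * y j.
Proof.
have spanE j : exists qh : {poly K} * {poly {poly K}}, qh.1 != 0 /\
    ev1 kappa t qh.1 * y j = ev2 kappa t u qh.2.
  by have [q q0 [h e]] := @gp_span _ _ _ _ gp (y j); exists (q, h).
have [qh hqh] := choice spanE.
exists (ev1 kappa t (\prod_j (qh j).1)).
  apply: contra_neq (oner_neq0 {poly K}) => /(@gp_transc _ _ _ _ gp)/eqP.
  by rewrite prodf_seq_eq0 => /hasP[j _ /= qj]; have := (hqh j).1; rewrite qj.
exists (fun j => (\prod_(i | i != j) (qh i).1)%:P * (qh j).2) => j.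
rewrite [in RHS](bigD1 j) //= !rmorphM /= ev2C -(hqh j).2; ring.
Qed.

(** Away from finitely many t, the map (t, u) |-> [hh_j(t, u)] identifies the
    plane curve f = 0 with X, and xi with the projection to t. The inverse map
    is (p1/p0, a/b), where p1/p0 and a/b represent t and u on X. Identities
    are checked at the generic point and specialized. *)
Lemma plane_model :
  exists (f : {poly {poly K}}) (D : {poly K}) (hh : 'I_n.+1 -> {poly {poly K}}),
  [/\ (1 < size f)%N /\ D != 0,
      forall t0, D.[t0] != 0 -> (lead_coef f).[t0] != 0,
      forall t0 u0, D.[t0] != 0 -> sp t0 u0 f = 0 ->
        let v := \row_j sp t0 u0 (hh j) in
        [/\ sp t0 u0 f^`() != 0, v != 0, X (pt v) &
            xi (pt v) = pt (\row_(i < 2) (if i == 0 then 1 else t0))],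
      forall t0 u0 u1, D.[t0] != 0 -> sp t0 u0 f = 0 -> sp t0 u1 f = 0 ->
        pt (\row_j sp t0 u0 (hh j)) = pt (\row_j sp t0 u1 (hh j)) -> u0 = u1 &
      finite_set (X `\` [set pt (\row_j sp p.1 p.2 (hh j)) |
                           p in [set p | D.[p.1] != 0 /\ sp p.1 p.2 f = 0]])].
Proof.
have tT := @gp_transc _ _ _ _ gp.
have [f [f0 fu] fmin] := gp_minimal_poly.
have [h hu h'u] := gp_sep gp.
have f'u : ev2 kappa t u f^`() != 0.
  have [k k0 [s e]] := lead_divisible (minimal_divides f0 fu fmin hu).
  have := congr1 (fun g => ev2 kappa t u g^`()) e.
  rewrite derivZ derivM -!mul_polyC rmorphD !rmorphM /= fu mulr0 add0r ev2C => e'.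
  apply: contraNneq h'u => f'0; move/eqP: e'; rewrite f'0 mulr0 mulf_eq0.
  by case/orP => // /eqP/tT/eqP; rewrite (negPf k0).
have [c c0 [hh hhE]] := coord_numerators.
pose cc : {rmorphism K -> {poly {poly K}}} := polyC \o polyC.
pose subst (p : {mpoly K[n.+1]}) : {poly {poly K}} := mmap cc hh p.
have substE d p : p \is d.-homog -> ev2 kappa t u (subst p) = c ^+ d * gev p.
  move=> hp; rewrite -(mmap_homogZ _ _ _ hp).
  rewrite [LHS](rmorph_mmap cc (ev2 kappa t u) hh p).
  by apply: eq_mmap => [a|j] /=; rewrite ?ev2C ?ev1C.
have subst_sp t0 u0 p :
    sp t0 u0 (subst p) = p.@[(\row_j sp t0 u0 (hh j)) 0].
  rewrite [LHS](rmorph_mmap cc (sp t0 u0) hh p).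
  by apply: eq_mmap => [a|j] /=; rewrite ?ev2C ?ev1C ?mxE.
clearbody subst.
have subst_neq0 d p : p \is d.-homog -> gev p != 0 ->
    ev2 kappa t u (subst p) != 0.
  by move=> hp p0; rewrite (substE _ _ hp) mulf_neq0 // expf_neq0.
have [e [d [p0 [p1 [r [[hp0 hp1 hr p0y ry] [tE xiE]]]]]]] := gp_map gp.
have [e' [a [b [ha hb by0 uE]]]] := @gp_fraction _ _ _ _ gp u.
have [x0 Xx0] : X !=set0 by case: irrX.
have /rV0Pn[j0 xj0] := coords_neq0 x0.
have yj0 : gev 'X_j0 != 0.
  by apply: (gev_neq0 (dhomogXU _ j0) Xx0); rewrite /evalp mevalXU.
(* D excludes the t where some expression that has to be nonzero vanishes:
   f^`(), for distinct roots, the denominators p0 and b, the equation r of the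
   complement of the open set on which xi is given by p0 and p1, and one
   coordinate, for the image point to be defined. *)
pose g := f^`() * subst p0 * subst b * subst r * subst 'X_j0.
have gu : ev2 kappa t u g != 0.
  rewrite !rmorphM /= !mulf_neq0 //; first exact: subst_neq0 hp0 _.
  - exact: subst_neq0 hb _.
  - exact: subst_neq0 hr _.
  - exact: subst_neq0 (dhomogXU _ j0) _.
have [rho rho0 [al [be rhoE]]] := minimal_bezout tT f0 fu fmin gu.
pose D := lead_coef f * rho.
have specialize t0 u0 q : D.[t0] != 0 -> sp t0 u0 f = 0 ->
    ev2 kappa t u q = 0 -> sp t0 u0 q = 0.
  rewrite hornerM mulf_eq0 negb_or => /andP[lt0 _] ft0.
  move=> /(minimal_divides f0 fu fmin)/dvdp_lead_coef[N [s es]].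
  have := congr1 (sp t0 u0) es.
  rewrite -mul_polyC !rmorphM /= ft0 mulr0 ev2C rmorphXn /= ev1_id => /eqP.
  by rewrite mulf_eq0 expf_eq0 (negPf lt0) andbF => /eqP.
have specialize_neq0 t0 u0 : D.[t0] != 0 -> sp t0 u0 f = 0 -> sp t0 u0 g != 0.
  rewrite hornerM mulf_eq0 negb_or => /andP[_ rt0] ft0.
  have := congr1 (sp t0 u0) rhoE.
  rewrite ev2C ev1_id rmorphD !rmorphM /= ft0 mulr0 add0r => er.
  by apply: contraNneq rt0 => g0; rewrite er g0 mulr0.
have tS t0 u0 : D.[t0] != 0 -> sp t0 u0 f = 0 ->
    t0 * sp t0 u0 (subst p0) = sp t0 u0 (subst p1).
  move=> Dt0 ft0; apply/eqP; rewrite -subr_eq0; apply/eqP.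
  rewrite -ev2_cross; apply: specialize => //; rewrite ev2_cross.
  by rewrite (substE _ _ hp0) (substE _ _ hp1) mulrCA tE subrr.
have uS t0 u0 : D.[t0] != 0 -> sp t0 u0 f = 0 ->
    u0 * sp t0 u0 (subst b) = sp t0 u0 (subst a).
  move=> Dt0 ft0; apply/eqP; rewrite -subr_eq0; apply/eqP.
  rewrite -ev2_crossX; apply: specialize => //; rewrite ev2_crossX.
  by rewrite (substE _ _ hb) (substE _ _ ha) mulrCA uE subrr.
have v_neq0 t0 u0 : D.[t0] != 0 -> sp t0 u0 f = 0 ->
    \row_j sp t0 u0 (hh j) != 0.
  move=> Dt0 ft0; apply: contraNneq (specialize_neq0 _ _ Dt0 ft0) => v0.
  by rewrite !rmorphM /= (subst_sp _ _ 'X_j0) v0 mevalXU mxE mulr0.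
exists f, D, hh; split.
- split; last by rewrite mulf_neq0 // lead_coef_eq0.
  rewrite ltnNge; apply: contra f0 => /size1_polyC fC.
  move: fu; rewrite fC ev2C => /tT ->.
  by rewrite polyC0.
- by move=> t0; rewrite hornerM mulf_eq0 negb_or => /andP[].
- move=> t0 u0 Dt0 ft0 v; have v0 : v != 0 := v_neq0 _ _ Dt0 ft0.
  have := specialize_neq0 _ _ Dt0 ft0.
  rewrite !rmorphM /= !mulf_eq0 !negb_or -!andbA => /and5P[f's p0s bs rs _].
  have Xv : X (pt v).
    have [S hS eS] := closedX; rewrite eS => p Sp.
    have [dp hp] := hS _ Sp; apply/eqP; rewrite (evalp_pt_eq0 v0 hp).
    rewrite -subst_sp; apply/eqP/specialize => //.
    rewrite (substE _ _ hp) (_ : gev p = 0) ?mulr0 //.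
    by apply/(van hp) => x; rewrite eS => /(_ _ Sp).
  split=> //; have [k k0 kE] := evalp_pt d v0.
  have p0v : evalp p0 (pt v) != 0.
    by rewrite (evalp_pt_eq0 v0 hp0) -subst_sp.
  have rv : evalp r (pt v) != 0.
    by rewrite (evalp_pt_eq0 v0 hr) -subst_sp.
  rewrite (xiE _ Xv p0v rv); apply: pt_eq_cross.
  + by apply/eqP => /rowP/(_ 0); rewrite !mxE /=; apply/eqP.
  + exact: basept_neq0.
  have e01 (i : 'I_2) : evalp (if i == 0 then p0 else p1) (pt v) =
      evalp p0 (pt v) * (if i == 0 then 1 else t0).
    case: eqP => _; rewrite ?mulr1 // !kE // -!subst_sp.
    rewrite -(tS _ _ Dt0 ft0); ring.
  by move=> i j; rewrite !mxE !e01 mulrAC.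
- move=> t0 u0 u1 Dt0 ft0 ft1 eq01.
  have v0 := v_neq0 _ _ Dt0 ft0; have v1 := v_neq0 _ _ Dt0 ft1.
  set w0 := \row_j _ in eq01 v0; set w1 := \row_j _ in eq01 v1.
  have bE w uu : sp t0 uu f = 0 -> w = \row_j sp t0 uu (hh j) -> w != 0 ->
      evalp b (pt w) != 0 /\ uu * evalp b (pt w) = evalp a (pt w).
    move=> ftu wE w_neq0; have [k k0 kE] := evalp_pt e' w_neq0.
    have := specialize_neq0 _ _ Dt0 ftu.
    rewrite !rmorphM /= !mulf_eq0 !negb_or -!andbA => /and5P[_ _ bs _ _].
    rewrite !kE // wE -!subst_sp mulf_neq0 //; split=> //.
    by rewrite -uS // mulrCA.
  have [b0 e0] := bE _ _ ft0 erefl v0; have [_ e1] := bE _ _ ft1 erefl v1.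
  by apply: (mulIf b0); rewrite e0 eq01 -e1 -/w1 -eq01.
have [N [M [G [hG GE]]]] := homogenize D%:P hp0 hp1 ha hb.
have [N0 [M0 [G0 [hG0 G0E]]]] := homogenize f hp0 hp1 ha hb.
have hX := dhomogXU K j0.
have hbad := dhomogM (dhomogM (dhomogM (dhomogM hp0 hb) hr) hX) hG.
have Dt : ev1 kappa t D != 0.
  by rewrite rmorphM mulf_neq0 //;
    [apply: contra f0|apply: contra rho0] => /eqP/tT/eqP; rewrite ?lead_coef_eq0.
have bad_neq0 : gev (p0 * b * r * 'X_j0 * G) != 0.
  by rewrite !rmorphM /= (GE _ _ _ t u tE uE) ev2C !mulf_neq0 // expf_neq0.
apply: sub_finite_set (finite_zeros hbad bad_neq0) => x [Xx im]; split=> //.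
apply: contrapT => /eqP; rewrite /evalp !mevalM !mulf_eq0 !negb_or -!andbA.
rewrite -!/(evalp _ x) => /and5P[p0x bx rx xj G_x]; apply: im => /=.
pose t0 := evalp p1 x / evalp p0 x; pose u0 := evalp a x / evalp b x.
have t0E : t0 * evalp p0 x = evalp p1 x by rewrite divfK.
have u0E : u0 * evalp b x = evalp a x by rewrite divfK.
have Dt0 : D.[t0] != 0.
  apply: contraNneq G_x => Dt0.
  by rewrite /evalp /meval (GE _ _ _ t0 u0 t0E u0E) ev2C ev1_id Dt0 mulr0.
have ft0 : sp t0 u0 f = 0.
  have G0v : gev G0 = 0 by rewrite (G0E _ _ _ t u tE uE) fu mulr0.
  have /eqP := (van hG0).1 G0v x Xx.
  rewrite /evalp /meval (G0E _ _ _ t0 u0 t0E u0E) !mulf_eq0 !expf_eq0.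
  by rewrite (negPf p0x) (negPf bx) !andbF => /eqP.
exists (t0, u0) => //=.
rewrite -[RHS]coordsK; apply: pt_eq_cross; first exact: v_neq0.
  exact: coords_neq0.
move=> i j; rewrite !mxE.
have [Ni [Mi [Gi [hGi GiE]]]] := homogenize (hh i) hp0 hp1 ha hb.
have [Nj [Mj [Gj [hGj GjE]]]] := homogenize (hh j) hp0 hp1 ha hb.
(* Padding with powers of p0 and b brings both sides to the same degree. *)
pose q1 := 'X_j * Gi * (p0 ^+ Nj * b ^+ Mj).
pose q2 := 'X_i * Gj * (p0 ^+ Ni * b ^+ Mi).
pose m := (1 + (d * Ni + e' * Mi) + (d * Nj + e' * Mj))%N.
have hq1 : q1 \is m.-homog.
  by do 2!apply: dhomogM; rewrite ?dhomogXU //; apply: dhomogMn.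
have hq2 : q2 \is m.-homog.
  rewrite /m addnAC; by do 2!apply: dhomogM; rewrite ?dhomogXU //; apply: dhomogMn.
have q12 : gev (q1 - q2) = 0.
  rewrite /q1 /q2 !(rmorphB, rmorphM, rmorphXn) /=.
  rewrite (GiE _ _ _ t u tE uE) (GjE _ _ _ t u tE uE) !hhE !mmapX !mmap1U; ring.
have eval0 := (van (rpredB hq1 hq2)).1 q12 x Xx.
have GiX : Gi.@[coords x 0] = evalp p0 x ^+ Ni * evalp b x ^+ Mi *
    sp t0 u0 (hh i) := GiE _ _ _ t0 u0 t0E u0E.
have GjX : Gj.@[coords x 0] = evalp p0 x ^+ Nj * evalp b x ^+ Mj *
    sp t0 u0 (hh j) := GjE _ _ _ t0 u0 t0E u0E.
rewrite /evalp /q1 /q2 !(mevalB, mevalM, rmorphXn) /= GiX GjX !mevalXU in eval0.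
rewrite -!/(evalp _ x) in eval0; clear GiX GjX.
set P0i := _ ^+ Ni in eval0; set P0j := _ ^+ Nj in eval0.
set Bi := _ ^+ Mi in eval0; set Bj := _ ^+ Mj in eval0.
have P_neq0 : P0i * Bi * P0j * Bj != 0 by rewrite !mulf_neq0 ?expf_neq0.
apply/eqP; rewrite -subr_eq0 -(mulrI_eq0 _ (mulfI P_neq0)) -eval0.
by apply/eqP; ring.
Qed.
End PlaneModel.

(** * Symmetric functions of the roots and the resolvent *)

Section Resolvent.
Variable K : closedFieldType.

Definition fibre (f : {poly {poly K}}) (t : K) : {poly K} :=
  map_poly (ev1 (idfun : {rmorphism K -> K}) t) f.

Lemma fibre_horner f t u :
  ev2 (idfun : {rmorphism K -> K}) t u f = (fibre f t).[u].
Proof. by []. Qed.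

Lemma fibre_deriv f t : fibre f^`() t = (fibre f t)^`().
Proof. by rewrite /fibre deriv_map. Qed.

Lemma coef_fibre f t i : (fibre f t)`_i = (f`_i).[t].
Proof. by rewrite coef_map /= ev1_id. Qed.

Lemma size_fibre f t : (lead_coef f).[t] != 0 -> size (fibre f t) = size f.
Proof. by move=> l0; rewrite /fibre size_poly_eq //= ev1_id. Qed.

Lemma lead_coef_fibre f t : (lead_coef f).[t] != 0 ->
  lead_coef (fibre f t) = (lead_coef f).[t].
Proof. by move=> l0; rewrite !lead_coefE size_fibre // coef_fibre. Qed.

(** The degree does not drop at t, and no root of f(t, _) is multiple. *)
Lemma fibre_roots d (f : {poly {poly K}}) t : size f = d.+1 -> (lead_coef f).[t] != 0 ->
    (forall u, (fibre f t).[u] = 0 -> (fibre f^`() t).[u] != 0) ->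
  exists2 w : 'I_d -> K, injective w &
    fibre f t = (lead_coef f).[t] *: \prod_(i < d) ('X - (w i)%:P).
Proof.
move=> sf l0 der; have [r e] := closed_field_poly_normal (fibre f t).
rewrite lead_coef_fibre // in e.
have sr : size r = d.
  have := size_fibre l0; rewrite sf e size_scale // size_prod_XsubC.
  by case.
have ur : uniq r.
  rewrite -separable_prod_XsubC unlock; apply/Pdiv.ClosedField.coprimepP => u.
  move=> ru; have /rootP fu : root (fibre f t) u by rewrite e rootZ.
  have := der _ fu; rewrite fibre_deriv e derivZ hornerZ.
  by rewrite mulf_eq0 negb_or => /andP[].
exists (fun i : 'I_d => r`_i); last first.
  by rewrite e (big_nth 0) big_mkord sr.
by move=> i j /eqP; rewrite nth_uniq ?sr // => /eqP/val_inj.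
Qed.

(** The fundamental theorem of symmetric polynomials, applied to the roots of
    the polynomials f(t, _): a symmetric expression in the roots is a
    polynomial in t. Scaling the roots by the leading coefficient of f avoids
    denominators. *)
Lemma symmetric_in_roots d (f : {poly {poly K}}) (Phi : {mpoly {poly K}[d]}) :
    size f = d.+1 -> Phi \is symmetric ->
  exists G : {poly {poly K}}, forall t (w : 'I_d -> K),
    fibre f t = (lead_coef f).[t] *: \prod_(i < d) ('X - (w i)%:P) ->
    fibre G t = Phi.@[fun i => ((lead_coef f).[t] * w i)%:P].
Proof.
move=> sf /sym_fundamental[T [<- _]].
pose cc : {rmorphism {poly K} -> {poly {poly K}}} := map_poly polyC.
pose c (k : 'I_d) : {poly {poly K}} :=
  ((-1) ^+ k.+1 * lead_coef f ^+ k * f`_(d - k.+1))%:P.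
exists (mmap cc c T) => t w e; set l := (lead_coef f).[t] in e *.
rewrite comp_mpoly_meval.
pose sp : {rmorphism {poly {poly K}} -> {poly K}} :=
  map_poly (ev1 (idfun : {rmorphism K -> K}) t).
rewrite [LHS](rmorph_mmap cc sp c T).
apply: eq_mmap => [p|k].
  rewrite /= -map_poly_comp map_poly_id // => a _ /=.
  by rewrite ev1C.
rewrite -[LHS]/(map_poly _ _%:P) map_polyC /= tnth_mktuple.
have hs := dhomog_mesym d {poly K} k.+1.
rewrite (meval_eq (v2 := fun i => l%:P * (w i)%:P)); last first.
  by move=> i; rewrite polyCM.
rewrite (meval_homogZ _ _ hs).
pose cs := [tuple (w i)%:P | i < d].
have kd : (k.+1 < d.+1)%N by rewrite ltnS.
have := mroots_coeff cs (Ordinal kd); rewrite /=.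
have -> : \prod_(a <- cs) ('X - a%:P) =
    map_poly polyC (\prod_(i < d) ('X - (w i)%:P)).
  rewrite big_tuple rmorph_prod; apply: eq_bigr => i _.
  by rewrite tnth_mktuple rmorphB /= map_polyX map_polyC.
rewrite coef_map /= => mr.
rewrite (meval_eq (v2 := tnth cs)); last by move=> i; rewrite tnth_mktuple.
have -> : (mesym d {poly K} k.+1).@[tnth cs] =
    ((-1) ^+ k.+1 * (\prod_(i < d) ('X - (w i)%:P))`_(d - k.+1))%:P.
  by rewrite polyCM mr rmorphXn /= rmorphN rmorph1 mulrA -exprMn mulrNN mulr1
    expr1n mul1r.
rewrite !rmorphM /= !rmorphXn /= rmorphN rmorph1 !ev1_id -/l.
have -> : (f`_(d - k.+1)).[t] = l * (\prod_(i < d) ('X - (w i)%:P))`_(d - k.+1).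
  by rewrite -coef_fibre e coefZ.
rewrite -!polyC_exp -!polyCM; congr (_%:P).
by rewrite [l ^+ k.+1]exprSr -!mulrA mulrCA; congr (_ * _); rewrite mulrCA.
Qed.

Lemma msym_var (R : idomainType) d (s : 'S_d) i :
  msym s ('X_i : {mpoly R[d]}) = 'X_(s i).
Proof.
rewrite msymX; congr 'X_[_]; apply/mnmP => j; rewrite !mnmE.
by rewrite -(inj_eq (@perm_inj _ s)) permKV.
Qed.

Section LinearResolvent.
Variables (d : nat) (c : K).

(** The linear form whose orbit under the symmetric group separates the
    orderings of the roots. *)
Definition resolvent_form (s : 'S_d) : {mpoly {poly K}[d]} :=
  \sum_(i < d) (c ^+ i)%:P *: 'X_(s i).

Definition resolvent_value (w : 'I_d -> K) (s : 'S_d) : K :=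
  \sum_(i < d) c ^+ i * w (s i).

Lemma msym_resolvent_form s s' :
  msym s (resolvent_form s') = resolvent_form (s' * s)%g.
Proof.
rewrite /resolvent_form raddf_sum /=; apply: eq_bigr => i _.
by rewrite msymZ msym_var permM.
Qed.

Lemma meval_resolvent_form s (w : 'I_d -> K) :
  (resolvent_form s).@[fun i => (w i)%:P] = (resolvent_value w s)%:P.
Proof.
rewrite /resolvent_form raddf_sum rmorph_sum /=; apply: eq_bigr => i _ /=.
by rewrite mevalZ mevalXU -polyCM.
Qed.

Lemma resolvent_symmetric :
  \prod_(s : 'S_d) ('X%:MP - resolvent_form s) \is symmetric.
Proof.
apply/issymP => s; rewrite rmorph_prod [RHS](reindex_inj (mulIg s)) /=.
apply: eq_bigr => s' _; rewrite rmorphB /= msym_resolvent_form.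
by rewrite -[_%:MP]mulr1 mul_mpolyC msymZ msym1.
Qed.

Lemma discriminant_symmetric :
  \prod_(ss : 'S_d * 'S_d | ss.1 != ss.2)
    (resolvent_form ss.1 - resolvent_form ss.2) \is symmetric.
Proof.
apply/issymP => s; rewrite rmorph_prod /=.
pose h (ss : 'S_d * 'S_d) := ((ss.1 * s)%g, (ss.2 * s)%g).
have h_inj : injective h by move=> [a b] [a' b'] [/mulIg-> /mulIg->].
rewrite [RHS](reindex_inj h_inj) /=; apply: eq_big => [ss|ss _].
  by rewrite (inj_eq (mulIg s)).
by rewrite rmorphB /= !msym_resolvent_form.
Qed.

End LinearResolvent.

(** For two orderings the difference of the values is a polynomial in c with a
    nonzero coefficient at an index where the orderings differ. *)
Lemma separating_form d (w : 'I_d -> K) : injective w ->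
  exists c, injective (resolvent_value c w).
Proof.
move=> w_inj.
pose p (ss : 'S_d * 'S_d) : {poly K} :=
  \poly_(i < d) (if insub i is Some j then w (ss.1 j) - w (ss.2 j) else 0).
have pE c ss : (p ss).[c] = resolvent_value c w ss.1 - resolvent_value c w ss.2.
  rewrite horner_poly -sumrB; apply: eq_bigr => i _.
  by rewrite valK -mulrBr mulrC.
have p0 ss : ss.1 != ss.2 -> p ss != 0.
  apply: contraNneq => ps0; apply/eqP/permP => i; apply: w_inj.
  apply/eqP; rewrite -subr_eq0; apply/eqP.
  by have := congr1 (fun q : {poly K} => q`_i) ps0;
    rewrite coef_poly ltn_ord valK coef0.
have [|c] := @poly_nonroot K (\prod_(ss | ss.1 != ss.2) p ss).
  by rewrite prodf_seq_neq0; apply/allP => ss _; apply/implyP/p0.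
rewrite horner_prod prodf_seq_neq0 => /allP h.
exists c => s s' e; apply/eqP; apply: contraT => ss'.
have := h (s, s') (mem_index_enum _); rewrite /= ss' /= pE /= e.
by rewrite subrr eqxx.
Qed.

(** The product of the factors z - value and the discriminant delta of the
    values are symmetric in the roots, hence polynomials in t. One fibre with
    distinct roots is enough to choose the linear form and to see that delta
    is not zero. *)
Lemma resolvent d (f : {poly {poly K}}) t0 (w0 : 'I_d -> K) :
    size f = d.+1 -> (lead_coef f).[t0] != 0 -> injective w0 ->
    fibre f t0 = (lead_coef f).[t0] *: \prod_(i < d) ('X - (w0 i)%:P) ->
  exists c F delta, delta != 0 /\ forall t (w : 'I_d -> K),
    let z := resolvent_value c (fun i => (lead_coef f).[t] * w i) in
    fibre f t = (lead_coef f).[t] *: \prod_(i < d) ('X - (w i)%:P) ->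
    fibre F t = \prod_(s : 'S_d) ('X - (z s)%:P) /\
    (delta.[t] != 0 -> injective z).
Proof.
move=> sf l0 w0_inj e0.
have lw_inj : injective (fun i => (lead_coef f).[t0] * w0 i).
  by move=> i j /(mulfI l0)/w0_inj.
have [c c_inj] := separating_form lw_inj.
have [F FE] := symmetric_in_roots sf (resolvent_symmetric d c).
have [G GE] := symmetric_in_roots sf (discriminant_symmetric d c).
have discE t (w : 'I_d -> K) :
    fibre f t = (lead_coef f).[t] *: \prod_(i < d) ('X - (w i)%:P) ->
    (G`_0).[t] = \prod_(ss : 'S_d * 'S_d | ss.1 != ss.2)
      (resolvent_value c (fun i => (lead_coef f).[t] * w i) ss.1 -
       resolvent_value c (fun i => (lead_coef f).[t] * w i) ss.2).
  move=> /GE; rewrite rmorph_prod /= => GtE.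
  have cE (a : K) : a = (a%:P)`_0 by rewrite coefC.
  rewrite -coef_fibre GtE [RHS]cE rmorph_prod /=.
  apply: (congr1 (fun q : {poly K} => q`_0)); apply: eq_bigr => ss _.
  by rewrite rmorphB /= !meval_resolvent_form rmorphB.
exists c, F, (G`_0); split.
  have : (G`_0).[t0] != 0.
    rewrite (discE _ _ e0) prodf_seq_neq0; apply/allP => -[s s'] _ /=.
    by apply/implyP => ss'; rewrite subr_eq0 (inj_eq c_inj).
  by apply: contraNneq => ->; rewrite horner0.
move=> t w z e; split.
  rewrite (FE _ _ e) rmorph_prod; apply: eq_bigr => s _ /=.
  by rewrite rmorphB /= mevalC meval_resolvent_form.
rewrite (discE _ _ e) prodf_seq_neq0 => /allP h s s' zs.
apply/eqP; apply: contraT => ss'.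
have := h (s, s') (mem_index_enum _); rewrite /= ss' /=.
by rewrite -/(z s) -/(z s') zs subrr eqxx.
Qed.


End Resolvent.

(** * Irreducible polynomials and finite closed sets *)

Lemma irreducible_factor (R : idomainType) (F : {poly R}) : (1 < size F)%N ->
  exists2 p, irreducible_poly p & p %| F.
Proof.
move=> sF; have F0 : F != 0 by rewrite -size_poly_gt0 (ltn_trans _ sF).
have [|p [sp pF] pmin] := @minimal_size R
    (fun p => (1 < size p)%N /\ p %| F).
  by exists F; rewrite dvdpp.
exists p => //; split=> // q sq1 qp.
have p0 : p != 0 by rewrite -size_poly_gt0 (ltn_trans _ sp).
have q0 : q != 0 by apply: contraNneq p0 => q0; rewrite q0 dvd0p in qp.
rewrite -dvdp_size_eqp // eqn_leq dvdp_leq //= pmin //; split.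
  by rewrite ltn_neqAle eq_sym sq1 size_poly_gt0.
exact: dvdp_trans qp pF.
Qed.

Lemma irreducible_coprime (R : idomainType) (p q : {poly R}) :
  irreducible_poly p -> ~~ (p %| q) -> coprimep p q.
Proof.
move=> [sp irr] npq; rewrite /coprimep; apply: contraNT npq => s1.
by have := irr _ s1 (dvdp_gcdl _ _); rewrite /eqp => /andP[_ /dvdp_trans->] //;
  apply: dvdp_gcdr.
Qed.

Lemma coprime_bezout (R : idomainType) (p q : {poly R}) : coprimep p q ->
  exists2 rho, rho != 0 & exists a b, rho%:P = a * p + b * q.
Proof.
move=> /Bezout_coprimepP[[a b] /= e].
have /size_poly1P[rho rho0 e'] : size (a * p + b * q) == 1%N.
  by rewrite (eqp_size e) size_poly1.
by exists rho => //; exists a, b.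
Qed.

Section ClosedSets.
Variables (K : closedFieldType) (n : nat).

Lemma zclosedU (A B : set (proj K n)) :
  zclosed A -> zclosed B -> zclosed (A `|` B).
Proof.
move=> cA cB; have := @zopenI K n (~` A) (~` B).
by rewrite /zopen !setCK setCI !setCK; apply.
Qed.

Lemma zclosed1 (x : proj K n) : zclosed [set x].
Proof.
pose c := coords x 0.
exists [set p | exists i j, p = c j *: 'X_i - c i *: 'X_j].
  by move=> _ [i [j ->]]; exists 1%N; rewrite rpredB // dhomogZ // dhomogXU.
apply/seteqP; split=> y /=; last first.
  move=> h; rewrite -[y]coordsK -[x]coordsK; apply: pt_eq_cross.
  - exact: coords_neq0.
  - exact: coords_neq0.
  move=> i j; have := h (c j *: 'X_i - c i *: 'X_j) _.
  rewrite /evalp mevalB !mevalZ !mevalXU => /(_ (ex_intro _ i (ex_intro _ j erefl))).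
  by move/eqP; rewrite subr_eq0 => /eqP; rewrite -/c mulrC => ->; rewrite mulrC.
move=> -> _ [i [j ->]].
by rewrite /evalp mevalB !mevalZ !mevalXU mulrC subrr.
Qed.

Lemma zclosed_seq (s : seq (proj K n)) : zclosed [set` s].
Proof.
elim: s => [|a s IH].
  exists [set 1] => [_ ->|]; first by exists 0%N; apply: dhomog1.
  apply/seteqP; split=> x //= /(_ _ erefl)/eqP.
  by rewrite /evalp meval1 oner_eq0.
rewrite (_ : [set` _] = [set a] `|` [set` s]).
  by apply: zclosedU => //; apply: zclosed1.
apply/seteqP; split=> x /=; rewrite in_cons.
  by case/orP=> [/eqP|]; [left|right].
by case=> [->|->]; rewrite ?eqxx ?orbT.
Qed.

(** Points are closed, so an irreducible finite set is a single point. *)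
Lemma irreducible_finite (Y : set (proj K n)) : zirreducible Y ->
  finite_set Y -> exists x, Y = [set x].
Proof.
move=> [Y0 irrY] /finite_seqP[s eY].
have : Y `<=` [set` s] by rewrite eY.
elim: s {eY} => [|a s IH] Ys; first by case: Y0 => x /Ys.
have [||] := irrY _ _ (zclosed1 a) (zclosed_seq s).
- by move=> x /Ys /=; rewrite in_cons => /orP[/eqP|]; [left|right].
- move=> Ya; exists a; apply/seteqP; split=> // _ ->.
  by case: Y0 => x Yx; have <- := Ya _ Yx.
- exact: IH.
Qed.

Lemma irreducible1 (x : proj K n) : zirreducible [set x].
Proof.
split=> [|C1 C2 _ _ h]; first by exists x.
by have [Cx|Cx] := h x erefl; [left|right] => _ ->.
Qed.

End ClosedSets.

(** * The affine chart of the projective plane *)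

Section Dehomogenization.
Variable K : closedFieldType.

Definition const2 : {rmorphism K -> {poly {poly K}}} := polyC \o polyC.

Definition affine_coord (A : nzRingType) (t z : A) (i : 'I_3) : A :=
  nth 0 [:: 1; t; z] i.

Definition dehom (p : {mpoly K[3]}) : {poly {poly K}} :=
  mmap const2 (affine_coord 'X%:P 'X) p.

Lemma dehom_is_zmod_morphism : zmod_morphism dehom.
Proof. by move=> p q; rewrite /dehom rmorphB. Qed.

Lemma dehom_is_monoid_morphism : monoid_morphism dehom.
Proof. by split=> [|p q]; rewrite /dehom ?rmorph1 ?rmorphM. Qed.

HB.instance Definition _ := GRing.isZmodMorphism.Build {mpoly K[3]}
  {poly {poly K}} dehom dehom_is_zmod_morphism.
HB.instance Definition _ := GRing.isMonoidMorphism.Build {mpoly K[3]}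
  {poly {poly K}} dehom dehom_is_monoid_morphism.

Lemma dehomB p q : dehom (p - q) = dehom p - dehom q.
Proof. exact: rmorphB. Qed.

Lemma dehomM p q : dehom (p * q) = dehom p * dehom q.
Proof. exact: rmorphM. Qed.

Lemma fibre_dehom p t z : (fibre (dehom p) t).[z] = p.@[affine_coord t z].
Proof.
rewrite -fibre_horner /dehom.
rewrite [LHS](rmorph_mmap const2 (ev2 (idfun : {rmorphism K -> K}) t z)).
apply: eq_mmap => [c|]; first by rewrite /= ev2C ev1C.
by case=> [[|[|[|//]]] i] /=; rewrite /affine_coord /= ?rmorph1 ?ev2X ?ev2C ?ev1X.
Qed.

Lemma ev2_generic g : ev2 const2 'X%:P 'X g = g.
Proof.
have ev1_generic p : ev1 const2 'X%:P p = p%:P.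
  elim/poly_ind: p => [|p c IH]; first by rewrite !rmorph0.
  by rewrite rmorphD rmorphM /= IH ev1X ev1C /= -polyCM -polyCD.
elim/poly_ind: g => [|g p IH]; first by rewrite rmorph0.
by rewrite rmorphD rmorphM /= IH ev2X ev2C ev1_generic.
Qed.

Lemma dehom_surj g : exists d G, G \is d.-homog /\ dehom G = g.
Proof.
have [N [M [G [hG eG]]]] := homogenize g (dhomogXU K (ord0 : 'I_3))
  (dhomogXU K (inord 1)) (dhomogXU K (inord 2)) (dhomogXU K ord0).
exists (1 * N + 1 * M)%N, G; split=> //.
rewrite [LHS](eG _ const2 (affine_coord 'X%:P 'X) 'X%:P 'X).
- by rewrite mmapX mmap1U /affine_coord /= !expr1n !mul1r ev2_generic.
- by rewrite !mmapX !mmap1U /affine_coord /= inordK //= mulr1.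
- by rewrite !mmapX !mmap1U /affine_coord /= inordK //= mulr1.
Qed.

(** In a fixed degree the exponent of the first variable is determined by the
    two others. *)
Lemma dehom_inj p d : p \is d.-homog -> dehom p = 0 -> p = 0.
Proof.
move=> hp p0; apply/mpolyP => m; rewrite mcoeff0.
have [md|md] := eqVneq (mdeg m) d; last first.
  by apply: dhomog_nemf_coeff hp _.
have monoE (k : 'X_{1..3}) : mmap1 (affine_coord ('X%:P : {poly {poly K}}) 'X) k =
    ('X^(k (inord 1)))%:P * 'X^(k (inord 2)).
  rewrite /mmap1 !big_ord_recl big_ord0 /affine_coord /= expr1n mul1r mulr1.
  rewrite rmorphXn /=; congr (_ ^+ k _ * _ ^+ k _); apply: val_inj;
  by rewrite /= inordK.
have := congr1 (fun q : {poly {poly K}} => (q`_(m (inord 2)))`_(m (inord 1))) p0.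
rewrite !coef0 /dehom /mmap !coef_sum.
have [mp|/memN_msupp_eq0 //] := boolP (m \in msupp p).
rewrite (bigD1_seq m) //= big1_seq ?addr0.
  by rewrite monoE !coefCM coefXn eqxx mulr1 coefXn eqxx mulr1.
move=> k /andP[km kp]; rewrite monoE !coefCM coefXn.
case: eqP => [e2|]; last by rewrite !(mulr0, coef0).
rewrite mulr1 coefXn.
case: eqP => [e1|]; last by rewrite !(mulr0).
case/eqP: km; apply/mnmP.
have dk : mdeg k = d := dhomog_mf hp kp.
have e0 : k ord0 = m ord0.
  move: dk; rewrite -md !mdegE !big_ord_recl !big_ord0 !addn0.
  have -> : lift ord0 (ord0 : 'I_2) = inord 1 by apply: val_inj; rewrite /= inordK.
  have -> : lift ord0 (lift ord0 (ord0 : 'I_1)) = inord 2.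
    by apply: val_inj; rewrite /= inordK.
  by rewrite e1 e2 => /addIn.
case=> [[|[|[|//]]] lt].
- by rewrite (_ : Ordinal lt = ord0) //; apply: val_inj.
- by rewrite (_ : Ordinal lt = inord 1) //; apply: val_inj; rewrite /= inordK.
- by rewrite (_ : Ordinal lt = inord 2) //; apply: val_inj; rewrite /= inordK.
Qed.

Lemma dhomog_mderiv n d i (p : {mpoly K[n]}) : p \is d.-homog ->
  p^`M(i) \is d.-1.-homog.
Proof.
move=> /dhomogP hp; apply/dhomogP => m.
rewrite mcoeff_msupp mcoeff_mderiv => h.
have : (m + U_(i))%MM \in msupp p.
  by rewrite mcoeff_msupp; apply: contraNneq h => ->; rewrite mul0rn.
by move=> /hp <- /=; rewrite mdegD mdeg1 addn1.
Qed.

Lemma mpoly_ring_ind n (P : {mpoly K[n]} -> Prop) :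
    (forall c, P c%:MP) -> (forall i, P 'X_i) ->
    (forall p q, P p -> P q -> P (p + q)) ->
    (forall p q, P p -> P q -> P (p * q)) -> forall p, P p.
Proof.
move=> PC PX PD PM p; rewrite [p]mpolyE.
apply: (big_ind P) => [|p' q'|m _]; first by rewrite -mpolyC0.
  exact: PD.
rewrite -mul_mpolyC mpolyXE_id; apply: (PM) => //.
apply: (big_ind P) => [|p' q'|i _]; [exact: (PC 1)|exact: PM|].
by elim: (m i) => [|k IH]; [rewrite expr0; exact: (PC 1)|rewrite exprS; apply: PM].
Qed.

Lemma dehom_deriv p : dehom p^`M(inord 2) = (dehom p)^`().
Proof.
elim/mpoly_ring_ind: p => [c|i|p q IHp IHq|p q IHp IHq].
- by rewrite mderivC rmorph0 /dehom mmapC /= derivC.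
- rewrite mderivX mnm1E /dehom mmapZ !mmapX mmap1U /affine_coord.
  case: i => [[|[|[|//]]] lt] /=.
  + by rewrite -val_eqE /= inordK // rmorph0 mul0r -polyC1 derivC.
  + by rewrite -val_eqE /= inordK // rmorph0 mul0r derivC.
  + have e : Ordinal lt = inord 2 by apply: val_inj; rewrite /= inordK.
    by rewrite e eqxx -[X in (X - _)%MM]add0m addmK mmap11 derivX mulr1 rmorph1.
- by rewrite mderivD !rmorphD derivD /= IHp IHq.
- by rewrite mderivM rmorphD !rmorphM derivM /= IHp IHq.
Qed.

End Dehomogenization.

(** * Plane curves without vertical tangents *)

Section AffinePlane.
Variable K : closedFieldType.

Definition apt (t z : K) : proj K 2 := pt (\row_i affine_coord t z i).

Lemma affine_row_neq0 (t z : K) : \row_i affine_coord t z i != 0.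
Proof.
by apply/eqP => /rowP/(_ 0)/eqP; rewrite !mxE /affine_coord /= oner_eq0.
Qed.

Lemma evalp_apt d p t z : p \is d.-homog ->
  (evalp p (apt t z) == 0) = ((fibre (dehom p) t).[z] == 0).
Proof.
move=> hp; rewrite fibre_dehom (evalp_pt_eq0 (affine_row_neq0 t z) hp).
by congr (_ == 0); apply: meval_eq => i; rewrite mxE.
Qed.

Lemma apt_inj t z t' z' : apt t z = apt t' z' -> t = t' /\ z = z'.
Proof.
move=> e; have sep (i : 'I_3) (c : K) :
    (affine_coord t z i == c) = (affine_coord t' z' i == c).
  pose p : {mpoly K[3]} := 'X_i - c *: 'X_ord0.
  have hp : p \is 1.-homog by rewrite rpredB ?dhomogZ ?dhomogXU.
  have := evalp_apt t z hp; rewrite e (evalp_apt _ _ hp) !fibre_dehom.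
  by rewrite !mevalB !mevalZ !mevalXU /= !mulr1 !subr_eq0 => ->.
have := sep (inord 1) t; have := sep (inord 2) z.
by rewrite /affine_coord /= !inordK //= !eqxx => /esym/eqP-> /esym/eqP->.
Qed.

Lemma affine_point (x : proj K 2) : coords x 0 ord0 != 0 ->
  x = apt (coords x 0 (inord 1) / coords x 0 ord0)
          (coords x 0 (inord 2) / coords x 0 ord0).
Proof.
move=> x0; rewrite {1}(pt_coord_ratio x0); congr pt; apply/rowP => i.
rewrite !mxE /affine_coord; case: i => [[|[|[|//]]] lt] /=.
- by rewrite (_ : Ordinal lt = ord0) ?divff //; apply: val_inj.
- by rewrite (_ : Ordinal lt = inord 1) //; apply: val_inj; rewrite /= inordK.
- by rewrite (_ : Ordinal lt = inord 2) //; apply: val_inj; rewrite /= inordK.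
Qed.

End AffinePlane.

Section PlaneCurve.
Variables (K : closedFieldType) (F : {poly {poly K}}) (Delta : {poly K}).
Hypothesis Delta0 : Delta != 0.
Hypothesis lF : forall t, Delta.[t] != 0 -> (lead_coef F).[t] != 0.
Hypothesis sepF : forall t z, Delta.[t] != 0 ->
  (fibre F t).[z] = 0 -> (fibre F^`() t).[z] != 0.

Definition plane_curve : set (proj K 2) :=
  [set x | exists t z, [/\ Delta.[t] != 0, (fibre F t).[z] = 0 & x = apt t z]].

Lemma plane_curve_apt t z :
  plane_curve (apt t z) <-> Delta.[t] != 0 /\ (fibre F t).[z] = 0.
Proof.
by split=> [[t' [z' [? ? /apt_inj[-> ->]]]]|[? ?]] //; exists t, z.
Qed.

Lemma F_neq0 : F != 0.
Proof.
have [t /lF] := poly_nonroot Delta0.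
by apply: contraNneq => ->; rewrite lead_coef0 horner0.
Qed.

Lemma quasi_projective_plane_curve : quasi_projective plane_curve.
Proof.
have [d [G [hG GF]]] := dehom_surj F.
have [e [H [hH HD]]] := dehom_surj Delta%:P.
exists [set x | evalp G x = 0],
  ([set x | evalp 'X_ord0 x != 0] `&` [set x | evalp H x != 0]).
split; first exact: zclosed_eq0 hG.
  by apply: zopenI; [exact: zopen_neq0 (dhomogXU _ _)|exact: zopen_neq0 hH].
have HE t z : (evalp H (apt t z) == 0) = (Delta.[t] == 0).
  by rewrite (evalp_apt _ _ hH) HD /fibre map_polyC hornerC /= ev1_id.
apply/seteqP; split=> [x [t [z [Dt Fz ->]]]|x [/= Gx [x0 Hx]]].
  split=> /=; first by apply/eqP; rewrite (evalp_apt _ _ hG) GF Fz.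
  split; last by rewrite HE.
  rewrite (evalp_apt _ _ (dhomogXU _ _)) fibre_dehom mevalXU /=.
  exact: oner_neq0.
rewrite /evalp mevalXU in x0; have xE := affine_point x0.
set t := _ / _ in xE; set z := _ / _ in xE.
rewrite xE in Gx Hx; rewrite xE; apply/plane_curve_apt.
by rewrite -(HE t z) -GF; split=> //; apply/eqP; rewrite -(evalp_apt _ _ hG) Gx.
Qed.

Lemma finite_fibres rho : rho != 0 -> finite_set
  [set x | exists t z, [/\ rho.[t] = 0, Delta.[t] != 0, (fibre F t).[z] = 0 &
                           x = apt t z]].
Proof.
move=> rho0; apply: (@sub_finite_set _ _ (\bigcup_(t in [set t | rho.[t] = 0 /\
    Delta.[t] != 0]) (apt t @` [set z | (fibre F t).[z] = 0]))).
  by move=> x [t [z [rt Dt Fz ->]]]; exists t => //; exists z.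
apply: bigcup_finite => [|t [_ Dt]].
  by apply: sub_finite_set (finite_roots rho0) => t [].
apply/finite_image/finite_roots.
by rewrite -size_poly_gt0 size_fibre ?lF // size_poly_gt0 F_neq0.
Qed.

(** Over infinitely many t the polynomial F(t, _) has as many roots as its
    degree, so that a remainder modulo F that vanishes on the curve is zero. *)
Lemma vanishing_divides h :
  (forall t z, Delta.[t] != 0 -> (fibre F t).[z] = 0 -> (fibre h t).[z] = 0) ->
  F %| h.
Proof.
move=> hv; have F0 := F_neq0; have sF : size F = (size F).-1.+1.
  by rewrite prednK // size_poly_gt0.
set r := h %% F; have sr : (size r < size F)%N by rewrite ltn_modp.
have rv t : Delta.[t] != 0 -> fibre r t = 0.
  move=> Dt; apply/eqP; apply: contraT => rt0.
  have [w w_inj wE] := fibre_roots sF (lF Dt) (fun z => sepF Dt).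
  have /(max_poly_roots rt0) : all (root (fibre r t)) (codom w).
    apply/allP => _ /codomP[i ->]; apply/rootP.
    have Fw : (fibre F t).[w i] = 0.
      apply/rootP; rewrite wE rootZ ?lF // -big_enum /=.
      by rewrite -(big_map w xpredT (fun a => 'X - a%:P)) root_prod_XsubC
        map_f // mem_enum.
    have := congr1 (fun q => (fibre q t).[w i]) (Pdiv.Idomain.divp_eq h F).
    rewrite /fibre /= -mul_polyC rmorphD !rmorphM /= !hornerE.
    by rewrite -!/(fibre _ t) Fw (hv _ _ Dt Fw) !mulr0 add0r => ->.
  move=> /(_ _); rewrite map_inj_uniq ?enum_uniq // => /(_ isT).
  rewrite size_map size_enum_ord => lt.
  have := leq_trans lt (size_poly _ _); rewrite sF in sr.
  by rewrite ltnNge; move: sr; rewrite ltnS => ->.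
apply/modp_eq0P; apply/polyP => i; rewrite coef0.
apply/eqP; apply: contraT => ri0.
have [t] : exists t, (Delta * r`_i).[t] != 0.
  by apply: poly_nonroot; rewrite mulf_neq0.
rewrite hornerM mulf_eq0 negb_or => /andP[/rv rt0].
by rewrite -coef_fibre rt0 coef0 eqxx.
Qed.

Lemma dehom_vanishing d p : p \is d.-homog ->
  (forall x, plane_curve x -> evalp p x = 0) -> F %| dehom p.
Proof.
move=> hp pv; apply: vanishing_divides => t z Dt Fz; apply/eqP.
rewrite -(evalp_apt _ _ hp); apply/eqP/pv.
by apply/plane_curve_apt.
Qed.

(** Up to a form L that does not vanish at the point and powers of the first
    coordinate, p is a multiple S of G. Differentiating L p = S G at a common
    zero of p and G leaves only the gradients. *)
Lemma gradient_proportional g G d p t z : G \is g.-homog -> dehom G = F ->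
    p \is d.-homog -> (forall x, plane_curve x -> evalp p x = 0) ->
    plane_curve (apt t z) ->
  exists mu, forall i, evalp p^`M(i) (apt t z) = mu * evalp G^`M(i) (apt t z).
Proof.
move=> hG GF hp pv Zx; have [Dt Fz] := (plane_curve_apt t z).1 Zx.
have [N [s es]] := dvdp_lead_coef (dehom_vanishing hp pv).
have [a [S [hS SE]]] := dehom_surj s.
have [l [L [hL LE]]] := dehom_surj (lead_coef F ^+ N)%:P.
set x := apt t z in Zx *.
have Gx : evalp G x = 0 by apply/eqP; rewrite (evalp_apt _ _ hG) GF Fz.
have px : evalp p x = 0 := pv _ Zx.
have Lx : evalp L x != 0.
  rewrite (evalp_apt _ _ hL) LE /fibre map_polyC hornerC /= ev1_id.
  by rewrite horner_exp expf_neq0 // lF.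
pose A := 'X_ord0 ^+ (a + g) * (L * p); pose B := 'X_ord0 ^+ (l + d) * (S * G).
have dX0 k : dehom ('X_ord0 ^+ k) = 1.
  by rewrite rmorphXn /= /dehom mmapX mmap1U expr1n.
have hX k : ('X_ord0 ^+ k : {mpoly K[3]}) \is k.-homog.
  by rewrite -{2}[k]mul1n; apply: dhomogMn; apply: dhomogXU.
have AB : A = B.
  apply/eqP; rewrite -subr_eq0; apply/eqP.
  apply: (dehom_inj (d := (a + g + (l + d))%N)).
    apply: rpredB; first by apply: dhomogM => //; apply: dhomogM.
    by rewrite addnC; apply: dhomogM => //; apply: dhomogM.
  rewrite dehomB !dehomM !dX0 !mul1r LE SE GF mul_polyC es.
  exact: subrr.
have x0 k : evalp ('X_ord0 ^+ k) x != 0.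
  rewrite (evalp_apt _ _ (hX k)) dX0 /fibre rmorph1 hornerC.
  exact: oner_neq0.
exists (evalp ('X_ord0 ^+ (l + d)) x * evalp S x /
        (evalp ('X_ord0 ^+ (a + g)) x * evalp L x)) => i.
have := congr1 (fun q => evalp q^`M(i) x) AB.
rewrite /A /B /evalp !mderivM !(mevalD, mevalM) -!/(evalp _ x) px Gx.
rewrite !(mulr0, addr0, add0r) !mulrA => e.
have xL : evalp ('X_ord0 ^+ (a + g)) x * evalp L x != 0 by rewrite mulf_neq0.
by apply: (mulfI xL); rewrite e [RHS]mulrC [RHS]mulrAC divfK.
Qed.

(** The tangent space is the kernel of the gradient of the homogenized F,
    which is not zero because z is a simple root of F(t, _). *)
Lemma smooth_plane_curve : smooth plane_curve 1.
Proof.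
move=> _ [t [z [Dt Fz ->]]].
have [g [G [hG GF]]] := dehom_surj F.
have Zx : plane_curve (apt t z) by apply/plane_curve_apt.
set x := apt t z in Zx *.
have G2 : evalp G^`M(inord 2) x != 0.
  rewrite (evalp_apt _ _ (dhomog_mderiv _ hG)) dehom_deriv GF.
  exact: sepF.
have Gv y : plane_curve y -> evalp G y = 0.
  by move=> [t' [z' [Dt' Fz' ->]]]; apply/eqP; rewrite (evalp_apt _ _ hG) GF Fz'.
pose M : 'M[K]_(3, 1) := \col_i evalp G^`M(i) x.
have ME (v : 'rV[K]_3) : (v *m M) 0 0 = \sum_(i < 3) evalp G^`M(i) x * v 0 i.
  by rewrite mxE; apply: eq_bigr => i _; rewrite mxE mulrC.
pose f : 'Hom('rV[K]_3, 'rV[K]_1) := linfun (mulmxr M).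
exists (lker f) => [v|].
  have fE : (v \in lker f) = ((v *m M) 0 0 == 0).
    rewrite memv_ker lfunE /=; apply/eqP/eqP => [->|e]; first by rewrite mxE.
    by apply/matrixP => i j; rewrite !ord1 e mxE.
  rewrite fE ME; split=> [/eqP Mv p e hp pv|h]; last first.
    by apply/eqP; apply: h hG _ => y /Gv.
  have [mu muE] := gradient_proportional hG GF hp pv Zx.
  under eq_bigr => i _ do rewrite muE -mulrA.
  by rewrite -mulr_sumr Mv mulr0.
have := limg_ker_dim f fullv; rewrite capfv dimvf.
have -> : \dim (limg f) = 1%N.
  apply/eqP; rewrite eqn_leq; apply/andP; split.
    by rewrite (leq_trans (dimvS (subvf _))) // dimvf.
  rewrite lt0n dimv_eq0; apply: contra G2 => /eqP lf0.
  have : f (delta_mx 0 (inord 2)) \in limg f by apply: memv_img; apply: memvf.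
  rewrite lf0 memv0 lfunE /= => /eqP/(congr1 (fun A : 'rV[K]_1 => A 0 0)).
  by rewrite -rowE !mxE => ->.
by rewrite addn1 => -[].
Qed.

Definition vanish_on (Y : set (proj K 2)) (g : {poly {poly K}}) :=
  forall t z, Y (apt t z) -> (fibre g t).[z] = 0.

Lemma vanish_on_homog (Y : set (proj K 2)) d p : Y `<=` plane_curve ->
  p \is d.-homog ->
  vanish_on Y (dehom p) <-> forall x, Y x -> evalp p x = 0.
Proof.
move=> YZ hp; split=> [v x Yx|v t z Yx].
  have [t [z [_ _ e]]] := YZ _ Yx; rewrite e in Yx *.
  by apply/eqP; rewrite (evalp_apt _ _ hp) v.
by apply/eqP; rewrite -(evalp_apt _ _ hp) v.
Qed.

Lemma vanish_onM (Y : set (proj K 2)) g h : zirreducible Y -> Y `<=` plane_curve ->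
  vanish_on Y (g * h) -> vanish_on Y g \/ vanish_on Y h.
Proof.
move=> irrY YZ v.
have [d [G [hG GE]]] := dehom_surj g; have [e [H [hH HE]]] := dehom_surj h.
have [|vG|vH] := irreducible_neq0M irrY hG hH.
- move=> x Yx; have := (vanish_on_homog YZ (dhomogM hG hH)).1.
  rewrite rmorphM /= GE HE => /(_ v x Yx).
  by rewrite /evalp mevalM.
- by left; rewrite -GE; apply/(vanish_on_homog YZ hG).
- by right; rewrite -HE; apply/(vanish_on_homog YZ hH).
Qed.

Lemma vanish_on_const (Y : set (proj K 2)) rho : Y `<=` plane_curve ->
  rho != 0 -> vanish_on Y rho%:P -> finite_set Y.
Proof.
move=> YZ rho0 v; apply: sub_finite_set (finite_fibres rho0) => x Yx.
have [t [z [Dt Fz e]]] := YZ _ Yx; exists t, z; split=> //.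
rewrite e in Yx; have := v _ _ Yx.
by rewrite /fibre map_polyC hornerC /= ev1_id.
Qed.

Lemma vanish_on_coprime (Y : set (proj K 2)) g h : Y `<=` plane_curve ->
  coprimep g h -> vanish_on Y g -> vanish_on Y h -> finite_set Y.
Proof.
move=> YZ /coprime_bezout[rho rho0 [a [b e]]] vg vh.
apply: (vanish_on_const YZ rho0) => t z Yx.
rewrite e /fibre rmorphD !rmorphM /= hornerD !hornerM.
by rewrite -!/(fibre _ t) vg // vh // !mulr0 addr0.
Qed.

(** Among the polynomials vanishing on Y, one of least degree in z shares no
    factor with a polynomial that does not vanish on Y; a Bezout relation
    between the two leaves finitely many t for their common zeros. *)
Lemma proper_closed_finite (Y C : set (proj K 2)) : zirreducible Y ->
  Y `<=` plane_curve -> zclosed C -> ~ Y `<=` C -> finite_set (Y `&` C).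
Proof.
move=> irrY YZ [S hS eC] YC; apply: contrapT => Cinf.
have [p [d [Sp hp pY]]] : exists p d, [/\ S p, p \is d.-homog &
    ~ forall x, Y x -> evalp p x = 0].
  apply: contrapT => H; apply: YC => x Yx; rewrite eC => p Sp.
  have [d hp] := hS _ Sp; apply: contrapT => px; apply: H.
  by exists p, d; split=> // /(_ _ Yx).
have subZ : Y `&` C `<=` plane_curve by move=> x [/YZ].
have pC : vanish_on (Y `&` C) (dehom p).
  by apply/(vanish_on_homog subZ hp) => x [_]; rewrite eC; apply.
have [g [g0 gY] gmin] := @minimal_size _
    (fun g => g != 0 /\ vanish_on Y g) (ex_intro _ F (conj F_neq0 (fun t z Yx =>
      proj2 ((plane_curve_apt t z).1 (YZ _ Yx))))).
have not_const rho : rho != 0 -> ~ vanish_on Y rho%:P.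
  move=> rho0 /(vanish_on_const YZ rho0) Yfin; apply: Cinf.
  by apply: sub_finite_set Yfin => x [].
have gC : vanish_on (Y `&` C) g by move=> t z [/gY].
have /negP ncop : ~ coprimep g (dehom p).
  by move=> cop; apply: Cinf; apply: vanish_on_coprime cop gC pC.
set q := gcdp g (dehom p) in ncop.
have q0 : q != 0 by rewrite gcdp_eq0 negb_and g0.
have sq : (1 < size q)%N by rewrite ltn_neqAle eq_sym ncop size_poly_gt0.
have [k k0 [s e]] := lead_divisible (dvdp_gcdl g (dehom p)).
have [k' k'0 [s' e']] := lead_divisible (dvdp_gcdr g (dehom p)).
rewrite -/q -!mul_polyC in e e'.
have s0 : s != 0.
  apply: contraNneq g0 => s0; move: e; rewrite s0 mul0r => /eqP.
  by rewrite mulf_eq0 polyC_eq0 (negPf k0).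
have vM a h : vanish_on Y h -> vanish_on Y (a * h).
  by move=> vh t z Yx; rewrite /fibre rmorphM hornerM -!/(fibre _ t) vh ?mulr0.
have [sY|qY] : vanish_on Y s \/ vanish_on Y q.
- by apply: vanish_onM => //; rewrite -e; apply: vM.
- have := gmin _ (conj s0 sY).
  have -> : size g = (size s + size q).-1.
    by rewrite -size_mul // -e mul_polyC size_scale.
  case: (size q) sq => [|[|m]] // _.
  by rewrite addnS /= -{2}[size s]addn0 leq_add2l.
- have [|kY|pY'] := vanish_onM irrY YZ (g := k'%:P) (h := dehom p).
  + by rewrite e'; apply: vM.
  + exact: (not_const _ k'0 kY).
  + by apply: pY; apply/(vanish_on_homog YZ hp).
Qed.

Lemma plane_curve_dim_le1 : ~ zchain plane_curve 2.
Proof.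
move=> [Y [hY ltY]].
have [irr1 [C1 cC1 Y1E]] := hY 1%N isT; have [irr2 [C2 cC2 Y2E]] := hY 2%N isT.
have [irr0 _] := hY 0%N isT.
have [Y01 nY10] := ltY 0%N isT; have [Y12 nY21] := ltY 1%N isT.
have Y2Z : Y 2%N `<=` plane_curve by rewrite Y2E => x [].
have [x Yx] : exists x, Y 1%N = [set x].
  apply: irreducible_finite => //.
  apply: (@sub_finite_set _ _ (Y 2%N `&` C1)).
    by move=> x Yx; split; [exact: Y12|move: Yx; rewrite Y1E => -[]].
  apply: proper_closed_finite => // Y2C1; apply: nY21 => x Yx.
  by rewrite Y1E; split; [exact: Y2Z|exact: Y2C1].
have [[y Y0y] _] := irr0; apply: nY10; rewrite Yx => _ ->.
by have := Y01 _ Y0y; rewrite Yx => <-.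
Qed.

Section Component.
Variable f1 : {poly {poly K}}.
Hypothesis f1_irr : irreducible_poly f1.
Hypothesis f1F : f1 %| F.
Hypothesis lf1 : forall t, Delta.[t] != 0 -> (lead_coef f1).[t] != 0.

Definition component : set (proj K 2) :=
  [set x | exists t z, [/\ Delta.[t] != 0, (fibre F t).[z] = 0,
                           (fibre f1 t).[z] = 0 & x = apt t z]].

Lemma component_sub : component `<=` plane_curve.
Proof. by move=> x [t [z [? ? _ ?]]]; exists t, z. Qed.

Lemma component_apt t z : component (apt t z) -> (fibre f1 t).[z] = 0.
Proof. by move=> [t' [z' [_ _ ? /apt_inj[-> ->]]]]. Qed.

(** Outside finitely many t, the roots of f1(t, _) are roots of F(t, _). *)
Lemma component_infinite : infinite_set component.
Proof.
move=> fin; have [k k0 [s e]] := lead_divisible f1F.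
have /finite_seqP[r rE] :=
  finite_image (fun x => coords x 0 (inord 1) / coords x 0 ord0) fin.
have [t] : exists t, (Delta * k * \prod_(a <- r) ('X - a%:P)).[t] != 0.
  by apply: poly_nonroot; rewrite !mulf_neq0 // monic_neq0 // monic_prod_XsubC.
rewrite !hornerM !mulf_eq0 !negb_or => /andP[/andP[Dt kt] rt].
have /closed_rootP[z /rootP fz] : size (fibre f1 t) != 1%N.
  by rewrite size_fibre ?lf1 // neq_ltn orbC; case: f1_irr => ->.
have Fz : (fibre F t).[z] = 0.
  have := congr1 (fun q => (fibre q t).[z]) e.
  rewrite -mul_polyC /fibre !rmorphM /= !hornerM map_polyC hornerC /= ev1_id.
  rewrite -!/(fibre _ t) fz mulr0 => /eqP; rewrite mulf_eq0 (negPf kt).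
  by move/eqP.
have xC : component (apt t z) by exists t, z.
have : [set` r] t.
  rewrite -rE; exists (apt t z) => //.
  have [c c0 ->] := coords_ptE (affine_row_neq0 t z).
  by rewrite !mxE /affine_coord /= inordK //= mulr1 mulrAC divff // mul1r.
by rewrite /= -root_prod_XsubC /root (negPf rt).
Qed.

Lemma component_vanish g : vanish_on component g <-> f1 %| g.
Proof.
split=> [v|/dvdp_lead_coef[N [s e]] t z [t' [z' [Dt _ fz /apt_inj[-> ->]]]]].
  apply: contraT => nd; exfalso; apply: component_infinite.
  apply: (vanish_on_coprime component_sub (irreducible_coprime f1_irr nd)) => //.
  by move=> t z; apply: component_apt.
have := congr1 (fun q => (fibre q t').[z']) e.
rewrite -mul_polyC /fibre !rmorphM /= !hornerM map_polyC hornerC /= ev1_id.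
rewrite -!/(fibre _ t') fz mulr0 => /eqP.
by rewrite horner_exp mulf_eq0 expf_eq0 (negPf (lf1 Dt)) andbF => /eqP.
Qed.

Lemma component_irreducible : zirreducible component.
Proof.
have [x0 cx0] : component !=set0.
  apply: contrapT => h; apply: component_infinite.
  rewrite (_ : component = set0) //; apply/seteqP; split=> // x cx.
  by apply: h; exists x.
split=> [|C1 C2 [S1 hS1 e1] [S2 hS2 e2] cov]; first by exists x0.
have pick C S : (forall p, S p -> exists d, p \is d.-homog) -> C = zlocus S ->
    ~ component `<=` C -> exists d p, [/\ S p, p \is d.-homog & ~~ (f1 %| dehom p)].
  move=> hS eC nC; apply: contrapT => H; apply: nC => x cx; rewrite eC => p Sp.
  have [d hp] := hS _ Sp; apply: ((vanish_on_homog component_sub hp).1 _ x cx).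
  apply/component_vanish; apply: contraT => nd; exfalso; apply: H.
  by exists d, p.
have [|n1] := pselect (component `<=` C1); first by left.
have [|n2] := pselect (component `<=` C2); first by right.
have [d1 [p1 [Sp1 hp1 nd1]]] := pick _ _ hS1 e1 n1.
have [d2 [p2 [Sp2 hp2 nd2]]] := pick _ _ hS2 e2 n2.
have : ~~ (f1 %| dehom p1 * dehom p2).
  by rewrite Gauss_dvdpr // irreducible_coprime.
case/negP; apply/component_vanish; rewrite -rmorphM.
apply/(vanish_on_homog component_sub (dhomogM hp1 hp2)) => x cx.
rewrite /evalp mevalM; have [] := cov _ cx.
  by rewrite e1 => /(_ _ Sp1); rewrite /evalp => ->; rewrite mul0r.
by rewrite e2 => /(_ _ Sp2); rewrite /evalp => ->; rewrite mulr0.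
Qed.

Lemma has_dim_plane_curve : has_dim plane_curve 1.
Proof.
split; last exact: plane_curve_dim_le1.
have [[x0 cx0] _] := component_irreducible.
exists (fun i => if i == 0%N then [set x0] else component); split.
  case=> [|[|//]] _ /=; split.
  - exact: irreducible1.
  - exists [set x0]; first exact: zclosed1.
    by apply/seteqP; split=> [x ->|x []//]; split=> //; apply: component_sub.
  - exact: component_irreducible.
  - have [d [G [hG GE]]] := dehom_surj f1.
    exists [set x | evalp G x = 0]; first exact: zclosed_eq0 hG.
    apply/seteqP; split=> [x [t [z [Dt Fz fz ->]]]|x [[t [z [Dt Fz ->]]] /= Gx]].
      split; first by apply/plane_curve_apt.
      by apply/eqP; rewrite (evalp_apt _ _ hG) GE fz.
    exists t, z; split=> //; apply/eqP.
    by rewrite -GE -(evalp_apt _ _ hG) Gx.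
case=> [|//] _ /=; split=> [x ->//|h].
by apply: component_infinite; apply: sub_finite_set h _; apply: finite_set1.
Qed.

End Component.

End PlaneCurve.

(** * Frobenius maps and locally finite modules *)

Section FrobeniusMap.
Local Open Scope card_scope.
Variables (F : finFieldType) (K : closedFieldType) (iota : {rmorphism F -> K}).
Local Notation q := #|F|.

Definition frob (k : nat) (a : K) : K := a ^+ (q ^ k).

Lemma frob_pnat k : [pchar K].-nat (q ^ k)%N.
Proof.
have [p p_pr pF] := finPcharP F; have pK := rmorph_pchar iota pF.
rewrite (eq_pnat _ (pcharf_eq pK)) pnatX (card_pprimeChar pF) pnatX.
by rewrite pnat_id ?orbT.
Qed.

Lemma frob_is_zmod_morphism k : zmod_morphism (frob k).
Proof.
by move=> a b; rewrite /frob exprDn_pchar ?frob_pnat // exprNn_pchar ?frob_pnat.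
Qed.

Lemma frob_is_monoid_morphism k : monoid_morphism (frob k).
Proof. by split=> [|a b]; rewrite /frob ?expr1n // exprMn. Qed.

HB.instance Definition _ k :=
  GRing.isZmodMorphism.Build K K (frob k) (frob_is_zmod_morphism k).
HB.instance Definition _ k :=
  GRing.isMonoidMorphism.Build K K (frob k) (frob_is_monoid_morphism k).

Lemma card_gt1 : (1 < q)%N. Proof. exact: finNzRing_gt1. Qed.

Lemma frobD i j a : frob (i + j) a = frob i (frob j a).
Proof. by rewrite /frob expnD mulnC exprM. Qed.

Lemma frob_bij k : bijective (frob k).
Proof.
have inj : injective (frob k) by apply: fmorph_inj.
have surj b : exists a, frob k a = b.
  have N0 : (0 < q ^ k)%N by rewrite expn_gt0 (ltn_trans _ card_gt1).
  have /closed_rootP[a] : size ('X^(q ^ k) - b%:P) != 1%N.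
    by rewrite size_XnsubC // eqSS -lt0n.
  by rewrite /root !hornerE subr_eq0 => /eqP; exists a.
have [g gE] := choice surj.
by exists g => // a; apply: inj; rewrite gE.
Qed.

Definition frob_gal k : Defs.gal F K k :=
  @Defs.Gal F K k (frob k : {rmorphism K -> K}) (frob_bij k) (fun a h => h).

Lemma frob_fix_mul k n a : frob k a = a -> frob (k * n) a = a.
Proof.
move=> h; elim: n => [|n IH]; first by rewrite muln0 /frob expn0 expr1.
by rewrite mulnS frobD IH.
Qed.

Definition frob_fixed (k : nat) : set K := [set a | frob k a = a].

Lemma finite_frob_fixed k : (0 < k)%N -> finite_set (frob_fixed k).
Proof.
move=> k0; have N1 : (1 < q ^ k)%N by rewrite -(exp1n k) ltn_exp2r // card_gt1.
have : 'X^(q ^ k) - 'X != 0 :> {poly K}.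
  apply/eqP => /(congr1 (fun p : {poly K} => p`_(q ^ k))).
  rewrite coefB coefXn eqxx coefX (gtn_eqF N1) subr0 coef0 => /eqP.
  by rewrite oner_eq0.
move=> /finite_roots; apply: sub_finite_set => a /= h.
by rewrite !hornerE -/(frob k a) h subrr.
Qed.

Lemma pigeonhole (T : Type) (A : set T) n (u : nat -> T) : A #= `I_n ->
    (forall i, A (u i)) ->
  exists i j, [/\ (i < j)%N, (j <= n)%N & u i = u j].
Proof.
move=> An uA; apply: contrapT => H.
have inj : {in `I_n.+1 &, injective u}.
  move=> i j; rewrite !in_setE /= => ile jle e.
  have [ij|ij|//] := ltngtP i j; exfalso; apply: H.
    by exists i, j; split.
  by exists j, i; split.
have le : (u @` `I_n.+1 #<= A).
  by apply: subset_card_le => _ [i _ <-].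
have := inj_card_eq inj; rewrite card_eq_le => /andP[_ le'].
have /(card_le_trans le')/card_le_trans := le.
move: An; rewrite card_eq_le => /andP[h _] /(_ _ _ h).
by rewrite card_le_II ltnn.
Qed.

Hypothesis algK : forall a : K, algebraicOver iota a.

Lemma frob_iota k (x : F) : frob k (iota x) = iota x.
Proof.
rewrite /frob -rmorphXn; congr (iota _).
elim: k => [|k IH]; first by rewrite expn0 expr1.
by rewrite expnSr exprM IH expf_card.
Qed.

(** The Frobenius powers of an element are roots of one polynomial, so that
    two of them agree. *)
Lemma frob_fixedP (a : K) : exists2 k, (0 < k)%N & frob k a = a.
Proof.
have [p p0 pa] := algK a; pose P := map_poly iota p.
have P0 : P != 0 by rewrite map_poly_eq0.
have /finite_setP[n An] := finite_roots P0.
have [|i [j [ij _ e]]] := pigeonhole (u := fun i => frob i a) An.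
  move=> i /=; have /rootP {}pa := pa.
  have <- : map_poly (frob i) P = P.
    rewrite /P -map_poly_comp; apply: eq_map_poly => x /=.
    exact: frob_iota.
  by rewrite horner_map pa rmorph0.
exists (j - i)%N; first by rewrite subn_gt0.
by apply: (bij_inj (frob_bij i)); rewrite -frobD subnKC // ltnW.
Qed.

Lemma frob_fixed_seq (s : seq K) : exists2 k, (0 < k)%N &
  forall a, a \in s -> frob k a = a.
Proof.
elim: s => [|a s [k k0 h]]; first by exists 1%N.
have [l l0 hl] := frob_fixedP a; exists (k * l)%N; first by rewrite muln_gt0 k0.
move=> b; rewrite in_cons => /orP[/eqP->|/h hb]; last exact: frob_fix_mul.
by rewrite mulnC; apply: frob_fix_mul.
Qed.

(** An orbit of n points is fixed pointwise by a power of the Frobenius map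
    that depends on n only, so the coordinates of its points lie in one finite
    field. *)
Lemma locally_finite_coord k r (M : gmodule F K k) (c : M -> 'rV[K]_r) :
    (0 < k)%N -> injective c ->
    (forall g x, c (Defs.act g x) = map_mx (gal_fun g) (c x)) ->
  locally_finite M.
Proof.
move=> k0 c_inj cE.
have preim (A : set 'rV[K]_r) : finite_set A -> finite_set (c @^-1` A).
  move=> fA; have : finite_set (c @` (c @^-1` A)).
    by apply: sub_finite_set fA => _ [x Ax <-].
  by apply/card_le_finite; have := inj_card_eq (A := c @^-1` A) (in2W c_inj);
    rewrite card_eq_le => /andP[].
have rows_fixed l : (0 < l)%N ->
    finite_set [set x : M | forall j, frob l (c x 0 j) = c x 0 j].
  by move=> l0; apply: (preim _ (finite_rows r (finite_frob_fixed l0))).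
split=> [x|n].
  have [l l0 hl] := frob_fixed_seq (codom (c x 0)).
  apply: sub_finite_set (rows_fixed l l0) => _ [g _ <-] j.
  rewrite cE mxE -[frob l _]rmorphXn /= -[in RHS](hl (c x 0 j)) //.
  by rewrite codom_f.
pose l := (k * n`!)%N; have l0 : (0 < l)%N by rewrite muln_gt0 k0 fact_gt0.
apply: sub_finite_set (finite_image (@gorbit F K k M) (rows_fixed l l0)).
move=> O [[x ->] On]; exists x => // j.
have orbI i : gorbit x (iter i (Defs.act (frob_gal k)) x).
  elim: i => [|i [g _ e]]; first by exists (Defs.gal_one F K k) => //; rewrite act_one.
  by exists (Defs.gal_mul (frob_gal k) g) => //; rewrite act_mul /= e.
have [i1 [i2 [lt12 le2 e]]] := pigeonhole On orbI.
have iterE i : c (iter i (Defs.act (frob_gal k)) x) 0 j = frob (k * i) (c x 0 j).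
  elim: i => [|i IH]; first by rewrite muln0 /frob expn0 expr1.
  by rewrite iterS cE mxE IH mulnS frobD.
have fx : frob (k * (i2 - i1)) (c x 0 j) = c x 0 j.
  apply: (bij_inj (frob_bij (k * i1))).
  by rewrite -frobD -mulnDr subnKC ?(ltnW lt12) // -!iterE e.
have /dvdnP[w we] : (i2 - i1 %| n`!)%N.
  by apply: dvdn_fact; rewrite subn_gt0 lt12 (leq_trans (leq_subr _ _)).
by rewrite /l we [(w * _)%N]mulnC mulnA; apply: frob_fix_mul.
Qed.

End FrobeniusMap.

(** * Quotient modules and the action on coordinates *)

(** The fibres of pi are the orbits of H, so pi factors through a bijection
    from the orbit space. *)
Lemma orbit_space_identification (F : finFieldType) (K : closedFieldType) s
    (N L : gmodule F K s) (H : set (N -> N)) (HZ : H `<=` @Defs.centralizer F K s N)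
    (pi : N -> L) :
    sym_subgroup H -> equivariant pi -> (forall y, exists x, pi x = y) ->
    (forall x y, pi x = pi y <-> exists2 h, H h & h x = y) ->
  exists b : orbit_gmodule HZ -> L, [/\ bijective b, equivariant b &
    forall z, b (orbit_map H z) = pi z].
Proof.
move=> [Hbij Hid Hcomp Hinv] piE pi_surj piP.
have orbP x y : pi x = pi y -> orb H x = orb H y.
  suff sub x' y' : pi x' = pi y' -> orb H y' `<=` orb H x'.
    by move=> e; apply/seteqP; split; apply: sub.
  move=> /piP[h Hh <-] _ [h' Hh' <-]; exists (h' \o h) => //.
  exact: Hcomp.
pose rep (O : orbit_space H) : N := sval (cid (svalP O)).
have repE O : sval O = orb H (rep O) by rewrite /rep; case: cid.
pose b (O : orbit_gmodule HZ) : L := pi (rep O).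
have bE z : b (orbit_map H z) = pi z.
  apply/esym/piP; have := repE (orbit_map H z); rewrite /= => e.
  have : orb H z (rep (orbit_map H z)) by rewrite e; exists id.
  by case=> h Hh <-; exists h.
have orbit_ext (O O' : orbit_space H) : sval O = sval O' -> O = O'.
  by case: O O' => [O hO] [O' hO'] /= e; apply: eq_exist.
exists b; split=> //; last first.
  move=> g O; have -> : O = orbit_map H (rep O) by apply: orbit_ext; rewrite repE.
  have -> : Defs.act g (orbit_map H (rep O) : orbit_gmodule HZ) =
      orbit_map H (Defs.act g (rep O)).
    by apply: orbit_ext; rewrite /= act_orb.
  by rewrite !bE piE.
have [c cE] := choice pi_surj.
exists (fun y => orbit_map H (c y)) => [O|y]; last by rewrite bE cE.
by apply: orbit_ext => /=; rewrite repE; apply: orbP; rewrite cE.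
Qed.

(** The coordinates are those of a Galois equivariant parametrization. *)
Lemma locally_finite_param (F : finFieldType) (K : closedFieldType)
    (iota : {rmorphism F -> K}) (algK : forall a : K, algebraicOver iota a)
    n r s (A : set (proj K n)) (sA : gal_stable F s A)
    (P : set 'rV[K]_r) (phi : 'rV[K]_r -> proj K n) :
    (0 < s)%N -> (forall x, A x -> exists2 v, P v & x = phi v) ->
    (forall v v', P v -> P v' -> phi v = phi v' -> v = v') ->
    (forall (g : Defs.gal F K s) v, P v ->
       P (map_mx g v) /\ phi (map_mx g v) = proj_act g (phi v)) ->
  locally_finite (proj_gmodule sA).
Proof.
move=> s0 param phi_inj phiE.
have paramx (x : proj_gmodule sA) : exists v, P v /\ sval x = phi v.
  by have [v Pv e] := param _ (svalP x); exists v.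
have [c cP] := choice paramx.
apply: (locally_finite_coord algK s0 (c := c)) => [x y e|g x].
  apply: eq_sig_hprop => [z|]; first exact: Prop_irrelevance.
  by rewrite /= (cP x).2 e -(cP y).2.
have [Pg phig] := phiE g _ (cP x).1.
by apply: phi_inj => //; [exact: (cP _).1|rewrite phig -(cP x).2 -(cP _).2].
Qed.

Section GaloisAction.
Variables (F : finFieldType) (K : closedFieldType).

Lemma proj_act_pt n k (g : Defs.gal F K k) (v : 'rV[K]_n.+1) : v != 0 ->
  proj_act g (pt v) = pt (map_mx (gal_fun g) v).
Proof.
move=> v0; have [c c0 cE] := coords_ptE v0; rewrite /proj_act cE.
apply: pt_eq_cross; rewrite ?map_mx_eq0 //.
  by rewrite scaler_eq0 negb_or c0.
by move=> i j; rewrite !mxE !rmorphM; ring.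
Qed.

Lemma fibre_fixed (gam : {rmorphism K -> K}) (g : {poly {poly K}}) t :
    (forall p, p \in polyseq g -> forall a, a \in polyseq p -> gam a = a) ->
  map_poly gam (fibre g t) = fibre g (gam t).
Proof.
move=> fixg; apply/polyP => i; rewrite coef_map !coef_fibre /=.
have [ilt|ile] := ltnP i (size g); last by rewrite nth_default // !horner0 raddf0.
rewrite -horner_map; congr (_.[_]); apply/polyP => j; rewrite coef_map /=.
have [jlt|jle] := ltnP j (size g`_i); last by rewrite nth_default // raddf0.
by apply: (fixg _ (mem_nth 0 ilt)); apply: mem_nth.
Qed.

Definition coefs (g : {poly {poly K}}) : seq K :=
  flatten [seq polyseq p | p : {poly K} <- polyseq g].

Lemma coefsP (gam : K -> K) (g : {poly {poly K}}) :
    (forall a, a \in coefs g -> gam a = a) ->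
  forall p, p \in polyseq g -> forall a, a \in polyseq p -> gam a = a.
Proof.
by move=> h p pg a ap; apply: h; apply/flatten_mapP; exists p.
Qed.

(** Every element is a difference of two elements outside a finite set. *)
Lemma cofinite_fixed (gam : {rmorphism K -> K}) (D : {poly K}) : D != 0 ->
  (forall t, D.[t] != 0 -> gam t = t) -> forall a, gam a = a.
Proof.
move=> D0 fixD a.
have [t] : exists t, (D * (D \Po ('X + a%:P))).[t] != 0.
  apply: poly_nonroot; rewrite mulf_neq0 // -lead_coef_eq0.
  by rewrite lead_coef_comp ?size_XaddC // lead_coefXaddC expr1n mulr1 lead_coef_eq0.
rewrite hornerM horner_comp !hornerE mulf_eq0 negb_or => /andP[/fixD ft /fixD].
by rewrite rmorphD ft => /addrI.
Qed.

End GaloisAction.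

Lemma perm_of_roots (K : eqType) d (w w' : 'I_d -> K) :
    injective w -> injective w' -> (forall i, exists j, w' i = w j) ->
  exists s : 'S_d, forall i, w' i = w (s i).
Proof.
move=> w_inj w'_inj h; have [f fE] := choice h.
have f_inj : injective f by move=> i j e; apply: w'_inj; rewrite !fE e.
by exists (perm f_inj) => i; rewrite permE.
Qed.

(** * Orderings of the fibres *)

Section Enumerations.
Variables (K : closedFieldType) (d : nat) (f F : {poly {poly K}}).
Variables (Delta : {poly K}) (c : K).
Local Notation lc t := ((lead_coef f).[t]).

(** Stated as a factorization, this property is visibly stable under
    permutations of the roots and under automorphisms; the injectivity of w
    follows from the resolvent [enumerates_inj]. *)
Definition enumerates (t : K) (w : 'I_d.+1 -> K) :=
  fibre f t = lc t *: \prod_(i < d.+1) ('X - (w i)%:P).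

Definition ordering_value t w s : K :=
  resolvent_value c (fun i : 'I_d.+1 => lc t * w i) s.

Hypothesis lc_neq0 : forall t, Delta.[t] != 0 -> lc t != 0.
Hypothesis resolventP : forall t w, Delta.[t] != 0 -> enumerates t w ->
  fibre F t = \prod_(s : 'S_d.+1) ('X - (ordering_value t w s)%:P) /\
  injective (ordering_value t w).
Hypothesis enumeration : forall t, Delta.[t] != 0 ->
  exists w, enumerates t w.

Lemma enumerates_root t w u : Delta.[t] != 0 -> enumerates t w ->
  (fibre f t).[u] = 0 <-> exists i, u = w i.
Proof.
move=> Dt we; rewrite -[_ = 0]/(_) we hornerZ.
split=> [/eqP|[i ->]]; last first.
  by rewrite (bigD1 i) //= hornerM hornerXsubC subrr mul0r mulr0.
rewrite mulf_eq0 (negPf (lc_neq0 Dt)) horner_prod prodf_seq_eq0 /= => /hasP[i _].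
by rewrite hornerXsubC subr_eq0 => /eqP; exists i.
Qed.

Lemma ordering_value_perm t w (s s' : 'S_d.+1) :
  ordering_value t (w \o s) s' = ordering_value t w (s' * s)%g.
Proof. by apply: eq_bigr => i _; rewrite /= permM. Qed.

Lemma enumerates_perm t w (s : 'S_d.+1) :
  enumerates t w -> enumerates t (w \o s).
Proof.
by rewrite /enumerates => ->; congr (_ *: _); rewrite (reindex_inj (@perm_inj _ s)).
Qed.

Lemma enumerates_inj t w : Delta.[t] != 0 -> enumerates t w -> injective w.
Proof.
move=> Dt we i j wij; have [_ inj] := resolventP Dt we.
have : tperm i j = 1%g.
  apply: inj; rewrite -[tperm i j]mul1g -ordering_value_perm.
  apply: eq_bigr => k _ /=; congr (_ * (_ * _)).
  by case: tpermP => [->|->|//].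
by move=> /permP/(_ i); rewrite tpermL perm1.
Qed.

Lemma enumerates_unique t w w' : Delta.[t] != 0 ->
  enumerates t w -> enumerates t w' -> exists s : 'S_d.+1, w' = w \o s.
Proof.
move=> Dt we we'; have [|s sE] := perm_of_roots (enumerates_inj Dt we)
    (enumerates_inj Dt we').
  by move=> i; apply/(enumerates_root _ Dt we)/(enumerates_root _ Dt we'); exists i.
by exists s; apply/funext.
Qed.

Lemma ordering_value_inj t w w' : Delta.[t] != 0 ->
    enumerates t w -> enumerates t w' ->
  ordering_value t w 1 = ordering_value t w' 1 -> w = w'.
Proof.
move=> Dt we we'; have [s ->] := enumerates_unique Dt we we'.
rewrite ordering_value_perm mul1g => /(resolventP Dt we).2 <-.
by apply/funext => i /=; rewrite perm1.
Qed.

Lemma resolvent_root t w z : Delta.[t] != 0 -> enumerates t w ->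
  (fibre F t).[z] = 0 <-> exists s, z = ordering_value t w s.
Proof.
move=> Dt we; rewrite (resolventP Dt we).1; split=> [/eqP|[s ->]]; last first.
  by rewrite (bigD1 s) //= hornerM hornerXsubC subrr mul0r.
rewrite horner_prod prodf_seq_eq0 /= => /hasP[s _].
by rewrite hornerXsubC subr_eq0 => /eqP; exists s.
Qed.

Lemma resolvent_separable t z : Delta.[t] != 0 -> (fibre F t).[z] = 0 ->
  (fibre F^`() t).[z] != 0.
Proof.
move=> Dt /rootP Fz; have [w we] := enumeration Dt.
have [FE inj] := resolventP Dt we.
have : separable_poly (fibre F t).
  rewrite FE -big_enum -(big_map (ordering_value t w) xpredT (fun a => 'X - a%:P)).
  by rewrite separable_prod_XsubC map_inj_uniq // enum_uniq.
rewrite unlock => /Pdiv.ClosedField.coprimepP/(_ _ Fz).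
by rewrite fibre_deriv.
Qed.

Lemma plane_curve_enumeration x : plane_curve F Delta x <-> exists t w,
  [/\ Delta.[t] != 0, enumerates t w & x = apt t (ordering_value t w 1)].
Proof.
split=> [[t [z [Dt Fz ->]]]|[t [w [Dt we ->]]]].
  have [w we] := enumeration Dt; have [s ->] := (resolvent_root z Dt we).1 Fz.
  exists t, (w \o s); split=> //; first exact: enumerates_perm.
  by rewrite ordering_value_perm mul1g.
exists t, (ordering_value t w 1); split=> //.
by apply/(resolvent_root _ Dt we); exists 1%g.
Qed.

End Enumerations.

(** * The model of the covering *)

Definition line_row (K : closedFieldType) (t : K) : 'rV[K]_2 :=
  \row_(i < 2) (if i == 0 then 1 else t).

Definition line_pt (K : closedFieldType) (t : K) : proj K 1 := pt (line_row t).

Lemma line_pt_inj (K : closedFieldType) (t t' : K) :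
  line_pt t = line_pt t' -> t = t'.
Proof.
move=> e; pose p : {mpoly K[2]} := 'X_1 - t *: 'X_0.
have hp : p \is 1.-homog by rewrite rpredB ?dhomogZ ?dhomogXU.
have v0 := basept_neq0 t; have v0' := basept_neq0 t'.
have := evalp_pt_eq0 v0 hp; rewrite -/(line_row t) -/(line_pt t) e.
rewrite (evalp_pt_eq0 v0' hp) !mevalB !mevalZ !mevalXU !mxE /= !mulr1 subrr eqxx.
by rewrite subr_eq0 => /eqP.
Qed.

Definition curve_row (K : closedFieldType) n (hh : 'I_n.+1 -> {poly {poly K}})
  (t u : K) : 'rV[K]_n.+1 := \row_j (fibre (hh j) t).[u].

(** The birational model on which the covering is studied: X is parametrized
    by the points (t, u) of the plane curve cm_poly = 0, xi is the projection
    to t, and the orderings of the fibres are the points of the resolvent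
    curve cm_res = 0. The roots of cm_bad are the values of t to be avoided. *)
Record covering_model (K : closedFieldType) n (X : set (proj K n))
    (xi : proj K n -> proj K 1) := CoveringModel {
  cm_deg : nat;
  cm_poly : {poly {poly K}};
  cm_res : {poly {poly K}};
  cm_factor : {poly {poly K}};
  cm_bad : {poly K};
  cm_scalar : K;
  cm_coord : 'I_n.+1 -> {poly {poly K}};
  cm_bad_neq0 : cm_bad != 0;
  cm_lead : forall t, cm_bad.[t] != 0 -> (lead_coef cm_poly).[t] != 0;
  cm_lead_res : forall t, cm_bad.[t] != 0 -> (lead_coef cm_res).[t] != 0;
  cm_lead_factor : forall t, cm_bad.[t] != 0 -> (lead_coef cm_factor).[t] != 0;
  cm_irr : irreducible_poly cm_factor;
  cm_dvd : cm_factor %| cm_res;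
  cm_enum : forall t, cm_bad.[t] != 0 ->
    exists w : 'I_cm_deg.+1 -> K, enumerates cm_poly t w;
  cm_resolvent : forall t (w : 'I_cm_deg.+1 -> K), cm_bad.[t] != 0 ->
    enumerates cm_poly t w ->
    fibre cm_res t = \prod_(s : 'S_cm_deg.+1)
      ('X - (ordering_value cm_poly cm_scalar t w s)%:P) /\
    injective (ordering_value cm_poly cm_scalar t w);
  cm_point : forall t u, cm_bad.[t] != 0 -> (fibre cm_poly t).[u] = 0 ->
    [/\ curve_row cm_coord t u != 0, X (pt (curve_row cm_coord t u)) &
        xi (pt (curve_row cm_coord t u)) = line_pt t];
  cm_inj : forall t u v, cm_bad.[t] != 0 -> (fibre cm_poly t).[u] = 0 ->
    (fibre cm_poly t).[v] = 0 ->
    pt (curve_row cm_coord t u) = pt (curve_row cm_coord t v) -> u = v;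
  cm_cofinite : finite_set (X `\` [set pt (curve_row cm_coord p.1 p.2) |
    p in [set p | cm_bad.[p.1] != 0 /\ (fibre cm_poly p.1).[p.2] = 0]])
}.

(** To the bad values of t of [plane_model] those are added where two
    orderings have the same value of the linear form, or where the leading
    coefficients of the resolvent or of its irreducible factor vanish. *)
Lemma covering_model_exists (K : closedFieldType) n (X : set (proj K n))
    (xi : proj K n -> proj K 1) (gp : generic_point X xi) :
  zirreducible X -> zclosed X -> inhabited (covering_model X xi).
Proof.
move=> irrX closedX.
have [f [D [hh [[sf D0] lD pointD injD finD]]]] := plane_model gp irrX closedX.
have [d sd] : exists d, size f = d.+2.
  by case: (size f) sf => [|[|d]] // _; exists d.
have enumD t : D.[t] != 0 -> exists2 w : 'I_d.+1 -> K, injective w &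
    enumerates f t w.
  move=> Dt; apply: (fibre_roots sd (lD _ Dt)) => u fu.
  by have [] := pointD _ _ Dt fu.
have [t0 Dt0] := poly_nonroot D0.
have [w0 w0_inj w0E] := enumD _ Dt0.
have [c [F [delta [delta0 resE]]]] := resolvent sd (lD _ Dt0) w0_inj w0E.
have sF : (1 < size F)%N.
  apply: leq_trans (size_poly _ _ : size (fibre F t0) <= size F)%N.
  rewrite (resE _ _ w0E).1 -big_enum -(big_map _ xpredT (fun a => 'X - a%:P)) /=.
  rewrite size_prod_XsubC size_map -cardE ltnS.
  by apply/card_gt0P; exists 1%g.
have [f1 f1_irr f1F] := irreducible_factor sF.
have F0 : F != 0 by rewrite -size_poly_gt0 ltnW.
have f10 : f1 != 0 by apply: contraNneq F0 => f10; rewrite f10 dvd0p in f1F.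
pose B := D * delta * lead_coef F * lead_coef f1.
have BP t : B.[t] != 0 -> [/\ D.[t] != 0, delta.[t] != 0,
    (lead_coef F).[t] != 0 & (lead_coef f1).[t] != 0].
  by rewrite !hornerM !mulf_eq0 !negb_or -!andbA => /and4P[].
unshelve refine (inhabits (@CoveringModel K n X xi d f F f1 B c hh
  _ _ _ _ _ _ _ _ _ _ _)) => //.
- by rewrite !mulf_neq0 // lead_coef_eq0.
- by move=> t /BP[/lD].
- by move=> t /BP[].
- by move=> t /BP[].
- by move=> t /BP[/enumD[w _ wE] _ _ _]; exists w.
- move=> t w /BP[_ dt _ _] /resE[FE inj]; split=> //; exact: inj.
- by move=> t u /BP[Dt _ _ _] fu; have [] := pointD _ _ Dt fu.
- move=> t u v /BP[Dt _ _ _]; exact: injD.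
pose bad := \bigcup_(t in [set t | B.[t] = 0 /\ D.[t] != 0])
  ((fun u => pt (curve_row hh t u)) @` [set u | (fibre f t).[u] = 0]).
have B0 : B != 0 by rewrite !mulf_neq0 // lead_coef_eq0.
have bad_fin : finite_set bad.
  apply: bigcup_finite => [|t [_ Dt]].
    by apply: sub_finite_set (finite_roots B0) => t [].
  apply/finite_image/finite_roots.
  by rewrite -size_poly_gt0 size_fibre ?lD // sd.
have : finite_set ((X `\` [set pt (curve_row hh p.1 p.2) |
    p in [set p | D.[p.1] != 0 /\ (fibre f p.1).[p.2] = 0]]) `|` bad).
  by rewrite finite_setU; split.
apply: sub_finite_set => x [Xx nx].
have [[[t u] /= [Dt fu] e]|nx'] := pselect ([set pt (curve_row hh p.1 p.2) |
    p in [set p | D.[p.1] != 0 /\ (fibre f p.1).[p.2] = 0]] x); last by left.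
right; exists t; last by exists u.
split=> //; apply/eqP; apply: contraT => Bt; case: nx.
by exists (t, u).
Qed.

(** * The Galois closure *)

Section Covering.
Local Open Scope card_scope.
Variables (F : finFieldType) (K : closedFieldType) (iota : {rmorphism F -> K}).
Hypothesis algK : forall a : K, algebraicOver iota a.
Variables (n : nat) (X : set (proj K n)) (xi : proj K n -> proj K 1).
Variable cm : covering_model X xi.
Local Notation d := (cm_deg cm).
Local Notation f := (cm_poly cm).
Local Notation R := (cm_res cm).
Local Notation Delta := (cm_bad cm).
Local Notation c := (cm_scalar cm).
Local Notation hh := (cm_coord cm).
Local Notation enumF := (@enumerates K d f).
Local Notation val1 t w := (ordering_value f c t w (1%g : 'S_d.+1)).

Definition cm_constants : seq K :=
  c :: coefs f ++ coefs Delta%:P ++ flatten [seq coefs (hh j) | j <- enum 'I_n.+1].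

Variable s : nat.
Hypothesis s_gt0 : (0 < s)%N.
Hypothesis gal_fix : forall (g : Defs.gal F K s) a, a \in cm_constants -> g a = a.

Let enum_root := @enumerates_root K d f Delta (@cm_lead _ _ _ _ cm).
Let enum_uniq := enumerates_unique (@cm_lead _ _ _ _ cm) (@cm_resolvent _ _ _ _ cm).
Let enum_inj := enumerates_inj (@cm_resolvent _ _ _ _ cm).
Let val1_inj := ordering_value_inj (@cm_lead _ _ _ _ cm) (@cm_resolvent _ _ _ _ cm).
Let curveP := plane_curve_enumeration (@cm_resolvent _ _ _ _ cm) (@cm_enum _ _ _ _ cm).

Lemma gal_fibre (g : Defs.gal F K s) t : map_poly g (fibre f t) = fibre f (g t).
Proof.
apply: fibre_fixed; apply: coefsP => a af; apply: gal_fix.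
by rewrite in_cons mem_cat af orbT.
Qed.

Lemma gal_coord (g : Defs.gal F K s) j t :
  map_poly g (fibre (hh j) t) = fibre (hh j) (g t).
Proof.
apply: fibre_fixed; apply: coefsP => a af; apply: gal_fix.
rewrite in_cons !mem_cat; apply/orP; right; apply/orP; right.
apply/orP; right; apply/flatten_mapP; exists j => //.
by rewrite mem_enum.
Qed.

Lemma gal_bad (g : Defs.gal F K s) t : (Delta.[g t] != 0) = (Delta.[t] != 0).
Proof.
have : map_poly g (fibre Delta%:P t) = fibre Delta%:P (g t).
  apply: fibre_fixed; apply: coefsP => a af; apply: gal_fix.
  by rewrite in_cons !mem_cat af /= !orbT.
move=> /(congr1 (fun p : {poly K} => p`_0)); rewrite coef_map !coef_fibre !coefC /=.
by move=> <-; rewrite fmorph_eq0.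
Qed.

Lemma gal_lead (g : Defs.gal F K s) t :
  g (lead_coef f).[t] = (lead_coef f).[g t].
Proof. by rewrite lead_coefE -!coef_fibre -gal_fibre [RHS]coef_map. Qed.

Lemma gal_enum (g : Defs.gal F K s) t w : enumF t w -> enumF (g t) (g \o w).
Proof.
rewrite /enumerates -gal_fibre => ->; rewrite map_polyZ gal_lead; congr (_ *: _).
rewrite rmorph_prod; apply: eq_bigr => i _.
by rewrite rmorphB /= map_polyX map_polyC.
Qed.

Lemma gal_val1 (g : Defs.gal F K s) t (w : 'I_d.+1 -> K) :
  val1 (g t) (g \o w) = g (val1 t w).
Proof.
have gc : g c = c by apply: gal_fix; rewrite in_cons eqxx.
rewrite /ordering_value /resolvent_value rmorph_sum; apply: eq_bigr => i _ /=.
by rewrite !rmorphM rmorphXn /= gal_lead gc.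
Qed.

Lemma gal_root (g : Defs.gal F K s) t u :
  (fibre f t).[u] = 0 -> (fibre f (g t)).[g u] = 0.
Proof. by move=> fu; rewrite -gal_fibre horner_map /= fu rmorph0. Qed.

Lemma gal_curve_row (g : Defs.gal F K s) t u :
  map_mx g (curve_row hh t u) = curve_row hh (g t) (g u).
Proof.
by apply/rowP => j; rewrite !mxE -gal_coord horner_map.
Qed.

Definition good_line : set (proj K 1) :=
  [set y | exists2 t, Delta.[t] != 0 & y = line_pt t].

Definition good_curve : set (proj K n) :=
  [set x | exists t u, [/\ Delta.[t] != 0, (fibre f t).[u] = 0 &
                           x = pt (curve_row hh t u)]].

Definition galois_curve : set (proj K 2) := plane_curve R Delta.

Lemma gal_line_pt (g : Defs.gal F K s) t : proj_act g (line_pt t) = line_pt (g t).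
Proof.
rewrite /line_pt proj_act_pt; last exact: basept_neq0.
congr pt; apply/rowP => i; rewrite !mxE.
by case: eqP => _ //; rewrite rmorph1.
Qed.

Lemma gal_apt (g : Defs.gal F K s) t z : proj_act g (apt t z) = apt (g t) (g z).
Proof.
rewrite /apt proj_act_pt; last exact: affine_row_neq0.
congr pt; apply/rowP => i; rewrite !mxE /affine_coord.
by case: i => [[|[|[|//]]] ?] //=; rewrite rmorph1.
Qed.

Lemma gal_curve_pt (g : Defs.gal F K s) t u : Delta.[t] != 0 ->
    (fibre f t).[u] = 0 ->
  proj_act g (pt (curve_row hh t u)) = pt (curve_row hh (g t) (g u)).
Proof.
move=> Dt fu; rewrite proj_act_pt ?gal_curve_row //.
by have [] := cm_point Dt fu.
Qed.

Lemma good_line_stable : gal_stable F s good_line.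
Proof.
by move=> g _ [t Dt ->]; exists (g t); rewrite ?gal_bad ?gal_line_pt.
Qed.

Lemma good_curve_stable : gal_stable F s good_curve.
Proof.
move=> g _ [t [u [Dt fu ->]]]; exists (g t), (g u).
by rewrite gal_bad gal_curve_pt //; split=> //; apply: gal_root.
Qed.

Lemma galois_curve_stable : gal_stable F s galois_curve.
Proof.
move=> g _ /curveP[t [w [Dt we ->]]]; apply/curveP.
exists (g t), (g \o w); rewrite gal_bad gal_apt gal_val1; split=> //.
exact: gal_enum.
Qed.

Lemma xi_good x : good_curve x -> good_line (xi x).
Proof.
by move=> [t [u [Dt fu ->]]]; have [_ _ ->] := cm_point Dt fu; exists t.
Qed.

Let M := proj_gmodule good_curve_stable.
Let L := proj_gmodule good_line_stable.
Let N := proj_gmodule galois_curve_stable.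
Let xio : M -> L := restr xi_good.

Lemma good_line_finite : locally_finite L.
Proof.
apply: (@locally_finite_param F K iota algK _ _ _ _ good_line_stable
  ([set v : 'rV_1 | Delta.[v 0 0] != 0])
  (fun v => line_pt (v 0 0))) => //.
- by move=> _ [t Dt ->]; exists (\row_j t); rewrite /= mxE.
- by move=> v v' _ _ /line_pt_inj e; apply/rowP => j; rewrite !ord1 e.
- by move=> g v Dv; rewrite /= mxE gal_bad gal_line_pt.
Qed.

Lemma curve_pt_inj t u t' u' : Delta.[t] != 0 -> (fibre f t).[u] = 0 ->
    Delta.[t'] != 0 -> (fibre f t').[u'] = 0 ->
  pt (curve_row hh t u) = pt (curve_row hh t' u') -> t = t' /\ u = u'.
Proof.
move=> Dt fu Dt' fu' e; have [_ _ e1] := cm_point Dt fu.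
have [_ _ e2] := cm_point Dt' fu'; rewrite -e e1 in e2.
have tt' := line_pt_inj e2; rewrite -tt' in fu' e *; split=> //.
exact: cm_inj Dt fu fu' e.
Qed.

Lemma rV2P (v v' : 'rV[K]_2) : v 0 0 = v' 0 0 -> v 0 1 = v' 0 1 -> v = v'.
Proof.
move=> e0 e1; apply/rowP => j; case: j => [[|[|//]] lt].
  by rewrite (_ : Ordinal lt = 0) //; apply: val_inj.
by rewrite (_ : Ordinal lt = 1) //; apply: val_inj.
Qed.

Lemma good_curve_finite : locally_finite M.
Proof.
apply: (@locally_finite_param F K iota algK _ _ _ _ good_curve_stable
  ([set v : 'rV_2 | Delta.[v 0 0] != 0 /\ (fibre f (v 0 0)).[v 0 1] = 0])
  (fun v => pt (curve_row hh (v 0 0) (v 0 1)))) => //.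
- move=> _ [t [u [Dt fu ->]]]; exists (\row_j (if j == 0 then t else u)).
    by rewrite /= !mxE.
  by rewrite !mxE.
- by move=> v v' [Dv fv] [Dv' fv'] /(curve_pt_inj Dv fv Dv' fv')[]; apply: rV2P.
- move=> g v [Dv fv]; rewrite /= !mxE gal_bad gal_curve_pt //; split=> //.
  by split=> //; apply: gal_root.
Qed.

Lemma galois_curve_finite : locally_finite N.
Proof.
apply: (@locally_finite_param F K iota algK _ _ _ _ galois_curve_stable
  ([set v : 'rV_2 | galois_curve (apt (v 0 0) (v 0 1))])
  (fun v => apt (v 0 0) (v 0 1))) => //.
- move=> x Zx; have [t [z [_ _ e]]] := Zx; exists (\row_j (if j == 0 then t else z)).
    by rewrite /= !mxE /= -e.
  by rewrite !mxE.
- by move=> v v' _ _ /apt_inj[]; apply: rV2P.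
- move=> g v Zv; rewrite /= !mxE gal_apt; split=> //.
  by have := galois_curve_stable g Zv; rewrite gal_apt.
Qed.

Lemma finite_covering_xi : finite_covering d.+1 xio.
Proof.
split; [exact: good_curve_finite|exact: good_line_finite| | |].
- move=> g [x [t [u [Dt fu e]]]]; apply: eq_exist => /=; subst x.
  rewrite gal_curve_pt //; have [_ _ ->] := cm_point Dt fu.
  rewrite gal_line_pt; have [] // := @cm_point _ _ _ _ cm (g t) (g u).
    by rewrite gal_bad.
  exact: gal_root.
- move=> [y [t Dt e]]; have [w we] := cm_enum Dt.
  have fw : (fibre f t).[w ord0] = 0 by apply/(enum_root _ Dt we); exists ord0.
  have xg : good_curve (pt (curve_row hh t (w ord0))) by exists t, (w ord0).
  exists (exist _ _ xg); apply: eq_exist; rewrite e /=.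
  by have [] := cm_point Dt fw.
exists set0; split=> //; move=> [y [t Dt e]] _; have [w we] := cm_enum Dt.
have fw i : (fibre f t).[w i] = 0 by apply/(enum_root _ Dt we); exists i.
have xg i : good_curve (pt (curve_row hh t (w i))) by exists t, (w i).
pose p (i : 'I_d.+1) : M := exist _ _ (xg i).
have p_inj : injective p.
  move=> i j /(congr1 sval) /= /(curve_pt_inj Dt (fw i) Dt (fw j))[_].
  exact: (enum_inj Dt we).
have -> : xio @^-1` [set exist _ y (ex_intro2 _ _ t Dt e)] = p @` [set: 'I_d.+1].
  apply/seteqP; split=> [[x xgood] /= /(congr1 sval) /=|_ [i _ <-]].
    move=> xy; have [t' [u [Dt' fu ex]]] := xgood.
    have tt : t' = t.
      by apply: line_pt_inj; rewrite -e -xy ex; have [_ _ ->] := cm_point Dt' fu.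
    rewrite tt in fu ex; have [i ui] := (enum_root u Dt we).1 fu.
    by exists i => //; apply: eq_exist; rewrite ex ui.
  by apply: eq_exist => /=; rewrite e; have [] := cm_point Dt (fw i).
have := inj_card_eq (A := [set: 'I_d.+1]) (in2W p_inj).
by move=> /card_eq_trans; apply; apply/card_esym/card_II.
Qed.

Lemma base_enumeration (x : N) : exists p : K * ('I_d.+1 -> K),
  [/\ Delta.[p.1] != 0, enumF p.1 p.2 & sval x = apt p.1 (val1 p.1 p.2)].
Proof. by have /curveP[t [w ?]] := svalP x; exists (t, w). Qed.

Let tw (x : N) : K * ('I_d.+1 -> K) := sval (cid (base_enumeration x)).

Let twP x : [/\ Delta.[(tw x).1] != 0, enumF (tw x).1 (tw x).2 &
  sval x = apt (tw x).1 (val1 (tw x).1 (tw x).2)].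
Proof. by rewrite /tw; case: cid. Qed.

Lemma tw_unique (x : N) t w : Delta.[t] != 0 -> enumF t w ->
  sval x = apt t (val1 t w) -> tw x = (t, w).
Proof.
move=> Dt we e; have [Dx wx] := twP x; rewrite e => /apt_inj[tE].
case: (tw x) tE Dx wx => t' w' /= <- Dx wx /(val1_inj Dt we wx) ->.
by [].
Qed.

Lemma tw_inj (x y : N) : tw x = tw y -> x = y.
Proof.
move=> e; have [_ _ ex] := twP x; have [_ _ ey] := twP y.
by apply: eq_sig_hprop => [z|]; [exact: Prop_irrelevance|rewrite ex ey e].
Qed.

Lemma ordered_point_on_curve t w : Delta.[t] != 0 -> enumF t w ->
  galois_curve (apt t (val1 t w)).
Proof. by move=> Dt we; apply/curveP; exists t, w. Qed.

Definition ordered_point t w (Dt : Delta.[t] != 0) (we : enumF t w) : N :=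
  exist _ _ (ordered_point_on_curve Dt we).

Lemma tw_ordered_point t w (Dt : Delta.[t] != 0) (we : enumF t w) :
  tw (ordered_point Dt we) = (t, w).
Proof. exact: tw_unique. Qed.

Lemma tw_act g x : tw (Defs.act g x) = (g (tw x).1, g \o (tw x).2).
Proof.
have [Dx wx ex] := twP x; apply: tw_unique; rewrite ?gal_bad //.
  exact: gal_enum.
by rewrite /= ex gal_apt gal_val1.
Qed.

(** The symmetric group acts through orderings, as permutations of the points
    that commute with the Galois group. *)
Definition reorder (p : 'S_d.+1) (x : N) : N :=
  let: And3 Dx wx _ := twP x in ordered_point Dx (enumerates_perm p wx).

Lemma tw_reorder p x : tw (reorder p x) = ((tw x).1, (tw x).2 \o p).
Proof. by rewrite /reorder; case: (twP x) => Dx wx _; apply: tw_ordered_point. Qed.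

Lemma reorderM p r x : reorder p (reorder r x) = reorder (p * r)%g x.
Proof.
apply: tw_inj; rewrite !tw_reorder /=; congr (_, _).
by apply/funext => i; rewrite /= permM.
Qed.

Lemma reorder1 x : reorder 1%g x = x.
Proof.
apply: tw_inj; rewrite tw_reorder; case: (tw x) => t w /=; congr (_, _).
by apply/funext => i; rewrite /= perm1.
Qed.

Lemma reorderK p : cancel (reorder p) (reorder p^-1%g).
Proof. by move=> x; rewrite reorderM mulVg reorder1. Qed.

Lemma reorder_act p g x : reorder p (Defs.act g x) = Defs.act g (reorder p x).
Proof. by apply: tw_inj; rewrite tw_act !tw_reorder tw_act. Qed.

Lemma reorder_fixed p x : reorder p x = x -> p = 1%g.
Proof.
move=> /(congr1 tw); rewrite tw_reorder => /(congr1 snd) /= e.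
have [Dx wx _] := twP x; apply/permP => i; rewrite perm1.
by apply: (enum_inj Dx wx); rewrite -[in RHS]e.
Qed.

Lemma reorder_transitive x y : (tw x).1 = (tw y).1 -> exists p, reorder p x = y.
Proof.
move=> e; have [Dx wx _] := twP x; have [_ wy _] := twP y; rewrite -e in wy.
have [p pE] := enum_uniq Dx wx wy; exists p.
by apply: tw_inj; rewrite tw_reorder -pE e; case: (tw y).
Qed.

Definition reorderings (G : {group 'S_d.+1}) : set (N -> N) :=
  [set h | exists2 p, p \in G & h = reorder p].

Lemma reorderings_centralize G : reorderings G `<=` @Defs.centralizer F K s N.
Proof.
move=> _ [p _ ->]; split=> [|g x]; last exact: reorder_act.
exists (reorder p^-1%g); first exact: reorderK.
by move=> x; rewrite -{1}[p]invgK reorderK.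
Qed.

Lemma reorderings_group G : sym_subgroup (reorderings G).
Proof.
split.
- by move=> h /reorderings_centralize[].
- by exists 1%g => //; apply/funext => x; rewrite reorder1.
- move=> _ _ [p pG ->] [r rG ->]; exists (p * r)%g; first exact: groupM.
  by apply/funext => x; rewrite /= reorderM.
- move=> _ h' [p pG ->] _ h'K; exists p^-1%g; first by rewrite groupV.
  by apply/funext => x; rewrite -{2}[x]h'K reorderK.
Qed.

Lemma good_line_tw x : good_line (line_pt (tw x).1).
Proof. by have [Dx _ _] := twP x; exists (tw x).1. Qed.

Definition to_line (x : N) : L := exist _ _ (good_line_tw x).

Lemma root_tw x i : (fibre f (tw x).1).[(tw x).2 i] = 0.
Proof. by have [Dx wx _] := twP x; apply/(enum_root _ Dx wx); exists i. Qed.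

Lemma good_curve_tw x : good_curve (pt (curve_row hh (tw x).1 ((tw x).2 ord0))).
Proof.
by have [Dx _ _] := twP x; exists (tw x).1, ((tw x).2 ord0); rewrite root_tw.
Qed.

Definition to_curve (x : N) : M := exist _ _ (good_curve_tw x).

Lemma xi_to_curve x : xio (to_curve x) = to_line x.
Proof.
have [Dx _ _] := twP x; apply: eq_exist => /=.
by have [] := cm_point Dx (root_tw x ord0).
Qed.

Lemma to_line_eq x y : to_line x = to_line y <->
  exists2 h, reorderings [set: 'S_d.+1] h & h x = y.
Proof.
split=> [/(congr1 sval)/line_pt_inj/reorder_transitive[p <-]|[_ [p _ ->] <-]].
  by exists (reorder p) => //; exists p; rewrite ?inE.
by apply: eq_exist; rewrite tw_reorder.
Qed.

(** An ordering is sent to its first point, so the group that keeps the image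
    is the stabilizer of the first index. *)
Lemma to_curve_eq x y : to_curve x = to_curve y <->
  exists2 h, reorderings 'C[ord0 | 'P]%G h & h x = y.
Proof.
have [Dx wx _] := twP x; have [Dy wy _] := twP y.
split=> [/(congr1 sval)|[_ [p pG ->] <-]]; last first.
  apply: eq_exist; rewrite tw_reorder /=.
  by move/astab1P: pG; rewrite /= apermE => ->.
move=> /(curve_pt_inj Dx (root_tw x _) Dy (root_tw y _))[tE uE].
have [p pE] := reorder_transitive tE; exists (reorder p) => //.
exists p => //; apply/astab1P; rewrite /= apermE.
by apply: (enum_inj Dx wx); rewrite uE -pE tw_reorder.
Qed.

Lemma ordered_point_exists t : Delta.[t] != 0 -> exists x, (tw x).1 = t.
Proof.
move=> Dt; have [w we] := cm_enum Dt.
by exists (ordered_point Dt we); rewrite tw_ordered_point.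
Qed.

Lemma to_line_surj y : exists x, to_line x = y.
Proof.
case: y => y [t Dt e]; have [x xt] := ordered_point_exists Dt.
by exists x; apply: eq_exist; rewrite e xt.
Qed.

Lemma to_curve_surj y : exists x, to_curve x = y.
Proof.
case: y => y [t [u [Dt fu e]]]; have [w we] := cm_enum Dt.
have [i ui] := (enum_root u Dt we).1 fu.
exists (ordered_point Dt (enumerates_perm (tperm ord0 i) we)).
by apply: eq_exist; rewrite tw_ordered_point /= tpermL e ui.
Qed.

Lemma to_line_equivariant : equivariant (to_line : N -> gm_res (dvdnn s) L).
Proof.
by move=> g x; apply: eq_exist; rewrite tw_act /= -gal_line_pt.
Qed.

Lemma to_curve_equivariant : equivariant (to_curve : N -> gm_res (dvdnn s) M).
Proof.
move=> g x; have [Dx _ _] := twP x.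
by apply: eq_exist; rewrite tw_act /= -gal_curve_pt ?root_tw.
Qed.

Lemma galois_closure_xi : @galois_closure F K s N s (dvdnn s) M L xio.
Proof.
split; [|exact: galois_curve_finite|].
  move=> /(finite_image (fun x => (tw x).1)) fin; apply: (@closed_field_infinite K).
  have : finite_set ([set (tw x).1 | x in [set: N]] `|` [set t | Delta.[t] = 0]).
    by rewrite finite_setU; split=> //; apply: finite_roots (cm_bad_neq0 cm).
  apply: sub_finite_set => t _; have [Dt|Dt] := eqVneq Delta.[t] 0; first by right.
  by left; have [x xt] := ordered_point_exists Dt; exists x.
exists (reorderings 'C[ord0 | 'P]%G), (reorderings [set: 'S_d.+1]%G).
exists (@reorderings_centralize _), (@reorderings_centralize _).
split; [split|split].
- exact: reorderings_group.
- exact: reorderings_group.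
- apply: (@sub_finite_set _ _ (reorder @` [set: 'S_d.+1])).
    by move=> _ [p _ ->]; exists p.
  exact/finite_image/finite_finset.
- by move=> _ [p _ ->]; exists p; rewrite ?inE.
- move=> _ [p _ ->] [g gE]; rewrite gE; apply/funext => x /=.
  (* The reordering fixes t, hence g fixes all good t. *)
  have gid a : g a = a.
    apply: (cofinite_fixed (cm_bad_neq0 cm)) => t Dt.
    have [y yt] := ordered_point_exists Dt.
    have := congr1 (fun h => (tw (h y)).1) gE.
    by rewrite tw_reorder tw_act /= yt.
  apply: tw_inj; rewrite tw_act; case: (tw x) => t w /=.
  by rewrite gid; congr (_, _); apply/funext => i; rewrite /= gid.
- rewrite (_ : [set z | _] = set0); first exact: finite_set0.
  apply/seteqP; split=> // x [_ [[p _ ->] /reorder_fixed-> nid]].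
  by apply: nid; apply/funext => y; rewrite reorder1.
have [a [a_bij aE aP]] := orbit_space_identification
  (@reorderings_centralize 'C[ord0 | 'P]%G) (reorderings_group _)
  to_curve_equivariant to_curve_surj to_curve_eq.
have [b [b_bij bE bP]] := orbit_space_identification
  (@reorderings_centralize [set: 'S_d.+1]%G) (reorderings_group _)
  to_line_equivariant to_line_surj to_line_eq.
exists a, b; split=> // z.
by rewrite bP aP -xi_to_curve.
Qed.

End Covering.

Theorem corollary21 (F : finFieldType) (K : closedFieldType)
    (iota : {rmorphism F -> K}) (algK : forall a : K, algebraicOver iota a)
    (n : nat) (X : set (proj K n)) (xi : proj K n -> proj K 1)
    (X_over : zclosed_over iota X) (X_irr : zirreducible X)
    (X_curve : has_dim X 1) (X_smooth : smooth X 1)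
    (xi_mor : is_morphism X [set: proj K 1] xi)
    (xi_finsep : finite_separable X [set: proj K 1] xi)
    (xi_surj : set_surj X [set: proj K 1] xi) :
  exists m : nat, (0 < m)%N /\
  exists (Xo : set (proj K n)) (Lo : set (proj K 1))
         (Xo_stable : gal_stable F m Xo) (Lo_stable : gal_stable F m Lo)
         (XoLo : forall x, Xo x -> Lo (xi x)),
    let M := proj_gmodule Xo_stable in
    let L := proj_gmodule Lo_stable in
    let xio : M -> L := restr XoLo in
    [/\ Xo `<=` X, finite_set (X `\` Xo), finite_set (~` Lo),
        exists2 d : nat, (0 < d)%N & finite_covering d xio &
        exists (s : nat) (ms : (m %| s)%N) (k : nat) (Zo : set (proj K k))
               (Zo_stable : gal_stable F s Zo),
          [/\ (0 < s)%N, quasi_projective Zo, has_dim Zo 1, smooth Zo 1 &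
              galois_closure (proj_gmodule Zo_stable) ms xio]].
Proof.
have closedX : zclosed X.
  have [S hS ->] := X_over; exists (map_mpoly iota @` S) => // _ [p /hS[d hp] <-].
  exists d; apply/dhomogP => m; rewrite mcoeff_msupp mcoeff_map_mpoly fmorph_eq0.
  by rewrite -mcoeff_msupp; apply: dhomog_mf.
have [irrX [irrY [L [phi [phi_bij phi_pull sepL]]]]] := xi_finsep.
have [y yP] := funfield_generic_point irrX.
have [z zP] := funfield_generic_point irrY.
have gp : generic_point X xi.
  exact: (generic_point_funfield xi_mor xi_surj phi_bij phi_pull sepL yP zP).
have [cm] := covering_model_exists gp X_irr closedX.
have [m m0 mfix] := frob_fixed_seq algK (cm_constants cm).
have gal_fix (g : Defs.gal F K m) a : a \in cm_constants cm -> g a = a.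
  by move=> /mfix; apply: gal_fix.
exists m; split=> //.
exists (good_curve cm), (good_line cm).
exists (good_curve_stable gal_fix), (good_line_stable gal_fix), (@xi_good _ _ _ _ cm).
split.
- by move=> x [t [u [Dt fu ->]]]; have [] := cm_point Dt fu.
- apply: sub_finite_set (cm_cofinite cm) => x [Xx nx]; split=> // -[[t u] /= [Dt fu] e].
  by apply: nx; exists t, u.
- have : finite_set ((@line_pt K @` [set t | (cm_bad cm).[t] = 0]) `|`
      [set pt (\row_(i < 2) (i != 0)%:R)]).
    rewrite finite_setU; split; last exact: finite_set1.
    exact/finite_image/finite_roots/cm_bad_neq0.
  apply: sub_finite_set => x nx.
  have [x0|x0] := eqVneq (coords x 0 0) 0; [right|left].
    rewrite /= -[x]coordsK; apply: pt_eq_cross; first exact: coords_neq0.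
      by apply/eqP => /rowP/(_ 1)/eqP; rewrite !mxE /= oner_eq0.
    have colP (i : 'I_2) : coords x 0 i = coords x 0 1 * (i != 0)%:R.
      case: i => [[|[|//]] lt]; rewrite -val_eqE /= ?mulr0 ?mulr1 -?x0.
        by congr (coords x 0 _); apply: val_inj.
      by congr (coords x 0 _); apply: val_inj.
    by move=> i j; rewrite !mxE (colP i) (colP j) mulrAC.
  have xE : x = line_pt (coords x 0 1 / coords x 0 0).
    rewrite {1}(pt_coord_ratio x0); congr pt; apply/rowP => i; rewrite !mxE.
    case: i => [[|[|//]] lt]; rewrite -val_eqE /=.
      by rewrite (_ : Ordinal lt = 0) ?divff //; apply: val_inj.
    by congr (coords x 0 _ / _); apply: val_inj.
  set t := _ / _ in xE; exists t => //=; apply/eqP; apply: contraT => Dt.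
  by case: nx; exists t.
- by exists (cm_deg cm).+1 => //; apply: finite_covering_xi.
exists m, (dvdnn m), 2%N, (galois_curve cm), (galois_curve_stable gal_fix).
have sepR := resolvent_separable (@cm_resolvent _ _ _ _ cm) (@cm_enum _ _ _ _ cm).
split=> //.
- exact: quasi_projective_plane_curve.
- exact: (has_dim_plane_curve (cm_bad_neq0 cm) (@cm_lead_res _ _ _ _ cm)
    (cm_irr cm) (cm_dvd cm) (@cm_lead_factor _ _ _ _ cm)).
- exact: (smooth_plane_curve (cm_bad_neq0 cm) (@cm_lead_res _ _ _ _ cm) sepR).
- exact: galois_closure_xi.
Qed.
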